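(* Let $S$ be an infinite discrete weakly cancellative semigroup and $\omega$ a weight on $S$ such that $\mathcal A=l^1(S,\omega)$ is Arens regular and $\mathcal A''$ is unital with unit $e_{\mathcal A''}$. Then $\mathcal A''$ is Connes-amenable (with predual $\mathcal A'$) if and only if there exists $M\in l^\infty(S\times S)'=(\mathcal A\hat\otimes\mathcal A)''$ such that: (1) $\langle M,(f_{gh}\Omega(g,h))_{(g,h)\in S\times S}\rangle=\langle e_{\mathcal A''},f\rangle$ for every $f=(f_g)_{g\in S}\in l^\infty(S)$; (2) $\langle M,(f(hk,g)\Omega(h,k)-f(h,kg)\Omega(k,g))_{(g,h)\in S\times S}\rangle=0$ for every $k\in S$ and every bounded function $f:S\times S\to\mathbb C$ which clusters on $S\times S$.
   Context: Weight: $\omega:S\to(0,\infty)$, $\omega(st)\le\omega(s)\omega(t)$; $\Omega(g,h)=\omega(gh)\omega(g)^{-1}\omega(h)^{-1}$; $l^1(S,\omega)$ is $l^1(S)$ with $\delta_g\star\delta_h=\Omega(g,h)\delta_{gh}$, dual $l^\infty(S)$. Weakly cancellative: $t\mapsto st$, $t\mapsto ts$ finite-to-one. $\mathcal A\hat\otimes\mathcal A=l^1(S\times S)$ with $\delta_g\otimes\delta_h\leftrightarrow\delta_{(g,h)}$, so $(\mathcal A\hat\otimes\mathcal A)'=l^\infty(S\times S)$. A function $f:I\times J\to\mathbb C$ clusters on $I\times J$ if $\lim_n\lim_m f(x_m,y_n)=\lim_m\lim_n f(x_m,y_n)$ whenever $(x_m)\subseteq I$, $(y_n)\subseteq J$ are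 sequences of distinct elements and both iterated limits exist. Arens regularity: the two Arens products on $\mathcal A''$ agree, making $\mathcal A''$ a dual Banach algebra with predual $\mathcal A'$. Connes-amenability: every weak$^*$-continuous derivation into a dual bimodule $E'$ whose module maps $b\mapsto b\cdot\mu,\mu\cdot b$ are weak$^*$–$\sigma(E',E)$ continuous is inner. *)

(* Defs.v *)
From HB Require Import structures.
From mathcomp Require Import all_boot all_order all_algebra.
From mathcomp Require Import complex.
From mathcomp Require Import boolp classical_sets cardinality reals topology normedtype.
Set Implicit Arguments. Unset Strict Implicit. Unset Printing Implicit Defensive.
Import Order.TTheory GRing.Theory Num.Theory.
Local Open Scope ring_scope.
Local Open Scope complex_scope.

Definition semigroup_assoc (S : Type) (mul : S -> S -> S) : Prop :=
  forall a b c, mul a (mul b c) = mul (mul a b) c.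

Definition weakly_cancellative (S : Type) (mul : S -> S -> S) : Prop :=
  forall s u, finite_set [set t | mul s t = u] /\ finite_set [set t | mul t s = u].

Definition is_weight (R : realType) (S : Type) (mul : S -> S -> S) (w : S -> R) : Prop :=
  (forall s, 0 < w s) /\ (forall s t, w (mul s t) <= w s * w t).

Definition Omega (R : realType) (S : Type) (mul : S -> S -> S) (w : S -> R)
  (g h : S) : R[i] := (w (mul g h) / (w g * w h))%:C.

Definition bdd (R : realType) (T : Type) (f : T -> R[i]) : Prop :=
  exists c : R[i], forall t, `|f t| <= c.

(* Phi is a bounded linear functional on l^oo(T) with bound C:
   |Phi f| <= C ||f||_oo, formulated without the sup. *)
Definition fun_bounded_by (R : realType) (T : Type) (Phi : (T -> R[i]) -> R[i])
  (C : R[i]) : Prop :=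
  forall (f : T -> R[i]) (d : R[i]), (forall t, `|f t| <= d) -> `|Phi f| <= C * d.

Definition lin_on_bdd (R : realType) (T : Type) (Phi : (T -> R[i]) -> R[i]) : Prop :=
  forall (f g : T -> R[i]) (a : R[i]), bdd f -> bdd g ->
    Phi (fun t => a * f t + g t) = a * Phi f + Phi g.

Definition in_linf_dual (R : realType) (T : Type) (Phi : (T -> R[i]) -> R[i]) : Prop :=
  lin_on_bdd Phi /\ exists C, 0 <= C /\ fun_bounded_by Phi C.

(* Elements of A'' = l^1(S,w)'' = l^oo(S)' are represented by functions
   (S -> C) -> C which are linear and bounded on bounded functions and are
   normalized to be 0 on unbounded functions (so that equality of elements of
   A'' is plain equality of functions). *)
Definition bidual (R : realType) (S : Type) (Phi : (S -> R[i]) -> R[i]) : Prop :=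
  in_linf_dual Phi /\ forall f, ~ bdd f -> Phi f = 0.

(* First Arens product: <Phi [] Psi, f> = <Phi, Psi . f>,
   where (Psi . f)(g) = <Psi, f . delta_g> and (f . delta_g)(h) = Omega(g,h) f(gh). *)
Definition arens1 (R : realType) (S : Type) (mul : S -> S -> S) (w : S -> R)
  (Phi Psi : (S -> R[i]) -> R[i]) : (S -> R[i]) -> R[i] :=
  fun f => if `[< bdd f >] then
             Phi (fun g => Psi (fun h => Omega mul w g h * f (mul g h)))
           else 0.

(* Second Arens product: <Phi <> Psi, f> = <Psi, f . Phi>,
   where (f . Phi)(g) = <Phi, delta_g . f> and (delta_g . f)(h) = Omega(h,g) f(hg). *)
Definition arens2 (R : realType) (S : Type) (mul : S -> S -> S) (w : S -> R)
  (Phi Psi : (S -> R[i]) -> R[i]) : (S -> R[i]) -> R[i] :=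
  fun f => if `[< bdd f >] then
             Psi (fun g => Phi (fun h => Omega mul w h g * f (mul h g)))
           else 0.

Definition arens_regular (R : realType) (S : Type) (mul : S -> S -> S) (w : S -> R) : Prop :=
  forall Phi Psi, bidual Phi -> bidual Psi -> arens1 mul w Phi Psi = arens2 mul w Phi Psi.

Definition bidual_unit (R : realType) (S : Type) (mul : S -> S -> S) (w : S -> R)
  (e : (S -> R[i]) -> R[i]) : Prop :=
  bidual e /\ forall Phi, bidual Phi ->
    arens1 mul w e Phi = Phi /\ arens1 mul w Phi e = Phi.

Definition bid_scale (R : realType) (S : Type) (a : R[i]) (Phi Psi : (S -> R[i]) -> R[i]) :
  (S -> R[i]) -> R[i] := fun f => a * Phi f + Psi f.

Definition directed (I : Type) (le : I -> I -> Prop) : Prop :=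
  (exists i : I, True) /\ (forall i, le i i) /\
  (forall i j k, le i j -> le j k -> le i k) /\
  (forall i j, exists k, le i k /\ le j k).

Definition net_cvg (R : realType) (I : Type) (le : I -> I -> Prop)
  (u : I -> R[i]) (l : R[i]) : Prop :=
  forall eps : R[i], 0 < eps -> exists i0, forall i, le i0 i -> `|u i - l| < eps.

Definition weakstar_cont (R : realType) (S : Type) (E : Type)
  (T : ((S -> R[i]) -> R[i]) -> E -> R[i]) : Prop :=
  forall (I : Type) (le : I -> I -> Prop) (Phis : I -> (S -> R[i]) -> R[i])
         (Phi : (S -> R[i]) -> R[i]),
    directed le -> (forall i, bidual (Phis i)) -> bidual Phi ->
    (forall f, bdd f -> net_cvg le (fun i => Phis i f) (Phi f)) ->
    forall x, net_cvg le (fun i => T (Phis i) x) (T Phi x).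

Definition banach_bimodule (R : realType) (S : Type) (mul : S -> S -> S) (w : S -> R)
  (E : completeNormedModType R[i])
  (lact : ((S -> R[i]) -> R[i]) -> E -> E)
  (ract : E -> ((S -> R[i]) -> R[i]) -> E) : Prop :=
  (forall Phi Psi a x, bidual Phi -> bidual Psi ->
     lact (bid_scale a Phi Psi) x = a *: lact Phi x + lact Psi x /\
     ract x (bid_scale a Phi Psi) = a *: ract x Phi + ract x Psi) /\
  (forall Phi a x y, bidual Phi ->
     lact Phi (a *: x + y) = a *: lact Phi x + lact Phi y /\
     ract (a *: x + y) Phi = a *: ract x Phi + ract y Phi) /\
  (exists C : R[i], 0 <= C /\ forall Phi c x, bidual Phi -> fun_bounded_by Phi c ->
     `|lact Phi x| <= C * c * `|x| /\ `|ract x Phi| <= C * c * `|x|) /\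
  (forall Phi Psi x, bidual Phi -> bidual Psi ->
     lact (arens1 mul w Phi Psi) x = lact Phi (lact Psi x) /\
     ract x (arens1 mul w Phi Psi) = ract (ract x Phi) Psi /\
     ract (lact Phi x) Psi = lact Phi (ract x Psi)).

Definition in_dual (R : realType) (E : normedModType R[i]) (mu : E -> R[i]) : Prop :=
  (forall a x y, mu (a *: x + y) = a * mu x + mu y) /\
  exists C : R[i], forall x, `|mu x| <= C * `|x|.

Definition dual_lact (R : realType) (S : Type) (E : Type)
  (ract : E -> ((S -> R[i]) -> R[i]) -> E)
  (Phi : (S -> R[i]) -> R[i]) (mu : E -> R[i]) : E -> R[i] :=
  fun x => mu (ract x Phi).
Definition dual_ract (R : realType) (S : Type) (E : Type)
  (lact : ((S -> R[i]) -> R[i]) -> E -> E)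
  (mu : E -> R[i]) (Phi : (S -> R[i]) -> R[i]) : E -> R[i] :=
  fun x => mu (lact Phi x).

Definition derivation (R : realType) (S : Type) (mul : S -> S -> S) (w : S -> R)
  (E : completeNormedModType R[i])
  (lact : ((S -> R[i]) -> R[i]) -> E -> E)
  (ract : E -> ((S -> R[i]) -> R[i]) -> E)
  (D : ((S -> R[i]) -> R[i]) -> E -> R[i]) : Prop :=
  (forall Phi, bidual Phi -> in_dual (D Phi)) /\
  (forall Phi Psi a, bidual Phi -> bidual Psi ->
     D (bid_scale a Phi Psi) = (fun x => a * D Phi x + D Psi x)) /\
  (forall Phi Psi, bidual Phi -> bidual Psi ->
     D (arens1 mul w Phi Psi) =
       (fun x => dual_lact ract Phi (D Psi) x + dual_ract lact (D Phi) Psi x)).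

Definition inner_derivation (R : realType) (S : Type) (E : completeNormedModType R[i])
  (lact : ((S -> R[i]) -> R[i]) -> E -> E)
  (ract : E -> ((S -> R[i]) -> R[i]) -> E)
  (D : ((S -> R[i]) -> R[i]) -> E -> R[i]) : Prop :=
  exists mu : E -> R[i], in_dual mu /\
    forall Phi, bidual Phi ->
      D Phi = (fun x => dual_lact ract Phi mu x - dual_ract lact mu Phi x).

Definition connes_amenable (R : realType) (S : Type) (mul : S -> S -> S) (w : S -> R) : Prop :=
  forall (E : completeNormedModType R[i])
         (lact : ((S -> R[i]) -> R[i]) -> E -> E)
         (ract : E -> ((S -> R[i]) -> R[i]) -> E),
    banach_bimodule mul w lact ract ->
    (forall mu : E -> R[i], in_dual mu ->
       weakstar_cont (fun Phi => dual_lact ract Phi mu) /\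
       weakstar_cont (fun Phi => dual_ract lact mu Phi)) ->
    forall D : ((S -> R[i]) -> R[i]) -> E -> R[i],
      derivation mul w lact ract D -> weakstar_cont D ->
      inner_derivation lact ract D.

Definition seq_cvg (R : realType) (u : nat -> R[i]) (l : R[i]) : Prop :=
  forall eps : R[i], 0 < eps -> exists N, forall n, (N <= n)%N -> `|u n - l| < eps.

Definition clusters (R : realType) (S : Type) (I J : set S) (f : S * S -> R[i]) : Prop :=
  forall (x y : nat -> S),
    (forall m, I (x m)) -> (forall n, J (y n)) ->
    injective x -> injective y ->
    forall (L1 : nat -> R[i]) (l1 : R[i]) (L2 : nat -> R[i]) (l2 : R[i]),
      (forall m, seq_cvg (fun n => f (x m, y n)) (L1 m)) -> seq_cvg L1 l1 ->
      (forall n, seq_cvg (fun m => f (x m, y n)) (L2 n)) -> seq_cvg L2 l2 ->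
      l2 = l1.

(* Main.v *)
(** From a functional [M] as in (1)-(2), a derivation [D] is implemented by [nu = mu0 + e.De - De],
    where [mu0 x] is [M] applied to [(g, h) |-> <D delta_h, x . delta_g>].  This function clusters
    because [D] and the actions are weak*-continuous, so (2) gives [delta_k . mu0 - mu0 . delta_k],
    and weak*-density of the point masses gives the rest.

    Conversely, let [E] be the Banach space of bounded [F] on [S * S] with [Phi_s Psi_t F = Psi_t Phi_s F]
    for all [Phi, Psi] in [A'']; by Grothendieck's double limit criterion these are the clustering
    functions.  [E] is an [A'']-bimodule under [(F . Phi)(g, h) = Phi_k (Om k g * F (k g, h))] and
    [(Phi . F)(g, h) = Phi_k (Om h k * F (g, h k) - Om g h * F (g h, k))], and
    [D Phi F = e_s Phi_t F] is a derivation.  Its dual is normal because Arens regularity makes [Om]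
    cluster to zero (Craw-Young), which lets products [Om g h * F (g h, _)] inherit the double limit
    condition.  If [D] is implemented by [mu], and [mt] is a Hahn-Banach extension of [mu] to all
    bounded functions, then [M f = mt (f - Om * e_t f(g h, t)) + e_s e_t f] satisfies (1)-(2). *)
Require Import Defs.
From Stdlib Require List.
From HB Require Import structures.
From mathcomp Require Import all_boot all_order all_algebra.
From mathcomp Require Import complex.
From mathcomp Require Import boolp classical_sets functions cardinality reals topology normedtype.
From mathcomp Require Import ring.
Set Implicit Arguments. Unset Strict Implicit. Unset Printing Implicit Defensive.
Import Order.TTheory GRing.Theory Num.Theory numFieldNormedType.Exports.
Local Open Scope ring_scope.
Local Open Scope complex_scope.

(** * Bounded functions and their dual *)

(** The left action on [E] is dictated by the other direction: when [x] is replaced by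
    [delta_k . x], the derivation rule transforms [(g, h) |-> <D delta_h, x . delta_g>] by exactly
    this formula, correction term included. The summand [e . De - De] of [nu] is there because
    modules need not be unital: [mu0] only implements [Phi |-> e . D Phi], and the missing part
    [D Phi - e . D Phi] equals [De . Phi]. In the converse, [f |-> f - Om * e_t f(g h, t)] projects
    onto the functions that [e] annihilates in the second variable. It kills the functions of (1),
    where only [e_s e_t f] survives; in (2) the two terms of [M] cancel because [mu] implements [D].
    Normality of [E'] is the obstacle: a functional on [l^oo(S * S)] must be interchanged with
    [Phi], so the pair [(g, h)] counts as one variable, and the double limit condition for it does
    not follow from that for [F] alone. All double limits are taken along one free ultrafilter:
    limits of bounded sequences then always exist, and iterated limits are instances of iterated
    functionals. *)

Lemma dep_seq (T : Type) (P : seq T -> T -> Prop) :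
  (forall s, exists t, P s t) -> exists u : nat -> T, forall k, P (mkseq u k) (u k).
Proof.
move=> /choice[c cP].
(* [h n] lists the first [n] terms, so each term can be chosen subject to conditions on all earlier
   ones; the diagonal constructions below have this form. *)
pose h := fix h n := if n is m.+1 then rcons (h m) (c (h m)) else [::].
exists (fun n => c (h n)) => k.
suff -> : mkseq (fun n => c (h n)) k = h k by exact: cP.
by elim: k => //= k IH; rewrite mkseqS IH.
Qed.

Section ComplexEstimates.
Variable R : realType.
Local Notation C := R[i].

Lemma norm_leNlt (z e : C) : 0 <= e -> (e <= `|z|) = ~~ (`|z| < e).
Proof. by move=> e0; rewrite real_ltNge ?negbK ?normr_real ?ger0_real. Qed.

(** Positive elements of [R[i]] are real, which brings in the Archimedean property of [R]. *)
Lemma eps_inv (e : C) : 0 < e -> exists n, n.+1%:R^-1 < e.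
Proof.
move=> e0; have eE : e = (complex.Re e)%:C by rewrite RRe_real ?gtr0_real.
have : 0 < complex.Re e by rewrite -ltcR -eE.
move=> /ltr_add_invr[k]; rewrite add0r => kP; exists k.
by rewrite eE -(rmorph_nat (real_complex R)) -fmorphV ltcR.
Qed.

Lemma le_eps_eq0 (z : C) : (forall e, 0 < e -> `|z| <= e) -> z = 0.
Proof.
move=> h; apply/eqP; apply: contraT => z0.
have zp : 0 < `|z| / 2 by rewrite divr_gt0 ?normr_gt0 ?ltr0n.
have := h _ zp; rewrite ler_pdivlMr ?ltr0n// mulr_natr mulr2n.
by rewrite -subr_ge0 opprD addrA subrr add0r oppr_ge0 normr_le0 (negPf z0).
Qed.

End ComplexEstimates.

Section BoundedFunctions.
Local Open Scope classical_set_scope.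
Variables (R : realType).
Local Notation C := R[i].
Implicit Type T : Type.

Lemma bddP T (f : T -> C) : bdd f -> exists2 c, 0 < c & forall t, `|f t| <= c.
Proof.
(* For empty [T] the bound [c] is an arbitrary complex number; [|c| + 1] is positive in any case. *)
move=> [c fc]; exists (`|c| + 1); first by rewrite ltr_wpDl ?normr_ge0.
move=> t; have c0 : 0 <= c := le_trans (normr_ge0 _) (fc t).
by rewrite (ger0_norm c0) (le_trans (fc t))// lerDl ler01.
Qed.

Lemma bdd_cst T (a : C) : bdd (fun _ : T => a).
Proof. by exists `|a|. Qed.

Lemma bddD T (f g : T -> C) : bdd f -> bdd g -> bdd (fun t => f t + g t).
Proof.
move=> [c fc] [d gd]; exists (c + d) => t.
by rewrite (le_trans (ler_normD _ _))// lerD.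
Qed.

Lemma bddM T (f g : T -> C) : bdd f -> bdd g -> bdd (fun t => f t * g t).
Proof.
move=> [c fc] [d gd]; exists (c * d) => t.
by rewrite normrM ler_pM.
Qed.

Lemma bddZ T a (f : T -> C) : bdd f -> bdd (fun t => a * f t).
Proof. by apply: bddM; exact: bdd_cst. Qed.

Lemma bddN T (f : T -> C) : bdd f -> bdd (fun t => - f t).
Proof. by move=> [c fc]; exists c => t; rewrite normrN. Qed.

Lemma bddB T (f g : T -> C) : bdd f -> bdd g -> bdd (fun t => f t - g t).
Proof. by move=> bf /bddN; exact: bddD. Qed.

Lemma bdd_sum T (I : Type) (s : seq I) (f : I -> T -> C) :
  (forall i, bdd (f i)) -> bdd (fun t => \sum_(i <- s) f i t).
Proof.
move=> bf; elim: s => [|i s IH].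
  by exists 0 => t; rewrite big_nil normr0.
have [c hc] := bddD (bf i) IH.
by exists c => t; rewrite big_cons.
Qed.

Definition ind T (A : set T) (t : T) : C := if `[< A t >] then 1 else 0.

Lemma ind1 T (A : set T) t : A t -> ind A t = 1.
Proof. by rewrite /ind => /asboolT ->. Qed.

Lemma ind0 T (A : set T) t : ~ A t -> ind A t = 0.
Proof. by rewrite /ind => /asboolF ->. Qed.

Lemma norm_ind T (A : set T) t : `|ind A t| <= 1.
Proof. by rewrite /ind; case: ifP => _; rewrite ?normr1 ?normr0. Qed.

Lemma bdd_ind T (A : set T) : bdd (ind A).
Proof. by exists 1 => t; exact: norm_ind. Qed.

Definition supn T (f : T -> C) : R := sup (range (fun t => complex.Re `|f t|)).

Lemma ReK_norm (z : C) : (complex.Re `|z|)%:C = `|z|.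
Proof. by rewrite RRe_real ?normr_real. Qed.

Lemma supn_ub T (f : T -> C) t : bdd f -> `|f t| <= (supn f)%:C.
Proof.
move=> /bddP[c c0 fc]; rewrite -ReK_norm lecR; apply: ub_le_sup; last by exists t.
exists (complex.Re c) => _ [s _ <-]; rewrite -lecR ReK_norm.
by rewrite RRe_real ?gtr0_real.
Qed.

Lemma supn_le T (f : T -> C) d : 0 <= d -> (forall t, `|f t| <= d) -> (supn f)%:C <= d.
Proof.
move=> d0 fd; rewrite /supn; have [->|] := eqVneq (range (fun t => complex.Re `|f t|)) set0.
  by rewrite sup0.
move=> /set0P ne; have dE : d = (complex.Re d)%:C by rewrite RRe_real ?ger0_real.
rewrite dE lecR; apply: ge_sup => // _ [t _ <-].
by rewrite -lecR ReK_norm -dE.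
Qed.

Lemma supn_ge0 T (f : T -> C) : bdd f -> 0 <= supn f.
Proof.
move=> bf; have [[t _]|nT] := pselect (exists t : T, True).
  by rewrite -ler0c (le_trans (normr_ge0 (f t)))// supn_ub.
have E : range (fun t => complex.Re `|f t|) = set0.
  by rewrite -subset0 => y [t _ _]; case: nT; exists t.
by rewrite /supn E sup0.
Qed.

Section Functional.
Variables (T : Type) (Phi : (T -> C) -> C).
Hypothesis hPhi : in_linf_dual Phi.

Lemma linf_bound :
  exists2 c, 0 < c & forall f d, 0 <= d -> (forall t, `|f t| <= d) -> `|Phi f| <= c * d.
Proof.
have [_ [c [c0 cP]]] := hPhi; exists (c + 1); first by rewrite ltr_wpDl.
move=> f d d0 fd; rewrite (le_trans (cP _ _ fd))// ler_wpM2r// lerDl.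
exact: ler01.
Qed.

Lemma linfP a (f g : T -> C) : bdd f -> bdd g ->
  Phi (fun t => a * f t + g t) = a * Phi f + Phi g.
Proof. exact: hPhi.1. Qed.

Lemma linfD (f g : T -> C) : bdd f -> bdd g ->
  Phi (fun t => f t + g t) = Phi f + Phi g.
Proof.
move=> bf bg; rewrite -[Phi f]mul1r -linfP//.
by congr Phi; apply/funext => t; rewrite mul1r.
Qed.

Lemma linf0 : Phi (fun=> 0) = 0.
Proof.
have b := bdd_cst T (0 : C).
by have /eqP := linfD b b; rewrite addr0 -subr_eq0 opprD addrA subrr sub0r oppr_eq0 => /eqP.
Qed.

Lemma linfZ a (f : T -> C) : bdd f -> Phi (fun t => a * f t) = a * Phi f.
Proof.
move=> bf; rewrite -[RHS]addr0 -linf0 -linfP//; last exact: bdd_cst.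
by congr Phi; apply/funext => t; rewrite addr0.
Qed.

Lemma linfB (f g : T -> C) : bdd f -> bdd g ->
  Phi (fun t => f t - g t) = Phi f - Phi g.
Proof.
move=> bf bg; rewrite linfD//; last exact: bddN.
congr (_ + _); rewrite -mulN1r -linfZ//.
by congr Phi; apply/funext => t; rewrite mulN1r.
Qed.

Lemma linf_sum (I : Type) (s : seq I) (f : I -> T -> C) : (forall i, bdd (f i)) ->
  Phi (fun t => \sum_(i <- s) f i t) = \sum_(i <- s) Phi (f i).
Proof.
move=> bf; elim: s => [|i s IH].
  by rewrite big_nil -[RHS]linf0; congr Phi; apply/funext => t; rewrite big_nil.
rewrite big_cons -IH -linfD//; last exact: bdd_sum.
by congr Phi; apply/funext => t; rewrite big_cons.
Qed.

End Functional.

Definition bdd2 (X Y : Type) (f : X -> Y -> C) := exists c, forall x y, `|f x y| <= c.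

Lemma bdd2l X Y (f : X -> Y -> C) x : bdd2 f -> bdd (f x).
Proof. by move=> [c fc]; exists c. Qed.

Lemma bdd2r X Y (f : X -> Y -> C) y : bdd2 f -> bdd (f^~ y).
Proof. by move=> [c fc]; exists c. Qed.

Lemma bdd2C X Y (f : X -> Y -> C) : bdd2 f -> bdd2 (fun y x => f x y).
Proof. by move=> [c fc]; exists c. Qed.

Lemma bdd2M X Y (f g : X -> Y -> C) :
  bdd2 f -> bdd2 g -> bdd2 (fun x y => f x y * g x y).
Proof.
move=> [c fc] [d gd]; exists (c * d) => x y.
by rewrite normrM ler_pM.
Qed.

Lemma bdd2P X Y (f : X -> Y -> C) :
  bdd2 f -> exists2 c, 0 < c & forall x y, `|f x y| <= c.
Proof.
move=> [c fc]; have [|d d0 dP] := @bddP _ (fun p : X * Y => f p.1 p.2).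
  by exists c => -[].
by exists d => // x y; exact: (dP (x, y)).
Qed.

Lemma bdd2_fun X Y (f : X -> Y -> C) (Psi : (Y -> C) -> C) :
  bdd2 f -> in_linf_dual Psi -> bdd (fun x => Psi (f x)).
Proof.
move=> /bdd2P[c c0 fc] /linf_bound[d d0 dP]; exists (d * c) => x.
by apply: dP => //; exact: ltW.
Qed.

End BoundedFunctions.

(** * Limits along a free ultrafilter on the natural numbers *)

Section FreeUltrafilter.
Local Open Scope classical_set_scope.
Variable R : realType.
Local Notation C := R[i].

Lemma free_ultrafilter_ex :
  exists U : set_system nat, UltraFilter U /\ forall N, U [set n | (N <= n)%N].
Proof.
have [U [uU sU]] := @ultraFilterLemma nat \oo _.
by exists U; split => // N; apply: sU; exists N.
Qed.

Definition FU : set_system nat := projT1 (cid free_ultrafilter_ex).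

#[local] Instance FU_ultra : UltraFilter FU.
Proof. by rewrite /FU; case: cid => ? []. Qed.

#[local] Instance FU_proper : ProperFilter FU.
Proof. exact: ultra_proper. Qed.

Lemma FU_free N : FU [set n | (N <= n)%N].
Proof. by rewrite /FU; case: cid => U [uU h]; exact: h. Qed.

Lemma FU_ex (A : set nat) : FU A -> exists n, A n.
Proof. by move=> /filter_ex[n]; exists n. Qed.

Lemma FU_setC (A : set nat) : ~ FU A -> FU (~` A).
Proof. by case: (in_ultra_setVsetC A FU_ultra). Qed.

Lemma FU_all (T : Type) (P : T -> set nat) (s : seq T) :
  (forall x, List.In x s -> FU (P x)) -> FU [set n | forall x, List.In x s -> P x n].
Proof.
elim: s => [|x s IH] h; first by apply: filterS filterT => n _ x [].
have h1 := h x (or_introl erefl).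
have h2 := IH (fun y ys => h y (or_intror ys)).
by apply: filterS (filterI h1 h2) => n [? hs] y [<-//|]; exact: hs.
Qed.

Definition ucvg (u : nat -> C) (l : C) :=
  forall e : C, 0 < e -> FU [set n | `|u n - l| < e].

(** The limit is the supremum of the [t] with [t <= u n] for [FU]-many [n]: for any [t] above it,
    maximality of [FU] gives [u n < t] for [FU]-many [n]. *)
Lemma ucvg_realex (u : nat -> R) (c : R) : (forall n, `|u n| <= c) ->
  exists l, forall e : R, 0 < e -> FU [set n | `|u n - l| < e].
Proof.
move=> uc; pose S := [set t | FU [set n | t <= u n]]%classic.
have S0 : S (- c).
  by apply: filterS filterT => n _ /=; have := uc n; rewrite ler_norml => /andP[].
have hS : has_sup S.
  split; first by exists (- c).
  exists c => t /FU_ex[n] /= tn; apply: (le_trans tn).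
  exact: le_trans (ler_norm _) (uc n).
exists (sup S) => e e0.
have [t St tl] := sup_adherent e0 hS.
have nS : ~ S (sup S + e).
  by move=> /(ub_le_sup hS.2); rewrite gerDl leNgt e0.
have := FU_setC nS; apply: filterS2 St => n /= tn /negP; rewrite -ltNge => un.
rewrite ltr_norml; apply/andP; split; last by rewrite ltrBlDl.
by rewrite ltrBrDl; exact: lt_le_trans tl tn.
Qed.

Lemma ucvg_ex (u : nat -> C) : bdd u -> exists l, ucvg u l.
Proof.
move=> /bddP[c c0 uc].
have cE : c = (complex.Re c)%:C by rewrite RRe_real ?gtr0_real.
have reb n : `|complex.Re (u n)| <= complex.Re c.
  by rewrite -lecR -cE (le_trans _ (uc n))// normc_ge_Re.
have imb n : `|complex.Im (u n)| <= complex.Re c.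
  rewrite -lecR -cE (le_trans _ (uc n))//.
  have := normc_ge_Re (u n * 'i%C); rewrite ReiNIm normrN normrM.
  by rewrite (_ : `|'i%C : C| = 1) ?mulr1// normc_def /= expr0n/= add0r expr1n sqrtr1.
have [a ha] := ucvg_realex reb; have [b hb] := ucvg_realex imb.
exists (a +i* b) => e e0.
have eE : e = (complex.Re e)%:C by rewrite RRe_real ?gtr0_real.
have e2 : 0 < complex.Re e / 2 by rewrite divr_gt0 ?ltr0n// -ltcR -eE.
apply: filterS2 (ha _ e2) (hb _ e2) => n /= an bn.
rewrite eE (complexE (u n - _)) (le_lt_trans (ler_normD _ _))//.
rewrite normrM (_ : `|'i%C : C| = 1) ?mul1r; last first.
  by rewrite normc_def /= expr0n/= add0r expr1n sqrtr1.
have nr (x : R) : `|x%:C| = `|x|%:C by rewrite normc_def /= expr0n addr0 sqrtr_sqr.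
rewrite !nr -rmorphD/= ltcR [ltRHS]splitr.
by case: (u n) an bn => x y /= an bn; rewrite ltrD.
Qed.

Definition ulim (u : nat -> C) : C := xget 0 [set l | ucvg u l].

Lemma ulimP (u : nat -> C) : bdd u -> ucvg u (ulim u).
Proof. by move=> /ucvg_ex[l ul]; exact: (xgetI 0 ul). Qed.

Lemma ucvg_unique u l l' : ucvg u l -> ucvg u l' -> l = l'.
Proof.
move=> ul ul'; apply/eqP; rewrite -subr_eq0; apply/eqP/le_eps_eq0 => e e0.
have e2 : 0 < e / 2 by rewrite divr_gt0 ?ltr0n.
have [n /= [h1 h2]] := FU_ex (filterI (ul _ e2) (ul' _ e2)).
rewrite -(subrKA (u n)) (le_trans (ler_normD _ _))// [leRHS]splitr.
by rewrite lerD// ltW// distrC.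
Qed.

Lemma ulimE u l : ucvg u l -> ulim u = l.
Proof. by move=> ul; apply: (ucvg_unique _ ul); exact: (xgetI 0 ul). Qed.

Lemma seq_ucvg u l : seq_cvg u l -> ucvg u l.
Proof.
move=> ul e /ul[N hN]; apply: filterS (FU_free N) => n /=; exact: hN.
Qed.

Lemma eq_ulim (u v : nat -> C) : FU [set n | u n = v n] -> ulim u = ulim v.
Proof.
move=> uv; suff E : ucvg u = ucvg v by rewrite /ulim E.
apply/funext => l; rewrite propeqE; split=> h e /h; apply: filterS2 uv => n /= ->//.
Qed.

Lemma ucvg_cst a : ucvg (fun=> a) a.
Proof. by move=> e e0; apply: filterS filterT => n _ /=; rewrite subrr normr0. Qed.

Lemma ucvgD u v a b : ucvg u a -> ucvg v b -> ucvg (fun n => u n + v n) (a + b).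
Proof.
move=> ua vb e e0; have e2 : 0 < e / 2 by rewrite divr_gt0 ?ltr0n.
apply: filterS2 (ua _ e2) (vb _ e2) => n /= h1 h2.
rewrite opprD addrACA (le_lt_trans (ler_normD _ _))// [ltRHS]splitr.
exact: ltrD.
Qed.

Lemma ucvgM u v a b : ucvg u a -> ucvg v b -> ucvg (fun n => u n * v n) (a * b).
Proof.
move=> ua vb e e0.
pose d : C := `|a| + `|b| + 1.
have d0 : 0 < d by rewrite ltr_wpDl ?addr_ge0 ?normr_ge0 ?ltr01.
have e1 : 0 < e / (d * 2) by rewrite divr_gt0 ?mulr_gt0 ?ltr0n.
have e3 : 0 < (1 : C) by exact: ltr01.
apply: filterS3 (ua _ e1) (vb _ e1) (ua _ e3) => n /= h1 h2 h3.
have -> : u n * v n - a * b = u n * (v n - b) + (u n - a) * b.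
  by rewrite mulrBr mulrBl addrA subrK.
have und : `|u n| <= d.
  have := ler_normD (u n - a) a; rewrite subrK => /le_trans; apply.
  by rewrite addrC /d -addrA lerD2l (le_trans (ltW h3))// lerDr.
rewrite (le_lt_trans (ler_normD _ _))// !normrM [ltRHS]splitr.
have E : e / 2 = d * (e / (d * 2)).
  by rewrite invfM mulrCA [X in _ = e * X]mulrA divff ?mul1r// gt_eqF.
rewrite ltr_leD// E.
  by rewrite (le_lt_trans (ler_wpM2r (normr_ge0 _) und))// ltr_pM2l.
rewrite mulrC ler_pM//; last exact: ltW.
by rewrite /d addrAC lerDr addr_ge0.
Qed.

Lemma ulim_cst a : ulim (fun=> a) = a.
Proof. exact: ulimE (ucvg_cst a). Qed.

Lemma ulim_seq u l : seq_cvg u l -> ulim u = l.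
Proof. by move=> /seq_ucvg/ulimE. Qed.

Lemma ulimD u v : bdd u -> bdd v -> ulim (fun n => u n + v n) = ulim u + ulim v.
Proof. by move=> bu bv; apply: ulimE; apply: ucvgD; exact: ulimP. Qed.

Lemma ulimM u v : bdd u -> bdd v -> ulim (fun n => u n * v n) = ulim u * ulim v.
Proof. by move=> bu bv; apply: ulimE; apply: ucvgM; exact: ulimP. Qed.

Lemma ulimZ a u : bdd u -> ulim (fun n => a * u n) = a * ulim u.
Proof.
by move=> bu; rewrite ulimM ?ulim_cst//; exact: bdd_cst.
Qed.

Lemma ulimB u v : bdd u -> bdd v -> ulim (fun n => u n - v n) = ulim u - ulim v.
Proof.
move=> bu bv; rewrite ulimD//; last exact: bddN.
by congr (_ + _); rewrite -mulN1r -ulimZ//; congr ulim; apply/funext => n; rewrite mulN1r.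
Qed.

Lemma ucvg_norm_le u l d : 0 <= d -> ucvg u l -> FU [set n | `|u n| <= d] -> `|l| <= d.
Proof.
move=> d0 ul ud; have dR := ger0_real d0.
rewrite real_leNgt ?normr_real//; apply/negP => ld.
have e0 : 0 < `|l| - d by rewrite subr_gt0.
have [n /= [h1 h2]] := FU_ex (filterI (ul _ e0) ud).
have := le_lt_trans (lerB_dist l (u n)) (_ : `|l - u n| < `|l| - d).
rewrite distrC => /(_ h1); rewrite ltrD2l ltrN2 => /lt_le_trans/(_ h2).
by rewrite ltxx.
Qed.

Lemma ulim_norm_le u d : 0 <= d -> (forall n, `|u n| <= d) -> `|ulim u| <= d.
Proof.
move=> d0 ud; apply: (ucvg_norm_le d0 (ulimP _)); first by exists d.
by apply: filterS filterT => n _ /=; exact: ud.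
Qed.

Lemma ulim_norm_ge u d : bdd u -> 0 <= d -> FU [set n | d <= `|u n|] -> d <= `|ulim u|.
Proof.
move=> bu d0 ud; have dR := ger0_real d0.
rewrite real_leNgt ?normr_real//; apply/negP => ld.
have e0 : 0 < d - `|ulim u| by rewrite subr_gt0.
have [n /= [h1 h2]] := FU_ex (filterI (ulimP bu e0) ud).
have : `|u n| < d.
  rewrite -[u n](subrK (ulim u)) (le_lt_trans (ler_normD _ _))//.
  by rewrite -ltrBrDr.
by move=> /(le_lt_trans h2); rewrite ltxx.
Qed.

Lemma bdd_ulim X (f : X -> nat -> C) : bdd2 f -> bdd (fun x => ulim (f x)).
Proof.
move=> /bdd2P[c c0 fc]; exists c => x; apply: ulim_norm_le => //.
exact: ltW.
Qed.

(** Provides weak* cluster points of norm-bounded sequences of functionals directly, the uniform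
    bound [K] passing to the limit. *)
Lemma ulim_linf (X : Type) (A : nat -> (X -> C) -> C) (K : C) : 0 <= K ->
  (forall n, lin_on_bdd (A n)) -> (forall n, fun_bounded_by (A n) K) ->
  in_linf_dual (fun g => ulim (fun n => A n g)).
Proof.
move=> K0 Al Ab.
have bA g : bdd g -> bdd (fun n => A n g).
  by move=> [d gd]; exists (K * d) => n; exact: Ab.
split=> [f g a bf bg|].
  transitivity (ulim (fun n => a * A n f + A n g)).
    by congr ulim; apply/funext => n; rewrite Al.
  by rewrite ulimD ?ulimZ//; [exact: bA|apply: bddZ; exact: bA|exact: bA].
exists K; split=> // f d fd.
have h n : `|A n f| <= K * d by exact: Ab.
by apply: ulim_norm_le => //; exact: le_trans (normr_ge0 _) (h 0%N).
Qed.

(** Members of [FU] meet every tail, so estimates valid along [FU] can be realized along an ordinary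
    sequence of indices. *)
Lemma seq_cvg_extract (P : nat -> set nat) : (forall k, FU (P k)) ->
  exists phi : nat -> nat, (forall k, (k <= phi k)%N) /\ forall k, P k (phi k).
Proof.
move=> hP.
have /choice[phi hphi] k : exists n, (k <= n)%N /\ P k n.
  by have [n [? ?]] := FU_ex (filterI (FU_free k) (hP k)); exists n.
by exists phi; split=> k; case: (hphi k).
Qed.

End FreeUltrafilter.

(** * Dominated convergence for functionals on bounded functions *)

Section DominatedConvergence.
Variable R : realType.
Local Notation C := R[i].
#[local] Existing Instance FU_ultra.
#[local] Existing Instance FU_proper.
Local Open Scope classical_set_scope.
Variables (Y : Type) (Psi : (Y -> C) -> C).
Hypothesis hPsi : in_linf_dual Psi.

(** A substitute for [|Psi|(A) >= d], with [|Psi|] the total variation of the finitely additive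
    measure behind [Psi]. *)
Definition charged (d : C) (A : set Y) := exists h : Y -> C,
  [/\ forall y, `|h y| <= 1, forall y, ~ A y -> h y = 0 & d <= `|Psi h|].

Lemma chargedS d (A B : set Y) : A `<=` B -> charged d A -> charged d B.
Proof.
by move=> AB [h [h1 hA hd]]; exists h; split=> // y nB; apply: hA => /AB.
Qed.

Lemma charged_ex d A : 0 < d -> charged d A -> exists y, A y.
Proof.
move=> d0 [h [h1 hA hd]]; apply: contrapT => nA.
have E : h = fun=> 0 by apply/funext => y; apply: hA => Ay; apply: nA; exists y.
move: hd; rewrite E linf0// normr0 => /(lt_le_trans d0).
by rewrite ltxx.
Qed.

Definition disjointed (A : nat -> set Y) (i : nat) : set Y :=
  [set y | A i y /\ forall j, (j < i)%N -> ~ A j y].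

Lemma disjointed_sum (A : nat -> set Y) n y :
  \sum_(j < n) ind R (disjointed A j) y = ind R [set y | exists2 j, (j < n)%N & A j y] y.
Proof.
elim: n => [|n IH].
  by rewrite big_ord0 ind0// => -[].
rewrite big_ord_recr/= IH.
have [[j jn Aj]|nA] := pselect (exists2 j, (j < n)%N & A j y).
  rewrite (@ind0 _ _ (disjointed A n)) ?addr0; last by move=> [_ /(_ _ jn)].
  by rewrite !ind1//; exists j => //; exact: leqW.
rewrite (@ind0 _ _ [set y | exists2 j, (j < n)%N & A j y])// add0r.
have [An|nAn] := pselect (A n y).
  rewrite !ind1//; first by exists n.
  by split=> // j jn Aj; apply: nA; exists j.
rewrite !ind0//; last by case.
move=> [j]; rewrite ltnS leq_eqVlt => /orP[/eqP->//|jn Aj].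
by apply: nA; exists j.
Qed.

Lemma disjointed_sum_norm (A : nat -> set Y) (h : nat -> Y -> C) n y :
  (forall i y, `|h i y| <= 1) ->
  `|\sum_(j < n) h j y * ind R (disjointed A j) y| <= 1.
Proof.
move=> h1; suff : `|\sum_(j < n) h j y * ind R (disjointed A j) y| <= 1 /\
   ((forall j, (j < n)%N -> ~ A j y) ->
      \sum_(j < n) h j y * ind R (disjointed A j) y = 0) by case.
elim: n => [|n [IH IH0]]; first by rewrite big_ord0 normr0 ler01.
rewrite big_ord_recr/=.
have [dn|ndn] := pselect (disjointed A n y); last first.
  rewrite (ind0 _ ndn) mulr0 addr0; split=> // h0; apply: IH0 => j jn.
  by apply: h0; exact: leqW.
rewrite IH0; last by case: dn.
rewrite add0r; split.
  by rewrite normrM mulr_ile1 ?normr_ge0// norm_ind.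
by move=> /(_ n (ltnSn n)); case: dn.
Qed.

(* Bonferroni: if the sets [A (u i)] had small pairwise intersections, their
   charges would add up to more than the norm of [Psi]. *)
Lemma charged_pair (A : nat -> set Y) (d : C) (B : set nat) : 0 < d ->
  FU [set n | charged d (A n)] -> FU B ->
  exists2 m, B m & exists2 d', 0 < d' & FU [set n | charged d' (A m `&` A n)].
Proof.
move=> d0 Ad BU; apply: contrapT => hN.
have [K K0 hK] := linf_bound hPsi.
(* With [N = r.+1] sets, charges of at least [d] each add up to more than the norm bound [K] plus an
   error of [1]. *)
have [r hr] : exists r : nat, K + 1 < r.+1%:R * d.
  have [|r hr] := @eps_inv _ (d / (K + 1)).
    by rewrite divr_gt0// ltr_wpDl// ltW.
  exists r; move: hr; rewrite ltr_pdivlMr ?ltr_wpDl ?ltW//.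
  by rewrite mulrC ltr_pdivrMr ?ltr0n// mulrC.
set N := r.+1 in hr.
(* Making [N] functions disjointly supported costs at most [N * d'] for each, hence [1] in all. *)
pose d' : C := (N%:R * N%:R)^-1.
have d'0 : 0 < d' by rewrite invr_gt0 mulr_gt0// ltr0n.
have nch m : B m -> FU [set n | ~ charged d' (A m `&` A n)].
  by move=> Bm; apply: FU_setC => h; apply: hN; exists m => //; exists d'.
pose P (s : seq nat) n := [/\ B n, charged d (A n) &
   forall m, List.In m s -> B m -> ~ charged d' (A m `&` A n)].
have [|u hu] := @dep_seq nat P.
  move=> s; have : FU [set n | forall m, List.In m s -> B m -> ~ charged d' (A m `&` A n)].
    apply: (@FU_all _ (fun m => [set n | B m -> ~ charged d' (A m `&` A n)])) => m _.
    have [Bm|nBm] := pselect (B m); last first.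
      by apply: filterS filterT => n _ /nBm.
    by apply: filterS (nch m Bm) => n /= h _.
  by move=> h; have [n [? [? ?]]] := FU_ex (filterI BU (filterI Ad h)); exists n.
have uB k : B (u k) by case: (hu k).
have upair i j : (j < i)%N -> ~ charged d' (A (u j) `&` A (u i)).
  move=> ji; case: (hu i) => _ _; apply => //.
  rewrite /mkseq; apply: List.in_map.
  have : j \in iota 0 i by rewrite mem_iota.
  by elim: (iota 0 i) => //= x s IH; rewrite inE => /orP[/eqP->|/IH]; [left|right].
pose A' i := A (u i).
(* A unimodular factor makes every [Psi (h i)] positive, so that the charges add without
   cancellation. *)
have /choice[h hh] i : exists h : Y -> C,
    [/\ forall y, `|h y| <= 1, forall y, ~ A' i y -> h y = 0 & d <= Psi h].
  have [_ [h [h1 hA hd]] _] := hu i.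
  have h0 : Psi h != 0 by rewrite -normr_gt0; exact: lt_le_trans hd.
  exists (fun y => `|Psi h| / Psi h * h y); split.
  - move=> y; rewrite !normrM normrV ?unitfE// normr_id divff ?mul1r//.
    by rewrite normr_eq0.
  - by move=> y /hA ->; rewrite mulr0.
  - rewrite linfZ; [|exact: hPsi|by exists 1].
    by rewrite divfK.
have bh i : bdd (h i) by exists 1; case: (hh i).
pose D := disjointed A'.
pose H y := \sum_(i < N) h i y * ind R (D i) y.
have H1 y : `|H y| <= 1 by apply: disjointed_sum_norm => i z; case: (hh i).
have := hK _ _ ler01 H1; rewrite mulr1.
have bhD i j : bdd (fun y => h i y * ind R (D j) y).
  by apply: bddM; [exact: bh|exact: bdd_ind].
rewrite (linf_sum hPsi)//.
(* On [A' i] the pieces [D j] with [j <= i] add up to one; those with [j < i] only see the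
   intersection of [A' j] and [A' i], which is not [d']-charged. *)
have hD i : (i < N)%N -> `|Psi (h i) - Psi (fun y => h i y * ind R (D i) y)| <= N%:R * d'.
  move=> iN; have -> : Psi (h i) =
      \sum_(j < i) Psi (fun y => h i y * ind R (D j) y) + Psi (fun y => h i y * ind R (D i) y).
    transitivity (Psi (fun y => \sum_(j < i.+1) h i y * ind R (D j) y)).
      congr Psi; apply/funext => y; rewrite -mulr_sumr disjointed_sum.
      have [Ay|nAy] := pselect (A' i y); first by rewrite ind1 ?mulr1//; exists i.
      by case: (hh i) => _ /(_ _ nAy) -> _; rewrite mul0r.
    by rewrite linf_sum// big_ord_recr.
  rewrite addrK (le_trans (ler_norm_sum _ _ _))//.
  have dn j : (j < i)%N -> `|Psi (fun y => h i y * ind R (D j) y)| <= d'.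
    move=> ji; have := upair _ _ ji; rewrite real_leNgt ?normr_real ?gtr0_real//.
    move=> nc; apply/negP => /ltW le; apply: nc.
    exists (fun y => h i y * ind R (D j) y); split=> //.
    - move=> y; rewrite normrM mulr_ile1 ?normr_ge0 ?norm_ind//.
      by case: (hh i).
    - move=> y nA; have [Ay|nAy] := pselect (A' i y).
        by rewrite ind0 ?mulr0// => -[Aj _]; apply: nA.
      by case: (hh i) => _ /(_ _ nAy) -> _; rewrite mul0r.
  apply: (@le_trans _ _ (\sum_(j < i) d')); first by apply: ler_sum => j _; exact: dn.
  rewrite sumr_const card_ord -[leLHS]mulr_natl; apply: ler_wpM2r; first exact: ltW.
  by rewrite ler_nat ltnW.
set S := (X in `|X|) => SK.
have : `|\sum_(i < N) Psi (h i) - S| <= 1.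
  rewrite -sumrB (le_trans (ler_norm_sum _ _ _))//.
  apply: (@le_trans _ _ (\sum_(i < N) N%:R * d')).
    by apply: ler_sum => i _; exact: hD.
  by rewrite sumr_const card_ord -[leLHS]mulr_natl mulrA divff// mulf_neq0 ?pnatr_eq0.
have : N%:R * d <= `|\sum_(i < N) Psi (h i)|.
  rewrite ger0_norm; last first.
    by apply: sumr_ge0 => i _; case: (hh i) => _ _; apply: le_trans; exact: ltW.
  rewrite mulr_natl -[N in leLHS]card_ord -sumr_const.
  by apply: ler_sum => i _; case: (hh i).
move=> h1 h2; have : N%:R * d <= K + 1.
  rewrite (le_trans h1)// -[X in `|X|](subrK S) addrC (le_trans (ler_normD _ _))//.
  exact: lerD.
by move=> /(lt_le_trans hr); rewrite ltxx.
Qed.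

(** The contrapositive of dominated convergence, in a form that yields points: the sets
    [|g n| >= eta] are charged, [charged_pair] selects indices whose finite intersections stay
    charged, and [y n] lies in the intersection of the first [n.+1] selected sets. *)
Lemma nonvanishing_subseq (g : nat -> Y -> C) : bdd2 g ->
  ulim (fun n => Psi (g n)) != 0 ->
  exists2 eta : C, 0 < eta & exists (mu : nat -> nat) (y : nat -> Y),
    (forall j, (j <= mu j)%N) /\ forall j n, (j <= n)%N -> eta <= `|g (mu j) (y n)|.
Proof.
move=> /bdd2P[c c0 gc]; rewrite -normr_gt0; set l := `|_| => l0.
have [K K0 hK] := linf_bound hPsi.
have bg : bdd (fun n => Psi (g n)).
  by exists (K * c) => n; apply: hK => //; exact: ltW.
pose d := l / 2.
have d0 : 0 < d by rewrite divr_gt0 ?ltr0n.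
(* [K * eta = d / 2], so cutting [g n] down to [|g n| >= eta] loses at most half of [d]. *)
pose eta := d / 2 / K.
have eta0 : 0 < eta by rewrite !divr_gt0 ?ltr0n.
pose A n : set Y := [set y | eta <= `|g n y|].
have gind n : bdd (g n) by exists c.
have ch0 : FU [set n | charged (d / 2 / c) (A n)].
  apply: filterS (ulimP bg d0) => n /= hn.
  have dn : d <= `|Psi (g n)|.
    have : l <= `|Psi (g n)| + d.
      rewrite /l -[X in `|X|](subrK (Psi (g n))) addrC (le_trans (ler_normD _ _))//.
      by rewrite lerD2l distrC ltW.
    by rewrite {1}[l]splitr lerD2r.
  exists (fun y => c^-1 * (g n y * ind R (A n) y)); split.
  - move=> y; rewrite normrM normfV (gtr0_norm c0) mulrC ler_pdivrMr// mul1r.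
    by rewrite normrM (le_trans _ (gc n y))// ler_piMr ?norm_ind.
  - by move=> y nA; rewrite ind0// !mulr0.
  - have bgi : bdd (fun y => g n y * ind R (A n) y) by apply: bddM => //; exact: bdd_ind.
    rewrite linfZ// normrM normfV (gtr0_norm c0) mulrC ler_pM2l ?invr_gt0//.
    have : `|Psi (fun y => g n y - g n y * ind R (A n) y)| <= K * eta.
      apply: hK => [|y]; first exact: ltW.
      have [Ay|nAy] := pselect (A n y); first by rewrite ind1// mulr1 subrr normr0 ltW.
      rewrite ind0// mulr0 subr0; move/negP: nAy.
      by rewrite norm_leNlt ?negbK; [exact: ltW|exact: ltW].
    rewrite linfB// /eta mulrCA divff ?gt_eqF// mulr1 => h.
    have : d <= d / 2 + `|Psi (fun y => g n y * ind R (A n) y)|.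
      rewrite (le_trans dn)// -[X in `|X|](subrK (Psi (fun y => g n y * ind R (A n) y))).
      by rewrite (le_trans (ler_normD _ _))// lerD2r.
    by rewrite {1}[d]splitr lerD2l.
pose cap (s : seq nat) : set Y := [set y | forall m, m \in s -> A m y].
(* The charge may shrink at each step; only its positivity for [FU]-many further sets has to
   persist. *)
pose inv s := exists2 d, 0 < d & FU [set n | charged d (cap s `&` A n)].
pose P (s : seq nat) m := (size s <= m)%N /\ (inv s -> inv (rcons s m)).
have [|mu hmu] := @dep_seq nat P.
  move=> s; have [[d1 d10 ch]|ninv] := pselect (inv s); last by exists (size s).
  have [m sm [d2 d20 ch2]] := charged_pair d10 ch (FU_free (size s)).
  exists m; split=> // _; exists d2 => //; apply: filterS ch2 => n; apply: chargedS.
  move=> y [[cy Am] [_ An]]; split=> // k; rewrite mem_rcons inE => /orP[/eqP->//|].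
  exact: cy.
have hinv k : inv (mkseq mu k).
  elim: k => [|k IH]; last by rewrite mkseqS; apply: (hmu k).2.
  exists (d / 2 / c); first by rewrite !divr_gt0 ?ltr0n.
  by apply: filterS ch0 => n; apply: chargedS => y Ay; split.
have /choice[y hy] n : exists y, cap (mkseq mu n.+1) y.
  have [d1 d10 /FU_ex[k /(charged_ex d10)[y [cy _]]]] := hinv n.+1.
  by exists y.
exists eta => //; exists mu, y; split=> [j|j n jn].
  by have := (hmu j).1; rewrite size_mkseq.
by apply: (hy n); apply: map_f; rewrite mem_iota.
Qed.

End DominatedConvergence.

Section DoubleLimit.
Variable R : realType.
Local Notation C := R[i].
#[local] Existing Instance FU_ultra.
#[local] Existing Instance FU_proper.
Local Open Scope classical_set_scope.

(* Limits along the free ultrafilter [FU] always exist for bounded [f]. *)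
Definition dbl (X Y : Type) (f : X -> Y -> C) :=
  forall (x : nat -> X) (y : nat -> Y),
    ulim (fun m => ulim (fun n => f (x m) (y n))) =
    ulim (fun n => ulim (fun m => f (x m) (y n))).

(** Equality of the two Arens-type extensions of [f] to pairs of functionals. *)
Definition swaps (X Y : Type) (f : X -> Y -> C) :=
  forall Phi Psi, in_linf_dual Phi -> in_linf_dual Psi ->
    Phi (fun x => Psi (f x)) = Psi (fun y => Phi (f^~ y)).

Lemma seq_cvg_le (u : nat -> C) l (phi : nat -> nat) : (forall k, (k <= phi k)%N) ->
  seq_cvg u l -> seq_cvg (u \o phi) l.
Proof.
by move=> hphi ul e /ul[N hN]; exists N => n Nn; apply: hN; exact: leq_trans (hphi n).
Qed.

(** Otherwise [nonvanishing_subseq] gives [x n] in [A] and [mu] with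
    [eta <= |f (x n) (y (mu j)) - k (x n)|] for [j <= n]. The limit over [n] first preserves the
    gap, the limit over [j] first closes it, against [dbl]. The set [A] confines the claim to points
    where convergence is known. *)
Lemma dbl_dominated (X Y : Type) (f : X -> Y -> C) Phi (A : set X) (y : nat -> Y)
    (k : X -> C) :
  dbl f -> bdd2 f -> in_linf_dual Phi -> bdd k ->
  (forall x, A x -> seq_cvg (fun n => f x (y n)) (k x)) ->
  ulim (fun n => Phi (fun x => ind R A x * (f x (y n) - k x))) = 0.
Proof.
move=> df bf hPhi bk fk; apply/eqP; apply: contraT => ne0.
have bg : bdd2 (fun n x => ind R A x * (f x (y n) - k x)).
  have [c c0 fc] := bdd2P bf; have [d d0 kd] := bddP bk.
  exists (1 * (c + d)) => n x; rewrite normrM ler_pM ?norm_ind//.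
  by rewrite (le_trans (ler_normB _ _))// lerD.
have [eta eta0 [mu [x [hmu hx]]]] := nonvanishing_subseq hPhi bg ne0.
have Ax n : A (x n).
  apply: contrapT => nA; have := hx _ _ (leq0n n).
  by rewrite ind0// mul0r normr0 => /(lt_le_trans eta0); rewrite ltxx.
have := df x (y \o mu).
have bu n : bdd (fun m => f (x m) (y n)) by case: bf => c fc; exists c.
have bkx : bdd (fun m => k (x m)) by case: bk => c kc; exists c.
rewrite (_ : (fun m => ulim _) = fun m => k (x m)); last first.
  by apply/funext => m; apply: ulim_seq; exact: (seq_cvg_le hmu (fk _ (Ax m))).
set lam := ulim _ => /esym E.
have bv : bdd (fun n => ulim (fun m => f (x m) ((y \o mu) n))).
  by apply: bdd_ulim; case: bf => c fc; exists c.
have : eta <= `|ulim (fun n => ulim (fun m => f (x m) ((y \o mu) n)) - lam)|.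
  apply: ulim_norm_ge; [|exact: ltW|].
    by apply: bddB => //; exact: bdd_cst.
  apply: filterS filterT => n _ /=.
  rewrite -(ulimB (bu (mu n)) bkx).
  apply: ulim_norm_ge; [|exact: ltW|].
    exact: bddB (bu _) bkx.
  apply: filterS (FU_free n) => m /= /hx.
  by rewrite ind1 ?mul1r.
rewrite ulimB//; last exact: bdd_cst.
rewrite E ulim_cst subrr normr0 => /(lt_le_trans eta0).
by rewrite ltxx.
Qed.

End DoubleLimit.

(** * Grothendieck's double limit criterion *)

Section FiniteSupport.
Variable R : realType.
Local Notation C := R[i].
#[local] Existing Instance FU_ultra.
#[local] Existing Instance FU_proper.
Local Open Scope classical_set_scope.

(** A finitely supported measure as a list of masses and points. Points may repeat, so [l1norm] is
    only an upper bound of the norm, which is all that [fsum_bound] asks. *)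
Definition fsum (X : Type) (a : seq (C * X)) (f : X -> C) : C := \sum_(p <- a) p.1 * f p.2.

Definition l1norm (X : Type) (a : seq (C * X)) : C := \sum_(p <- a) `|p.1|.

Lemma fsum_nil X (f : X -> C) : fsum [::] f = 0.
Proof. by rewrite /fsum big_nil. Qed.

Lemma fsum_cons X p a (f : X -> C) : fsum (p :: a) f = p.1 * f p.2 + fsum a f.
Proof. by rewrite /fsum big_cons. Qed.

Lemma fsum_lin X (a : seq (C * X)) c (f g : X -> C) :
  fsum a (fun x => c * f x + g x) = c * fsum a f + fsum a g.
Proof.
elim: a => [|p a IH]; rewrite ?fsum_nil ?mulr0 ?addr0// !fsum_cons IH !mulrDr.
by rewrite addrACA; congr (_ + _ + _); rewrite mulrCA.
Qed.

Lemma fsumB X (a : seq (C * X)) (f g : X -> C) :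
  fsum a (fun x => f x - g x) = fsum a f - fsum a g.
Proof.
rewrite [RHS]addrC -[- _]mulN1r -fsum_lin; congr fsum; apply/funext => x.
by rewrite mulN1r addrC.
Qed.

Lemma fsum_bound X (a : seq (C * X)) (f : X -> C) d :
  (forall x, `|f x| <= d) -> `|fsum a f| <= l1norm a * d.
Proof.
move=> fd; rewrite /fsum /l1norm (le_trans (ler_norm_sum _ _ _))// mulr_suml.
by apply: ler_sum => p _; rewrite normrM ler_wpM2l.
Qed.

Lemma eq_fsum X (a : seq (C * X)) (f g : X -> C) :
  (forall p, List.In p a -> f p.2 = g p.2) -> fsum a f = fsum a g.
Proof.
elim: a => [|p a IH] h; first by rewrite !fsum_nil.
by rewrite !fsum_cons h ?IH//; [move=> q qa; apply: h; right|left].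
Qed.

Lemma ucvg_fsum X (a : seq (C * X)) (v : nat -> X -> C) (V : X -> C) :
  (forall p, List.In p a -> ucvg (v^~ p.2) (V p.2)) ->
  ucvg (fun n => fsum a (v n)) (fsum a V).
Proof.
elim: a => [|p a IH] h.
  rewrite fsum_nil (_ : (fun n => _) = fun=> 0); first exact: ucvg_cst.
  by apply/funext => n; rewrite fsum_nil.
rewrite fsum_cons (_ : (fun n => _) = fun n => p.1 * v n p.2 + fsum a (v n)); last first.
  by apply/funext => n; rewrite fsum_cons.
apply: ucvgD; last by apply: IH => q qa; apply: h; right.
by apply: ucvgM; [exact: ucvg_cst|apply: h; left].
Qed.

(** The cells are the level sets of the integer part of [(u + c) / e]. *)
Lemma finite_partition_real X (u : X -> R) c e : 0 < e -> (forall x, `|u x| <= c) ->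
  exists (T : finType) (q : X -> T), forall x x', q x = q x' -> `|u x - u x'| <= e.
Proof.
move=> e0 uc; pose v x := (u x + c) / e.
have v0 x : 0 <= v x.
  rewrite divr_ge0 ?(ltW e0)//; have := uc x; rewrite ler_norml => /andP[+ _].
  by move=> h; rewrite -lerBlDr sub0r.
pose N := Num.truncn ((c + c) / e).
have vN x : (Num.truncn (v x) < N.+1)%N.
  rewrite ltnS /N; apply: le_truncn; rewrite /v ler_pM2r ?invr_gt0// lerD2r.
  exact: le_trans (ler_norm _) (uc x).
exists 'I_N.+1, (fun x => inord (Num.truncn (v x))) => x x' /(congr1 val).
rewrite /= !inordK// => E.
have /andP[a1 a2] := truncn_itv (v0 x); have /andP[b1 b2] := truncn_itv (v0 x').
have -> : u x - u x' = (v x - v x') * e.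
  by rewrite mulrBl !divfK ?gt_eqF// opprD addrACA subrr addr0.
rewrite normrM (gtr0_norm e0) ler_piMl ?ltW//.
rewrite -E in b1 b2; rewrite ltr_norml; apply/andP; split.
  by rewrite ltrBrDl ltrBlDr (lt_le_trans b2)// -natr1 lerD2r.
by rewrite ltrBlDl (lt_le_trans a2)// -natr1 lerD2r.
Qed.

Lemma finite_partition1 X (f : X -> C) e : 0 < e -> bdd f ->
  exists (T : finType) (q : X -> T), forall x x', q x = q x' -> `|f x - f x'| <= e.
Proof.
move=> e0 /bddP[c c0 fc].
have cE : c = (complex.Re c)%:C by rewrite RRe_real ?gtr0_real.
have eE : e = (complex.Re e)%:C by rewrite RRe_real ?gtr0_real.
have e2 : 0 < complex.Re e / 2 by rewrite divr_gt0 ?ltr0n// -ltcR -eE.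
have ni : `|'i%C : C| = 1 by rewrite normc_def /= expr0n/= add0r expr1n sqrtr1.
have nr (x : R) : `|x%:C| = `|x|%:C by rewrite normc_def /= expr0n addr0 sqrtr_sqr.
have [|T1 [q1 h1]] := @finite_partition_real X (fun x => complex.Re (f x)) (complex.Re c) _ e2.
  by move=> x; rewrite -lecR -cE (le_trans _ (fc x))// normc_ge_Re.
have [|T2 [q2 h2]] := @finite_partition_real X (fun x => complex.Im (f x)) (complex.Re c) _ e2.
  move=> x; rewrite -lecR -cE (le_trans _ (fc x))//.
  by have := normc_ge_Re (f x * 'i%C); rewrite ReiNIm normrN normrM ni mulr1.
exists (T1 * T2)%type, (fun x => (q1 x, q2 x)) => x x' [/h1 a1 /h2 a2].
rewrite (complexE (f x - f x')) (le_trans (ler_normD _ _))//.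
rewrite normrM ni mul1r !nr -rmorphD/= eE lecR [leRHS]splitr.
by case: (f x) (f x') a1 a2 => [? ?] [? ?] /= ? ?; rewrite lerD.
Qed.

Lemma finite_partition X (fs : seq (X -> C)) e : 0 < e ->
  (forall f, List.In f fs -> bdd f) ->
  exists (T : finType) (q : X -> T), forall f, List.In f fs ->
    forall x x', q x = q x' -> `|f x - f x'| <= e.
Proof.
move=> e0; elim: fs => [|f fs IH] bfs.
  by exists unit, (fun=> tt) => f [].
have [|T1 [q1 h1]] := @finite_partition1 X f e e0; first by apply: bfs; left.
have [|T2 [q2 h2]] := IH; first by move=> g gfs; apply: bfs; right.
exists (T1 * T2)%type, (fun x => (q1 x, q2 x)) => g [<-|gfs] x x' [].
  by move=> /h1.
by move=> _ /h2; exact.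
Qed.

(* [Phi] is approximated, on finitely many functions at once, by the discrete
   measure putting mass [Phi 1_A] at a point of each cell [A] of a fine partition. *)
Lemma finite_goldstine X (x0 : X) (Phi : (X -> C) -> C) K (fs : seq (X -> C)) e :
  lin_on_bdd Phi -> 0 <= K -> fun_bounded_by Phi K -> 0 < e ->
  (forall f, List.In f fs -> bdd f) ->
  exists2 a : seq (C * X), l1norm a <= K &
    forall f, List.In f fs -> `|fsum a f - Phi f| <= e.
Proof.
move=> lPhi K0 bPhi e0 bfs.
have hPhi : in_linf_dual Phi by split=> //; exists K.
have K1 : 0 < K + 1 by rewrite ltr_wpDl.
have [|T [q hq]] := @finite_partition X fs (e / (K + 1)) _ bfs; first by rewrite divr_gt0.
pose cell t : set X := [set x | q x = t].
have /choice[xt hxt] t : exists y, (exists x, q x = t) -> q y = t.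
  have [[x qx]|nt] := pselect (exists x, q x = t); first by exists x.
  by exists x0 => /nt.
have qxt x : q (xt (q x)) = q x by apply: hxt; exists x.
pose a := [seq (Phi (ind R (cell t)), xt t) | t <- enum T].
have bc t : bdd (ind R (cell t)) by exact: bdd_ind.
have sumc (k : T -> C) x : \sum_t k t * ind R (cell t) x = k (q x).
  rewrite (bigD1 (q x))//= ind1// mulr1 big1 ?addr0// => t /eqP tq.
  by rewrite ind0 ?mulr0// => /esym.
have PhiS (k : T -> C) :
    \sum_t k t * Phi (ind R (cell t)) = Phi (fun x => k (q x)).
  transitivity (Phi (fun x => \sum_t k t * ind R (cell t) x)); last first.
    by congr Phi; apply/funext.
  rewrite linf_sum//; last by move=> t; exact: bddZ.
  by apply: eq_bigr => t _; rewrite linfZ.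
exists a.
  (* The function equal to [ph t] on the cell [t] is bounded by [1], and [Phi] takes on it the value
     [l1norm a]; hence [l1norm a <= K]. *)
  pose ph t : C := `|Phi (ind R (cell t))| / Phi (ind R (cell t)).
  have -> : l1norm a = `|Phi (fun x => ph (q x))|.
    rewrite -PhiS /l1norm big_map big_enum/= ger0_norm.
      apply: eq_bigr => t _; rewrite /ph; have [->|n0] := eqVneq (Phi (ind R (cell t))) 0.
        by rewrite mulr0 normr0.
      by rewrite divfK.
    apply: sumr_ge0 => t _; rewrite /ph.
    have [->|n0] := eqVneq (Phi (ind R (cell t))) 0; first by rewrite mulr0.
    by rewrite divfK.
  rewrite -[leRHS]mulr1; apply: bPhi => x; rewrite /ph.
  have [->|n0] := eqVneq (Phi (ind R (cell (q x)))) 0.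
    by rewrite invr0 mulr0 normr0 ler01.
  by rewrite normrM normfV normr_id divff// normr_eq0.
move=> f ffs; have bf := bfs _ ffs.
have -> : fsum a f = Phi (fun x => f (xt (q x))).
  rewrite -(PhiS (fun t => f (xt t))) /fsum big_map big_enum/=.
  by apply: eq_bigr => t _; rewrite mulrC.
rewrite -linfB//; last by case: bf => c fc; exists c.
apply: (@le_trans _ _ (K * (e / (K + 1)))); first by apply: bPhi => x; apply: hq.
rewrite mulrCA; apply: ler_piMr; first exact: ltW.
by rewrite ler_pdivrMr// mul1r lerDl ler01.
Qed.

Lemma ulim_fsum_linf X (x0 : X) (a : nat -> seq (C * X)) K : 0 <= K ->
  (forall n, l1norm (a n) <= K) -> in_linf_dual (fun g => ulim (fun n => fsum (a n) g)).
Proof.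
move=> K0 aK; apply: (@ulim_linf _ X (fun n => fsum (a n)) K) => // n.
  by move=> f g c _ _; exact: fsum_lin.
move=> f d fd; rewrite (le_trans (fsum_bound _ fd))// ler_wpM2r//.
exact: le_trans (normr_ge0 _) (fd x0).
Qed.

Lemma bdd_fsum X (a : nat -> seq (C * X)) K (f : X -> C) :
  (forall n, l1norm (a n) <= K) -> bdd f -> bdd (fun n => fsum (a n) f).
Proof.
move=> aK /bddP[c c0 fc]; exists (K * c) => n.
by rewrite (le_trans (fsum_bound _ fc))// ler_wpM2r// ltW.
Qed.

Lemma seq_cvg_inv (u : nat -> C) l N :
  (forall n, (N <= n)%N -> `|u n - l| <= n.+1%:R^-1) -> seq_cvg u l.
Proof.
move=> h e /eps_inv[k ke]; exists (maxn N k) => n; rewrite geq_max => /andP[Nn kn].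
rewrite (le_lt_trans (h _ Nn))// (le_lt_trans _ ke)// lef_pV2 ?posrE ?ltr0n//.
by rewrite ler_nat ltnS.
Qed.

Lemma mem_flatten_mkseq X (g : nat -> seq X) x n k :
  (n < k)%N -> List.In x (g n) -> List.In x (flatten (mkseq g k)).
Proof.
move=> + xg; elim: k => [//|k IH]; rewrite mkseqS -cats1 flatten_cat/= cats0.
rewrite ltnS leq_eqVlt => /orP[/eqP <-|nk]; apply: List.in_or_app; first by right.
by left; exact: IH.
Qed.

(* Grothendieck's double limit criterion. If the two sides differ, finitely
   supported [a m] ~ [Phi] and [b n] ~ [Psi] with [f (a m) (b n)] close to the
   left side for [m <= n] and to the right side for [n < m] separate the
   iterated limits; dominated convergence, used on each side, replaces
   them by points. *)
Theorem dbl_swaps X Y (f : X -> Y -> C) : bdd2 f -> dbl f -> swaps f.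
Proof.
move=> bf df Phi Psi hPhi hPsi.
have [[x0 _]|nX] := pselect (exists x : X, True); last first.
  have E (g h : X -> C) : g = h by apply/funext => x; case: nX; exists x.
  rewrite (E (fun x => Psi (f x)) (fun=> 0)) linf0//.
  rewrite (_ : (fun y => Phi (f^~ y)) = fun=> 0) ?linf0//.
  by apply/funext => y; rewrite (E (f^~ y) (fun=> 0)) linf0.
have [[y0 _]|nY] := pselect (exists y : Y, True); last first.
  have E (g h : Y -> C) : g = h by apply/funext => y; case: nY; exists y.
  rewrite (E (fun y => Phi (f^~ y)) (fun=> 0)) linf0//.
  rewrite (_ : (fun x => Psi (f x)) = fun=> 0) ?linf0//.
  by apply/funext => x; rewrite (E (f x) (fun=> 0)) linf0.
pose F x := Psi (f x); pose h y := Phi (f^~ y).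
have bF : bdd F by exact: bdd2_fun.
have bh : bdd h by apply: (@bdd2_fun _ _ _ (fun y x => f x y)) => //; exact: bdd2C.
rewrite -/F -/h; apply/eqP; rewrite -subr_eq0; apply: contraT => ne0.
have [lPhi [K1 [K10 bPhi]]] := hPhi; have [lPsi [K2 [K20 bPsi]]] := hPsi.
have inv_gt0 k : 0 < k.+1%:R^-1 :> C by rewrite invr_gt0 ltr0n.
(* The measure [t.1] is fitted to [Phi] on [F] and on the columns through the supports of all
   earlier second measures; [t.2] is then fitted to [Psi] on [h] and on the rows through the
   supports of all first measures, the current [t.1] included. *)
pose P (s : seq (seq (C * X) * seq (C * Y))) t :=
  [/\ l1norm t.1 <= K1, l1norm t.2 <= K2,
   `|fsum t.1 F - Phi F| <= (size s).+1%:R^-1 /\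
   `|fsum t.2 h - Psi h| <= (size s).+1%:R^-1,
   forall p, List.In p (flatten (map snd s)) ->
     `|fsum t.1 (f^~ p.2) - h p.2| <= (size s).+1%:R^-1 &
   forall p, List.In p (flatten (map fst (rcons s t))) ->
     `|fsum t.2 (f p.2) - F p.2| <= (size s).+1%:R^-1].
have [|u hu] := @dep_seq _ P.
  move=> s; set e := (size s).+1%:R^-1 : C.
  have [|a aK ha] := @finite_goldstine X x0 Phi K1
      (F :: [seq f^~ p.2 | p <- flatten (map snd s)]) e lPhi K10 bPhi (inv_gt0 _).
    by move=> g [<-//|/List.in_map_iff[p [<- _]]]; exact: bdd2r.
  have [|b bK hb] := @finite_goldstine Y y0 Psi K2
      (h :: [seq f p.2 | p <- flatten (map fst (rcons s (a, [::])))]) e lPsi K20 bPsi (inv_gt0 _).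
    by move=> g [<-//|/List.in_map_iff[p [<- _]]]; exact: bdd2l.
  exists (a, b); split=> //=.
  - by split; [apply: ha; left|apply: hb; left].
  - move=> p ps; apply: ha; right; apply/List.in_map_iff; by exists p.
  - move=> p ps; apply: hb; right; apply/List.in_map_iff; exists p; split=> //.
    by move: ps; rewrite !map_rcons.
pose A m := (u m).1; pose B n := (u n).2.
have AK m : l1norm (A m) <= K1 by case: (hu m).
have BK m : l1norm (B m) <= K2 by case: (hu m).
have AF : seq_cvg (fun m => fsum (A m) F) (Phi F).
  by apply: (@seq_cvg_inv _ _ 0) => m _; case: (hu m) => _ _ []; rewrite size_mkseq.
have Bh : seq_cvg (fun m => fsum (B m) h) (Psi h).
  by apply: (@seq_cvg_inv _ _ 0) => m _; case: (hu m) => _ _ []; rewrite size_mkseq.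
have Af n p : List.In p (B n) -> seq_cvg (fun m => fsum (A m) (f^~ p.2)) (h p.2).
  move=> pB; apply: (@seq_cvg_inv _ _ n.+1) => m nm.
  case: (hu m) => _ _ _; rewrite size_mkseq => + _; apply.
  rewrite /mkseq -map_comp; exact: (mem_flatten_mkseq nm).
have Bf m p : List.In p (A m) -> seq_cvg (fun n => fsum (B n) (f p.2)) (F p.2).
  move=> pA; apply: (@seq_cvg_inv _ _ m) => n mn.
  case: (hu n) => _ _ _ _; rewrite size_mkseq; apply.
  rewrite -mkseqS (_ : map _ _ = mkseq A n.+1); last by rewrite /mkseq -map_comp.
  exact: (mem_flatten_mkseq _ pA).
pose X0 : set X := [set x | exists m p, List.In p (A m) /\ p.2 = x].
pose Y0 : set Y := [set y | exists n p, List.In p (B n) /\ p.2 = y].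
have Afb m : bdd (fun y => fsum (A m) (f^~ y)).
  have [c c0 fc] := bdd2P bf; exists (l1norm (A m) * c) => y.
  exact: fsum_bound.
pose Psi' (g : Y -> C) := ulim (fun n => fsum (B n) g).
have hPsi' : in_linf_dual Psi' by exact: (@ulim_fsum_linf _ y0 _ K2).
pose g m y := ind R Y0 y * (fsum (A m) (f^~ y) - h y).
have bg : bdd2 g.
  have [c c0 fc] := bdd2P bf; have [d d0 hd] := bddP bh.
  exists (1 * (K1 * c + d)) => m y; rewrite normrM ler_pM ?norm_ind//.
  rewrite (le_trans (ler_normB _ _))// lerD//.
  by rewrite (le_trans (fsum_bound _ (fun x => fc x y)))// ler_wpM2r// ltW.
have Psig m : Psi' (g m) = fsum (A m) F - Psi h.
  apply: ulimE; rewrite (_ : (fun n => _) =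
      fun n => fsum (A m) (fun x => fsum (B n) (f x)) + (- 1) * fsum (B n) h).
    rewrite -[- Psi h]mulN1r; apply: ucvgD; last first.
      by apply: ucvgM; [exact: ucvg_cst|exact: seq_ucvg].
    by apply: ucvg_fsum => p /Bf/seq_ucvg.
  apply/funext => n; rewrite mulN1r; transitivity (fsum (B n) (fun y => fsum (A m) (f^~ y) - h y)).
    by apply: eq_fsum => p pB; rewrite /g ind1 ?mul1r//; exists n, p.
  rewrite fsumB; congr (_ - _).
  rewrite /fsum; under eq_bigr do rewrite mulr_sumr; rewrite exchange_big/=.
  apply: eq_bigr => p _; rewrite mulr_sumr; apply: eq_bigr => q _.
  by rewrite mulrCA.
(* [Psi' (g m)] tends to [Phi F - Psi h], nonzero by assumption, so points [y n] can take over from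
   the measures [B n]. *)
have [eta eta0 [mu [y [hmu hy]]]] : exists2 eta : C, 0 < eta & exists (mu : nat -> nat) (y : nat -> Y),
    (forall j, (j <= mu j)%N) /\ forall j n, (j <= n)%N -> eta <= `|g (mu j) (y n)|.
  apply: (nonvanishing_subseq hPsi' bg).
  rewrite (_ : (fun n => Psi' (g n)) = fun m => fsum (A m) F - Psi h); last exact/funext.
  rewrite ulimB ?ulim_cst; [|exact: bdd_fsum AK bF|exact: bdd_cst].
  by rewrite (ulim_seq AF).
have yY0 n : Y0 (y n).
  apply: contrapT => nY; have := hy _ _ (leq0n n).
  by rewrite /g ind0// mul0r normr0 => /(lt_le_trans eta0); rewrite ltxx.
pose k x := ulim (fun n => f x (y n)).
have bfy x : bdd (fun n => f x (y n)) by case: bf => c fc; exists c.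
have bk : bdd k by apply: bdd_ulim; case: bf => c fc; exists c.
(* A diagonal subsequence makes [f x (y' n)] converge in the ordinary sense at all points [x] of the
   countable set [X0], as [dbl_dominated] requires. *)
have [phi [hphi phiP]] : exists phi : nat -> nat, (forall k, (k <= phi k)%N) /\
    forall i, forall p, List.In p (flatten (mkseq A i.+1)) ->
      `|f p.2 (y (phi i)) - k p.2| < i.+1%:R^-1.
  apply: (@seq_cvg_extract (fun i => [set n | forall p, List.In p (flatten (mkseq A i.+1)) ->
      `|f p.2 (y n) - k p.2| < i.+1%:R^-1])) => i.
  apply: (@FU_all _ (fun p => [set n | `|f p.2 (y n) - k p.2| < i.+1%:R^-1])) => p _.
  exact: ulimP (bfy p.2) _ (inv_gt0 _).
pose y' := y \o phi.
have fk x : X0 x -> seq_cvg (fun n => f x (y' n)) (k x).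
  move=> [m [p [pA <-]]]; apply: (@seq_cvg_inv _ _ m) => n mn; apply/ltW/phiP.
  exact: (@mem_flatten_mkseq _ A _ m).
have hy' j n : (j <= n)%N -> eta <= `|fsum (A (mu j)) (f^~ (y' n)) - h (y' n)|.
  move=> jn; have := hy _ _ (leq_trans jn (hphi n)); rewrite /g ind1 ?mul1r//.
pose Phi' (v : X -> C) := ulim (fun j => fsum (A (mu j)) v).
have AmuK j : l1norm (A (mu j)) <= K1 by [].
have hPhi' : in_linf_dual Phi' by exact: (@ulim_fsum_linf _ x0 _ K1).
have bhy : bdd (fun n => h (y' n)) by case: bh => c hc; exists c.
pose lam := ulim (fun n => h (y' n)).
have Phi'f n : Phi' (fun x => ind R X0 x * (f x (y' n) - k x)) = h (y' n) - Phi' k.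
  transitivity (Phi' (fun x => f x (y' n) - k x)).
    congr ulim; apply/funext => j; apply: eq_fsum => p pA.
    by rewrite ind1 ?mul1r//; exists (mu j), p.
  rewrite (linfB hPhi' (bdd2r _ bf) bk); congr (_ - _).
  have [m [p [pB E]]] := yY0 (phi n); rewrite /y' /= -E.
  by apply: ulim_seq; exact: (seq_cvg_le hmu (Af _ _ pB)).
have := dbl_dominated df bf hPhi' bk fk.
under eq_fun do rewrite Phi'f.
rewrite ulimB ?ulim_cst//; last exact: bdd_cst.
move/eqP; rewrite subr_eq0 => /eqP E.
(* [E] says [Phi' k = lam], yet for each [j] the gap [eta] holds for all [n >= j] and survives both
   limits. *)
have : eta <= `|ulim (fun j => fsum (A (mu j)) k - lam)|.
  apply: ulim_norm_ge; [|exact: ltW|].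
    by apply: bddB; [exact: bdd_fsum AmuK bk|exact: bdd_cst].
  apply: filterS filterT => j _ /=.
  have -> : fsum (A (mu j)) k = ulim (fun n => fsum (A (mu j)) (f^~ (y' n))).
    apply/esym/ulimE/ucvg_fsum => p pA.
    by apply: seq_ucvg; apply: fk; exists (mu j), p.
  have bA : bdd (fun n => fsum (A (mu j)) (f^~ (y' n))).
    by case: (Afb (mu j)) => c hc; exists c.
  rewrite -(ulimB bA bhy); apply: ulim_norm_ge; [exact: bddB|exact: ltW|].
  by apply: filterS (FU_free j) => n /=; exact: hy'.
rewrite ulimB; [|exact: bdd_fsum AmuK bk|exact: bdd_cst].
by rewrite ulim_cst -/(Phi' k) -E subrr normr0 => /(lt_le_trans eta0); rewrite ltxx.
Qed.

End FiniteSupport.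

(** * Extension of functionals *)

Section HahnBanachReal.
Variable R : realType.
Local Notation C := R[i].
Local Open Scope classical_set_scope.
Variables (V : lmodType C) (B E : set V) (p f : V -> R).

Definition real_subspace (D : set V) :=
  D 0 /\ forall (t : R) x y, D x -> D y -> D (t%:C *: x + y).

Definition real_linear_on (D : set V) (h : V -> R) :=
  forall (t : R) x y, D x -> D y -> h (t%:C *: x + y) = t * h x + h y.

Hypotheses (subB : real_subspace B) (subE : real_subspace E) (EB : E `<=` B).
Hypothesis pD : forall x y, B x -> B y -> p (x + y) <= p x + p y.
Hypothesis pZ : forall t x, 0 <= t -> B x -> p (t%:C *: x) = t * p x.
Hypothesis flin : real_linear_on E f.
Hypothesis fp : forall x, E x -> f x <= p x.

(** Partial extensions are relations, so that chains are bounded by their unions; domination at [0]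
    makes them single-valued. *)
Definition dominated_graph (G : set (V * R)) := [/\ G (0, 0),
  forall t x r y s, G (x, r) -> G (y, s) -> G (t%:C *: x + y, t * r + s) &
  forall x r, G (x, r) -> B x /\ r <= p x].

Let G0 : set (V * R) := [set q | E q.1 /\ q.2 = f q.1].

Let f0 : f 0 = 0.
Proof.
have := flin (-1) subE.1 subE.1.
by rewrite scaler0 addr0 mulN1r addNr.
Qed.

Let dominated_G0 : dominated_graph G0.
Proof.
split=> [|t x r y s [/= Ex ->] [/= Ey ->]|x r [/= Ex ->]]; rewrite /G0 /=.
- by rewrite f0; split=> //; exact: subE.1.
- by rewrite flin//; split=> //; apply: subE.2.
- by split; [exact: EB|exact: fp].
Qed.

(** The value at [v] has to lie above every [r - p (x - v)] and below every [p (y + v) - s]; it is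
    the supremum [c] of the former. Rescaling by [t] or [- t] reduces domination of the new elements
    to these two bounds. *)
Lemma dominated_graph_extend G v : dominated_graph G -> B v ->
  exists2 G', dominated_graph G' & G `<=` G' /\ exists r, G' (v, r).
Proof.
move=> [G00 Glin Gdom] Bv.
have Gsum x r y s : G (x, r) -> G (y, s) -> r - p (x - v) <= p (y + v) - s.
  move=> xr ys; have [Bx _] := Gdom _ _ xr; have [By _] := Gdom _ _ ys.
  have BDx : B (x - v) by have := subB.2 (-1) _ _ Bv Bx; rewrite rmorphN1 scaleN1r addrC.
  have BDy : B (y + v) by have := subB.2 1 _ _ By Bv; rewrite rmorph1 scale1r.
  rewrite lerBrDr addrAC lerBlDr.
  have [_] := Gdom _ _ (Glin 1 _ _ _ _ xr ys); rewrite rmorph1 scale1r mul1r => /le_trans; apply.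
  by have := pD BDx BDy; rewrite addrACA addNr addr0 [leRHS]addrC.
pose L : set R := [set c | exists x r, G (x, r) /\ c = r - p (x - v)].
have hL : has_sup L.
  split; first by exists (0 - p (0 - v)), 0, 0.
  by exists (p (0 + v) - 0) => c [x [r [xr ->]]]; exact: Gsum.
pose c := sup L.
have cl x r : G (x, r) -> r - p (x - v) <= c.
  by move=> xr; apply: ub_le_sup; [exact: hL.2|exists x, r].
have cu y s : G (y, s) -> c <= p (y + v) - s.
  by move=> ys; apply: ge_sup; [exact: hL.1|move=> _ [x [r [xr ->]]]; exact: Gsum].
have Gscale t x r : G (x, r) -> G (t%:C *: x, t * r).
  by move=> xr; have := Glin t _ _ _ _ xr G00; rewrite !addr0.
exists [set q | exists t x r, G (x, r) /\ q = (t%:C *: v + x, t * c + r)]; last first.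
  split; last by exists c, 1, 0, 0; rewrite rmorph1 scale1r mul1r !addr0.
  by move=> [x r] xr; exists 0, x, r; rewrite rmorph0 scale0r mul0r !add0r.
split.
- by exists 0, 0, 0; rewrite rmorph0 scale0r mul0r !add0r.
- move=> t _ _ _ _ [t1 [x [r [xr [-> ->]]]]] [t2 [y [s [ys [-> ->]]]]].
  exists (t * t1 + t2), (t%:C *: x + y), (t * r + s); split; first exact: Glin.
  congr (_, _).
    by rewrite scalerDr scalerA addrACA -scalerDl -rmorphM -rmorphD.
  by rewrite mulrDr mulrA addrACA -mulrDl.
- move=> _ _ [t [x [r [xr [-> ->]]]]]; have [Bx rx] := Gdom _ _ xr.
  split; first exact: subB.2.
  have [t0|t0|t0] := ltgtP 0 t; last by rewrite -t0 rmorph0 scale0r mul0r !add0r.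
  + have xr' := Gscale t^-1 _ _ xr; have [Bx' _] := Gdom _ _ xr'.
    have BDx : B (t^-1%:C *: x + v).
      by have := subB.2 1 _ _ Bx' Bv; rewrite rmorph1 scale1r.
    have -> : t%:C *: v + x = t%:C *: (t^-1%:C *: x + v).
      by rewrite scalerDr scalerA -rmorphM divff ?gt_eqF// rmorph1 scale1r addrC.
    rewrite (pZ (ltW t0) BDx) -ler_pdivrMl// mulrDr mulKf ?gt_eqF//.
    by rewrite -lerBrDr cu.
  + have u0 : 0 < - t by rewrite oppr_gt0.
    have xr' := Gscale (- t)^-1 _ _ xr; have [Bx' _] := Gdom _ _ xr'.
    have BDx : B ((- t)^-1%:C *: x - v).
      by have := subB.2 (-1) _ _ Bv Bx'; rewrite rmorphN1 scaleN1r addrC.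
    have -> : t%:C *: v + x = (- t)%:C *: ((- t)^-1%:C *: x - v).
      rewrite scalerBr scalerA -rmorphM divff ?gt_eqF// rmorph1 scale1r.
      by rewrite rmorphN scaleNr opprK addrC.
    rewrite (pZ (ltW u0) BDx) -ler_pdivrMl// mulrDr -[t in t * c]opprK mulNr mulrN mulKf ?gt_eqF//.
    by rewrite addrC lerBlDr addrC -lerBlDr cl.
Qed.

Theorem hahn_banach_real : exists g : V -> R,
  [/\ real_linear_on B g, forall x, B x -> g x <= p x & forall x, E x -> g x = f x].
Proof.
(* The condition is on the union with [G0], so that the empty chain is admissible too and every
   extension contains [f]. *)
have [F FP tF|A [GA Amax]] := @Zorn_bigcup _ [set G | dominated_graph (G `|` G0)].
  have Fgood a : (\bigcup_(X in F) X `|` G0) a -> exists2 G, dominated_graph G &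
      G a /\ G `<=` \bigcup_(X in F) X `|` G0.
    move=> [[X FX Xa]|G0a]; last by exists G0 => //; split=> // z; right.
    exists (X `|` G0); first exact: FP.
    by split; [left|move=> z [Xz|]; [left; exists X|right]].
  have Fgood2 a b : (\bigcup_(X in F) X `|` G0) a -> (\bigcup_(X in F) X `|` G0) b ->
      exists2 G, dominated_graph G & [/\ G a, G b & G `<=` \bigcup_(X in F) X `|` G0].
    have sub X : F X -> X `|` G0 `<=` \bigcup_(X in F) X `|` G0.
      by move=> FX z [Xz|]; [left; exists X|right].
    move=> [[X FX Xa]|G0a] [[Y FY Yb]|G0b].
    - have [XY|YX] := tF X Y FX FY.
        by exists (Y `|` G0); [exact: FP|split; [left; exact: XY|left|exact: sub]].
      by exists (X `|` G0); [exact: FP|split; [left|left; exact: YX|exact: sub]].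
    - by exists (X `|` G0); [exact: FP|split; [left|right|exact: sub]].
    - by exists (Y `|` G0); [exact: FP|split; [right|left|exact: sub]].
    - by exists G0 => //; split=> // z; right.
  split.
  - by right; case: dominated_G0.
  - move=> t x r y s xr ys; have [G [_ Glin _] [Ga Gb GS]] := Fgood2 _ _ xr ys.
    by apply: GS; exact: Glin.
  - by move=> x r /Fgood[G [_ _ Gdom] [Ga _]]; exact: Gdom.
pose G := A `|` G0; have [G00 Glin Gdom] : dominated_graph G by [].
have /choice[g hg] x : exists r, B x -> G (x, r).
  have [Bx|nBx] := pselect (B x); last by exists 0.
  have [G' G'd [GG' [r G'r]]] := dominated_graph_extend GA Bx.
  have [AG'|nAG'] := pselect (G' `<=` A); first by exists r => _; left; exact: AG'.
  case: (Amax G'); first by split=> // z Az; apply: GG'; left.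
  by rewrite /= (_ : G' `|` G0 = G')//; apply/setUidPl => z G0z; apply: GG'; right.
have p0 : p 0 = 0 by rewrite -(scale0r 0) -(rmorph0 (real_complex R)) pZ ?mul0r//; exact: subB.1.
have Guniq x r s : G (x, r) -> G (x, s) -> r = s.
  move=> xr xs; apply/eqP; rewrite eq_le; apply/andP; split.
    have [_] := Gdom _ _ (Glin (-1) _ _ _ _ xs xr).
    by rewrite rmorphN1 scaleN1r addNr p0 mulN1r addrC subr_le0.
  have [_] := Gdom _ _ (Glin (-1) _ _ _ _ xr xs).
  by rewrite rmorphN1 scaleN1r addNr p0 mulN1r addrC subr_le0.
exists g; split=> [t x y Bx By|x Bx|x Ex].
- apply: Guniq; first by apply: hg; exact: subB.2.
  by apply: Glin; exact: hg.
- by have [] := Gdom _ _ (hg _ Bx).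
- by apply: (@Guniq x); [apply: hg; exact: EB|right].
Qed.

End HahnBanachReal.

Section HahnBanach.
Variable R : realType.
Local Notation C := R[i].
Local Open Scope classical_set_scope.

(** The real part of [mu] is extended under [K] times the sup norm to a real-linear [g], and
    [M F = g F - i g(i F)] is the complex-linear functional with real part [g]. *)
Theorem hahn_banach_linf (X : Type) (x0 : X) (E : set (X -> C)) (mu : (X -> C) -> C) (K : C) :
  E (fun=> 0) ->
  (forall a f g, E f -> E g -> E (fun x => a * f x + g x)) ->
  (forall f, E f -> bdd f) ->
  (forall a f g, E f -> E g -> mu (fun x => a * f x + g x) = a * mu f + mu g) ->
  0 <= K ->
  (forall f d, E f -> (forall x, `|f x| <= d) -> `|mu f| <= K * d) ->
  exists2 M, in_linf_dual M & forall f, E f -> M f = mu f.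
Proof.
move=> E0 ElinE Ebdd mulin K0 muK.
have KE : K = (complex.Re K)%:C by rewrite RRe_real ?ger0_real.
have k0 : 0 <= complex.Re K by rewrite -ler0c -KE.
pose V : lmodType C := (X -> C^o).
pose B : set V := fun F => bdd F.
have nE (z : C) : `|z| = (complex.Re `|z|)%:C by rewrite ReK_norm.
pose N (F : X -> C) := supn F.
have Nub F x : bdd F -> `|F x| <= (N F)%:C by exact: supn_ub.
have Nle F (d : C) : (forall x, `|F x| <= d) -> (N F)%:C <= d.
  by move=> Fd; apply: supn_le => //; exact: le_trans (normr_ge0 _) (Fd x0).
have N0 F : bdd F -> 0 <= N F by exact: supn_ge0.
pose p (F : V) := complex.Re K * N F.
pose re (F : V) := complex.Re (mu F).
have [|||||||g [glin gp gf]] := @hahn_banach_real R V B E p re.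
- split; first exact: bdd_cst.
  by move=> t F G BF BG; apply: bddD => //; exact: bddZ.
- by split=> // t F G EF EG; exact: ElinE.
- by move=> F; exact: Ebdd.
- move=> F G BF BG; rewrite /p -mulrDr ler_wpM2l// -lecR; apply: Nle => x.
  by rewrite rmorphD (le_trans (ler_normD _ _))// lerD ?Nub.
- move=> t F t0 BF; rewrite /p mulrCA; congr (_ * _).
  have tle s G : 0 <= s -> bdd G -> N (s%:C *: (G : V)) <= s * N G.
    move=> s0 BG; rewrite -lecR; apply: Nle => x; rewrite normrM ger0_norm ?ler0c//.
    by rewrite rmorphM ler_wpM2l ?ler0c// Nub.
  apply/eqP; rewrite eq_le tle//=; have [->|tn0] := eqVneq t 0.
    by rewrite mul0r N0//; apply: (@bddZ _ _ 0%:C).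
  have bt : bdd (t%:C *: F) by apply: (@bddZ _ _ t%:C).
  have tp : 0 < t by rewrite lt_def tn0.
  have := tle t^-1 (t%:C *: F); rewrite invr_ge0 => /(_ t0 bt).
  rewrite scalerA -rmorphM mulVf// rmorph1 scale1r.
  by rewrite ler_pdivlMl.
- move=> t F G EF EG; rewrite /re mulin//.
  by rewrite raddfD/=; case: (mu F) => a b /=; rewrite mul0r subr0.
- move=> F EF; rewrite /re /p -lecR rmorphM/= -KE.
  apply: le_trans (muK F _ EF (fun x => Nub F x (Ebdd _ EF))).
  by rewrite (le_trans _ (normc_ge_Re _))// lecR ler_norm.
pose M (F : X -> C) : C := (g F)%:C - 'i%C * (g ('i%C *: (F : V)))%:C.
have bi F : B F -> B ('i%C *: F) by move=> bF; apply: (@bddZ _ _ 'i%C).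
have ii : 'i%C * 'i%C = -1 :> C by rewrite -expr2 sqr_i.
have gD F G : B F -> B G -> g (F + G) = g F + g G.
  by move=> BF BG; rewrite -[F in LHS]scale1r -(rmorph1 (real_complex R)) glin// mul1r.
have g0 : g 0 = 0.
  have := gD 0 0 (bdd_cst X 0) (bdd_cst X 0); rewrite addr0 => /eqP.
  by rewrite -subr_eq0 opprD addrA subrr sub0r oppr_eq0 => /eqP.
have gZ t F : B F -> g (t%:C *: F) = t * g F.
  by move=> BF; rewrite -[_ *: _ in LHS]addr0 glin ?g0 ?addr0//; exact: bdd_cst.
have MD F G : B F -> B G -> M (F + G) = M F + M G.
  move=> BF BG; rewrite /M scalerDr (gD _ _ BF BG) (gD _ _ (bi _ BF) (bi _ BG)).
  by rewrite !rmorphD mulrDr opprD addrACA.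
have MZr t F : B F -> M (t%:C *: F) = t%:C * M F.
  move=> BF; rewrite /M gZ// scalerA [_ * t%:C]mulrC -scalerA gZ ?bi//; last exact: bi.
  by rewrite !rmorphM mulrBr mulrCA.
have Mi F : B F -> M ('i%C *: F) = 'i%C * M F.
  move=> BF; rewrite /M scalerA ii mulrBr [in RHS]mulrA ii mulN1r opprK.
  have -> : (-1 : C) = (-1 : R)%:C by rewrite rmorphN1.
  by rewrite gZ// mulN1r rmorphN mulrN opprK addrC.
have MZ a F : B F -> M (a *: F) = a * M F.
  move=> BF; rewrite (complexE a) scalerDl MD; [|exact: (@bddZ _ _ _)|]; last first.
    by rewrite -scalerA; apply: bi; exact: (@bddZ _ _ _).
  rewrite MZr// -scalerA Mi ?MZr// ?mulrDl ?mulrA//; exact: (@bddZ _ _ _).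
exists M; last first.
  move=> F EF; rewrite /M gf// gf; last first.
    have := ElinE 'i%C _ _ EF E0; congr (E _); apply/funext => x.
    by rewrite addr0.
  rewrite /re (_ : mu ('i%C *: (F : V)) = 'i%C * mu F); last first.
    have mu0 : mu (fun=> 0) = 0.
      transitivity (-1 * mu (fun=> 0) + mu (fun=> 0)); last by rewrite mulN1r addNr.
      by rewrite -(mulin _ _ _ E0 E0); congr mu; apply/funext => x; rewrite mulr0 addr0.
    have := mulin 'i%C _ _ EF E0; rewrite mu0 addr0 => <-.
    by congr mu; apply/funext => x; rewrite addr0.
  by rewrite ['i%C * mu F]mulrC ReiNIm rmorphN mulrN opprK -complexE.
split=> [F G a bF bG|].
  have := MD (a *: (F : V)) G; rewrite MZ//; apply=> //.
  exact: (@bddZ _ _ _).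
exists K; split=> // F d Fd; have bF : B F by exists d.
have [->|z0] := eqVneq (M F) 0.
  by rewrite normr0 mulr_ge0// (le_trans (normr_ge0 _) (Fd x0)).
(* Rotating [F] makes [M] real and positive, so that the bound for [g] alone controls [|M F|]. *)
pose c := `|M F| / M F.
have Mc : M (c *: (F : V)) = `|M F| by rewrite MZ// /c divfK.
have bc : B (c *: (F : V)) by exact: (@bddZ _ _ _).
have gM : complex.Re (M (c *: (F : V))) = g (c *: (F : V)).
  by rewrite /M raddfB/= !(mul0r, mulr0, subr0).
rewrite nE -Mc gM (le_trans (_ : _ <= (p (c *: (F : V)))%:C))//.
  by rewrite lecR; exact: gp.
rewrite /p rmorphM/= -KE ler_wpM2l//; apply: Nle => x.
rewrite normrM (_ : `|c| = 1) ?mul1r//.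
by rewrite /c normrM normfV normr_id divff// normr_eq0.
Qed.

End HahnBanach.

(** * Clustering functions and Arens regularity *)

Section Clusters.
Variables (R : realType).
Local Notation C := R[i].
#[local] Existing Instance FU_ultra.
#[local] Existing Instance FU_proper.
Local Open Scope classical_set_scope.
Implicit Types (X Y : Type).

Lemma mem_mkseq_lt X (u : nat -> X) (k l : nat) : (k < l)%N -> List.In (u k) (mkseq u l).
Proof.
move=> kl; rewrite /mkseq; apply: List.in_map.
have : k \in iota 0 l by rewrite mem_iota.
by elim: (iota 0 l) => //= z s IH; rewrite inE => /orP[/eqP->|/IH]; [left|right].
Qed.

Lemma In_allpairs X Y Z (op : X -> Y -> Z) (s : seq X) (t : seq Y) x y :
  List.In x s -> List.In y t -> List.In (op x y) [seq op a b | a <- s, b <- t].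
Proof.
move=> + yt; elim: s => //= a s IH [->|/IH h]; apply: List.in_or_app; last by right.
by left; exact: List.in_map.
Qed.

(** Leaving every point along [FU] stands in for having distinct terms; by [diffuseVcst] the only
    alternative is to be constant along [FU]. *)
Definition diffuse X (x : nat -> X) := forall a, FU [set n | x n <> a].

Lemma diffuseVcst X (x : nat -> X) : diffuse x \/ exists a, FU [set n | x n = a].
Proof.
have [|nd] := pselect (exists a, FU [set n | x n = a]); [by right|left=> a].
by apply: FU_setC => h; apply: nd; exists a.
Qed.

Lemma diffuse_notin X (x : nat -> X) (s : seq X) : diffuse x ->
  FU [set n | ~ List.In (x n) s].
Proof.
move=> dx; have := @FU_all _ (fun a => [set n | x n <> a]) s (fun a _ => dx a).
by apply: filterS => n /= h xs; exact: h xs erefl.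
Qed.

Lemma diffuse_finite X (x : nat -> X) (A : set X) : diffuse x -> finite_set A ->
  FU [set n | ~ A (x n)].
Proof.
move=> dx /(@finite_seqP {classic X})[s ->].
elim: s => [|a s IH]; first by apply: filterS filterT.
apply: filterS (filterI (dx a) IH) => n [xa xs] /=; rewrite inE => /orP[/eqP//|].
exact: xs.
Qed.

Lemma ulim_swap_cstl X Y (f : X -> Y -> C) (x : nat -> X) (y : nat -> Y) a :
  FU [set n | x n = a] ->
  ulim (fun m => ulim (fun n => f (x m) (y n))) = ulim (fun n => ulim (fun m => f (x m) (y n))).
Proof.
move=> xa; transitivity (ulim (fun n => f a (y n))).
  rewrite -[RHS]ulim_cst; apply: eq_ulim; apply: filterS xa => m /= ->//.
congr ulim; apply/funext => n; rewrite -[LHS]ulim_cst; apply: eq_ulim.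
by apply: filterS xa => m /= ->.
Qed.

Lemma ulim2_dominated (u v : nat -> nat -> C) c : 0 < c -> bdd2 u ->
  (forall m n, `|v m n| <= c * `|u m n|) ->
  ulim (fun m => ulim (u m)) = 0 -> ulim (fun m => ulim (v m)) = 0.
Proof.
move=> c0 bu vu u0; have [d d0 ud] := bdd2P bu.
have bv : bdd2 v.
  by exists (c * d) => m n; rewrite (le_trans (vu _ _))// ler_pM2l.
have bum m : bdd (u m) by exists d.
apply: le_eps_eq0 => e e0; have ec : 0 < e / c by rewrite divr_gt0.
apply: (ucvg_norm_le (ltW e0) (ulimP (bdd_ulim bv))).
have := ulimP (bdd_ulim bu) ec; rewrite u0; apply: filterS => m /=; rewrite subr0 => um.
have em : 0 < e / c - `|ulim (u m)| by rewrite subr_gt0.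
apply: (ucvg_norm_le (ltW e0) (ulimP (bdd2l m bv))).
apply: filterS (ulimP (bum m) em) => n /= h.
have : `|u m n| < e / c.
  rewrite -[u m n](subrK (ulim (u m))) (le_lt_trans (ler_normD _ _))//.
  by rewrite -ltrBrDr.
move=> /ltW; rewrite ler_pdivlMr// mulrC; exact: le_trans.
Qed.

(** A sequence constant along [FU] makes the interchange trivial. If both are diffuse, a diagonal
    choice yields distinct terms along which inner and outer limits over [FU] become ordinary
    limits, and [clusters] compares these. *)
Lemma clusters_dbl (S : Type) (f : S * S -> C) :
  bdd f -> clusters [set: S] [set: S] f -> dbl (fun s t => f (s, t)).
Proof.
move=> bf cf x y.
have [dx|[a xa]] := diffuseVcst x; last exact: (@ulim_swap_cstl _ _ (fun s t => f (s, t)) x y a).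
have [dy|[b yb]] := diffuseVcst y; last first.
  exact/esym/(@ulim_swap_cstl _ _ (fun t s => f (s, t)) y x b).
have bf2 : bdd2 (fun m n => f (x m, y n)) by case: bf => c fc; exists c.
have bf2' : bdd2 (fun n m => f (x m, y n)) by case: bf => c fc; exists c.
pose v m := ulim (fun n => f (x m, y n)).
pose v' n := ulim (fun m => f (x m, y n)).
have bv : bdd v by exact: bdd_ulim bf2.
have bv' : bdd v' by exact: bdd_ulim bf2'.
have inv_gt0 k : 0 < k.+1%:R^-1 :> C by rewrite invr_gt0 ltr0n.
pose P (s : seq (nat * nat)) t := [/\
  ~ List.In (x t.1) (map (fun p => x p.1) s) /\ ~ List.In (y t.2) (map (fun p => y p.2) s),
  `|v t.1 - ulim v| < (size s).+1%:R^-1, `|v' t.2 - ulim v'| < (size s).+1%:R^-1,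
  forall p, List.In p s -> `|f (x t.1, y p.2) - v' p.2| < (size s).+1%:R^-1 &
  forall p, List.In p s -> `|f (x p.1, y t.2) - v p.1| < (size s).+1%:R^-1].
have [|u hu] := @dep_seq _ P.
  move=> s; set e := (size s).+1%:R^-1 : C.
  have e0 : 0 < e by exact: inv_gt0.
  have h1 := @FU_all _ (fun p => [set m | `|f (x m, y p.2) - v' p.2| < e]) s
    (fun p _ => ulimP (bdd2l p.2 bf2') e0).
  have h2 := @FU_all _ (fun p => [set n | `|f (x p.1, y n) - v p.1| < e]) s
    (fun p _ => ulimP (bdd2l p.1 bf2) e0).
  have [i [[i1 i2] i3]] := FU_ex (filterI (filterI
    (diffuse_notin (map (fun p => x p.1) s) dx) (ulimP bv e0)) h1).
  have [j [[j1 j2] j3]] := FU_ex (filterI (filterI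
    (diffuse_notin (map (fun p => y p.2) s) dy) (ulimP bv' e0)) h2).
  exists (i, j); split; [by split|exact: i2|exact: j2|exact: i3|exact: j3].
have inS (k l : nat) : (k < l)%N -> List.In (u k) (mkseq u l) by exact: mem_mkseq_lt.
have xinj : injective (fun k => x (u k).1).
  suff h k l : (k < l)%N -> x (u k).1 <> x (u l).1.
    by move=> k l E; have [kl|lk|//] := ltngtP k l; [case: (h _ _ kl)|case: (h _ _ lk)].
  move=> kl E; case: (hu l) => -[+ _] _ _ _ _; apply; rewrite -E.
  exact: (List.in_map (fun p => x p.1)) (inS _ _ kl).
have yinj : injective (fun k => y (u k).2).
  suff h k l : (k < l)%N -> y (u k).2 <> y (u l).2.
    by move=> k l E; have [kl|lk|//] := ltngtP k l; [case: (h _ _ kl)|case: (h _ _ lk)].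
  move=> kl E; case: (hu l) => -[_ +] _ _ _ _; apply; rewrite -E.
  exact: (List.in_map (fun p => y p.2)) (inS _ _ kl).
apply/esym; apply: (cf (fun k => x (u k).1) (fun k => y (u k).2) _ _ xinj yinj
  (fun k => v (u k).1) _ (fun k => v' (u k).2)) => //.
- move=> m; apply: (@seq_cvg_inv _ _ _ m.+1) => n mn.
  by case: (hu n) => _ _ _ _ /(_ _ (inS _ _ mn)); rewrite size_mkseq => /ltW.
- apply: (@seq_cvg_inv _ _ _ 0) => n _.
  by case: (hu n) => _ + _ _ _; rewrite size_mkseq => /ltW.
- move=> n; apply: (@seq_cvg_inv _ _ _ n.+1) => m nm.
  by case: (hu m) => _ _ _ /(_ _ (inS _ _ nm)) + _; rewrite size_mkseq => /ltW.
- apply: (@seq_cvg_inv _ _ _ 0) => n _.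
  by case: (hu n) => _ _ + _ _; rewrite size_mkseq => /ltW.
Qed.

Lemma dbl_clusters (S : Type) (f : S * S -> C) (I J : set S) :
  dbl (fun s t => f (s, t)) -> clusters I J f.
Proof.
move=> df x y _ _ _ _ L1 l1 L2 l2 h1 /ulim_seq <- h2 /ulim_seq <-.
have -> : L1 = fun m => ulim (fun n => f (x m, y n)) by apply/funext => m; rewrite (ulim_seq (h1 m)).
have -> : L2 = fun n => ulim (fun m => f (x m, y n)) by apply/funext => n; rewrite (ulim_seq (h2 n)).
by rewrite df.
Qed.

Lemma eval_ulim_linf X (x : nat -> X) : in_linf_dual (fun g : X -> C => ulim (fun n => g (x n))).
Proof.
apply: (@ulim_linf _ X (fun n g => g (x n)) 1) => // n f d fd.
by rewrite mul1r.
Qed.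

Lemma swaps_dbl X Y (f : X -> Y -> C) : swaps f -> dbl f.
Proof. by move=> sf x y; exact: sf (eval_ulim_linf x) (eval_ulim_linf y). Qed.

Definition zero_clusters X Y (f : X -> Y -> C) := forall x y, diffuse x -> diffuse y ->
  ulim (fun m => ulim (fun n => f (x m) (y n))) = 0 /\
  ulim (fun n => ulim (fun m => f (x m) (y n))) = 0.

Lemma zero_clustersC X Y (f : X -> Y -> C) :
  zero_clusters f -> zero_clusters (fun y x => f x y).
Proof. by move=> zf y x dy dx; have [h1 h2] := zf _ _ dx dy. Qed.

(** The map [op] mixes the two variables, so [F] alone gives nothing. If the first coordinates of
    [p] are diffuse, the factor [f] sends both iterated limits to [0]; if they equal some [g] along
    [FU], then [op (x m) g] is a sequence to which [dbl F] applies. *)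
Lemma dbl_mul X Y (A D : Type) (f : A -> X -> C) (op : A -> X -> D) (F : D -> Y -> C) :
  bdd2 f -> zero_clusters f -> bdd2 F -> dbl F ->
  dbl (fun k (p : X * Y) => f k p.1 * F (op k p.1) p.2).
Proof.
move=> bf zf bF dF x p.
have [dx|[a xa]] := diffuseVcst x; last first.
  exact: (@ulim_swap_cstl _ _ (fun k (p : X * Y) => f k p.1 * F (op k p.1) p.2) x p a).
have [c c0 Fc] := bdd2P bF; have [d d0 fd] := bdd2P bf.
have [dp|[g pg]] := diffuseVcst (fun n => (p n).1).
  have [h1 h2] := zf _ _ dx dp.
  have le m n : `|f (x m) (p n).1 * F (op (x m) (p n).1) (p n).2| <= c * `|f (x m) (p n).1|.
    by rewrite normrM mulrC ler_wpM2r.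
  rewrite (@ulim2_dominated _ _ c c0 _ le h1); last by exists d.
  by rewrite (@ulim2_dominated _ _ c c0 _ (fun n m => le m n) h2)//; exists d.
have bfg : bdd (fun m => f (x m) g) by exists d.
pose G m n := F (op (x m) g) (p n).2.
have bG : bdd2 G by exists c => m n; exact: Fc.
transitivity (ulim (fun m => f (x m) g) * ulim (fun m => ulim (G m))).
  rewrite -ulimM//; last exact: bdd_ulim.
  congr ulim; apply/funext => m; rewrite -ulimZ; last exact: bdd2l.
  by apply: eq_ulim; apply: filterS pg => n /= ->.
rewrite (dF (fun m => op (x m) g) (fun n => (p n).2)) -ulimZ; last first.
  by apply: (@bdd_ulim _ _ (fun n m => G m n)); exact: bdd2C.
apply: eq_ulim; apply: filterS pg => n /= pn; rewrite -ulimM//; last by exists c => m; exact: Fc.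
by congr ulim; apply/funext => m; rewrite pn.
Qed.

End Clusters.

(** * The weight cocycle under Arens regularity *)

Section WeightedSemigroup.
Variables (R : realType) (S : Type) (mul : S -> S -> S) (w : S -> R).
Local Notation C := R[i].
#[local] Existing Instance FU_ultra.
#[local] Existing Instance FU_proper.
Local Open Scope classical_set_scope.
Hypothesis Hassoc : semigroup_assoc mul.
Hypothesis Hw : is_weight mul w.

Local Notation Om := (Omega mul w).

Lemma norm_Omega g h : `|Om g h| <= 1.
Proof.
have [w0 wM] := Hw; have w00 : 0 < w g * w h by rewrite mulr_gt0.
rewrite /Omega ger0_norm ?ler0c ?divr_ge0 ?(ltW w00) ?(ltW (w0 _))//.
by rewrite -(rmorph1 (real_complex R)) lecR ler_pdivrMr// mul1r.
Qed.

Lemma bdd2_Omega : bdd2 Om.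
Proof. by exists 1; exact: norm_Omega. Qed.

(** Both sides equal [w (ghk) / (w g * w h * w k)]; this is associativity of the weighted
    convolution. *)
Lemma Omega_cocycle g h k : Om g h * Om (mul g h) k = Om h k * Om g (mul h k).
Proof.
have [w0 _] := Hw; have wn s : w s != 0 by rewrite gt_eqF.
rewrite /Omega -!rmorphM; congr _%:C; rewrite Hassoc.
by field; rewrite !wn.
Qed.

(** Restores the value [0] on unbounded functions that [bidual] prescribes, so that functionals
    meant for bounded functions can enter the Arens products. *)
Definition to_bidual (Phi : (S -> C) -> C) : (S -> C) -> C :=
  fun f => if `[< bdd f >] then Phi f else 0.

Lemma to_bidualE Phi f : bdd f -> to_bidual Phi f = Phi f.
Proof. by rewrite /to_bidual => /asboolT ->. Qed.

Lemma to_bidualP Phi : in_linf_dual Phi -> bidual (to_bidual Phi).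
Proof.
move=> [lPhi [c [c0 bPhi]]]; split; last by move=> f nf; rewrite /to_bidual asboolF.
split=> [f g a bf bg|].
  by rewrite !to_bidualE ?lPhi//; apply: bddD => //; exact: bddZ.
exists c; split=> // f d fd; rewrite to_bidualE; first exact: bPhi.
by exists d.
Qed.

Lemma arens1E Phi Psi f : bdd f ->
  arens1 mul w Phi Psi f = Phi (fun g => Psi (fun h => Om g h * f (mul g h))).
Proof. by rewrite /arens1 => /asboolT ->. Qed.

Lemma bdd2_Omega_mul (f : S -> C) : bdd f -> bdd2 (fun g h => Om g h * f (mul g h)).
Proof.
move=> [c fc]; exists (1 * c) => g h; rewrite normrM ler_pM//.
exact: norm_Omega.
Qed.

Hypothesis Hreg : arens_regular mul w.

(** The two sides are the two Arens products of [Phi] and [Psi], evaluated at [f]. *)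
Lemma swaps_Omega_mul (f : S -> C) : bdd f -> swaps (fun g h => Om g h * f (mul g h)).
Proof.
move=> bf Phi Psi hPhi hPsi; have b2 := bdd2_Omega_mul bf.
have := Hreg (to_bidualP hPhi) (to_bidualP hPsi) => /(congr1 (fun T => T f)).
rewrite /arens1 /arens2 (asboolT bf).
rewrite (_ : (fun g => to_bidual Psi _) = fun g => Psi (fun h => Om g h * f (mul g h))); last first.
  by apply/funext => g; rewrite to_bidualE//; exact: bdd2l b2.
rewrite (_ : (fun g => to_bidual Phi _) = fun h => Phi (fun g => Om g h * f (mul g h))); last first.
  by apply/funext => h; rewrite to_bidualE//; exact: bdd2r b2.
rewrite !to_bidualE//; first exact: bdd2_fun (bdd2C b2) hPhi.
exact: bdd2_fun.
Qed.

Hypothesis Hwc : weakly_cancellative mul.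

(* Otherwise subsequences [k], [g] with [Om (k i) (g j)] bounded below for
   [i <= j] can be chosen so that no [k i * g j] with [j < i] belongs to
   [P = {k i * g j | i <= j}], and [Om g h * 1_P (g h)] has different iterated limits. *)
Lemma zero_clusters_Omega : zero_clusters Om.
Proof.
move=> x y dx dy.
have one : bdd (fun _ : S => 1 : C) by exact: bdd_cst.
have EO : (fun g h => Om g h * 1) = Om.
  by apply/funext => g; apply/funext => h; rewrite mulr1.
(* Arens regularity at the constant function [1] equates the two iterated limits of [Om]; one of
   them remains to be shown zero. *)
have Odbl : dbl Om by rewrite -EO; exact: swaps_dbl (swaps_Omega_mul one).
rewrite -Odbl; suff -> : ulim (fun m => ulim (fun n => Om (x m) (y n))) = 0 by [].
apply/eqP; apply: contraT; rewrite -normr_gt0; set c := `|_| => c0.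
have bO (z z' : nat -> S) : bdd2 (fun m n => Om (z m) (z' n)).
  by exists 1 => m n; exact: norm_Omega.
pose v m := ulim (fun n => Om (x m) (y n)).
have bv : bdd v by exact: bdd_ulim (bO x y).
(* One halving for each of the two nested limits. *)
pose d := c / 2; have d0 : 0 < d by rewrite divr_gt0 ?ltr0n.
pose d2 := d / 2; have d20 : 0 < d2 by rewrite divr_gt0 ?ltr0n.
have below (u : nat -> C) (r : C) : bdd u -> 0 < r -> r <= `|ulim u| -> FU [set n | r / 2 <= `|u n|].
  move=> bu r0 ru; have r20 : 0 < r / 2 by rewrite divr_gt0 ?ltr0n.
  apply: filterS (ulimP bu r20) => n /= h.
  have : r <= `|u n| + r / 2.
    rewrite (le_trans ru)// -[X in `|X|](subrK (u n)) addrC (le_trans (ler_normD _ _))//.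
    by rewrite lerD2l distrC ltW.
  by rewrite {1}[r]splitr lerD2r.
have hv : FU [set m | d <= `|v m|] by exact: below.
pose prods (s1 s2 : seq nat) := [seq mul (x i) (y j) | i <- s1, j <- s2].
(* The new [x] sends no earlier [y] to a product already formed; then the new [y] is sent by no [x]
   so far, the new one included, to a product of these [x] with earlier [y]. Weak cancellativity
   excludes only finitely many elements each time. *)
pose P (s : seq (nat * nat)) t := [/\
  d <= `|v t.1|,
  forall q, List.In q s ->
    ~ List.In (mul (x t.1) (y q.2)) (prods (map fst s) (map snd s)),
  forall q, List.In q (rcons s t) -> d <= `|v q.1| -> d2 <= `|Om (x q.1) (y t.2)| &
  forall q, List.In q (rcons s t) ->
    ~ List.In (mul (x q.1) (y t.2)) (prods (map fst (rcons s t)) (map snd s))].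
have [|u hu] := @dep_seq _ P.
  move=> s; set L := prods (map fst s) (map snd s).
  have fin (op : S -> S) (l : seq S) : (forall a, finite_set [set t | op t = a]) ->
      finite_set [set t | List.In (op t) l].
    move=> opf; elim: l => [|a l IH]; first by apply: sub_finite_set (finite_set0 _) => t [].
    have : finite_set ([set t | op t = a] `|` [set t | List.In (op t) l]).
      by rewrite finite_setU; split.
    by apply: sub_finite_set => t /= [->|]; [left|right].
  have h1 := @FU_all _ (fun q => [set i | ~ List.In (mul (x i) (y q.2)) L]) s
     (fun q _ => diffuse_finite dx (fin _ L (fun a => (Hwc (y q.2) a).2))).
  have [i [vi hi]] := FU_ex (filterI hv h1).
  pose s' := rcons (map fst s) i; pose L' := prods s' (map snd s).
  have h2 : FU [set j | forall k, List.In k s' -> d <= `|v k| -> d2 <= `|Om (x k) (y j)|].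
    apply: (@FU_all _ (fun k => [set j | d <= `|v k| -> d2 <= `|Om (x k) (y j)|])) => k _.
    have [vk|nvk] := pselect (d <= `|v k|); last by apply: filterS filterT => j _ /nvk.
    by apply: filterS (below _ _ (bdd2l k (bO x y)) d0 vk) => j /= h _.
  have h3 := @FU_all _ (fun k => [set j | ~ List.In (mul (x k) (y j)) L']) s'
     (fun k _ => diffuse_finite dy (fin _ L' (fun a => (Hwc (x k) a).1))).
  have [j [j2 j3]] := FU_ex (filterI h2 h3).
  have s'E : map fst (rcons s (i, j)) = s' by rewrite map_rcons.
  exists (i, j); split=> //= q qs.
    by apply: j2; rewrite -s'E; exact: List.in_map.
  by rewrite s'E; apply: j3; rewrite -s'E; exact: List.in_map.
have uS k l : (k < l)%N -> List.In (u k) (mkseq u l) by exact: mem_mkseq_lt.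
have uS' k l : (k <= l)%N -> List.In (u k) (rcons (mkseq u l) (u l)).
  by rewrite -mkseqS => kl; exact: mem_mkseq_lt.
pose k i := x (u i).1; pose g j := y (u j).2.
have Ohi i j : (i <= j)%N -> d2 <= `|Om (k i) (g j)|.
  move=> ij; case: (hu j) => _ _ /(_ _ (uS' _ _ ij)) + _; apply.
  by case: (hu i).
pose Q : set S := [set z | exists i j, (i <= j)%N /\ z = mul (k i) (g j)].
have nQ i j : (j < i)%N -> ~ Q (mul (k i) (g j)).
  move=> ji [a [b [ab E]]]; have [bi|ib] := ltnP b i.
    case: (hu i) => _ /(_ _ (uS _ _ ji)) + _ _; apply; rewrite -/(k i) -/(g j) E.
    by apply: In_allpairs; apply: List.in_map; apply: uS => //; exact: leq_ltn_trans bi.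
  case: (hu b) => _ _ _ /(_ _ (uS' _ _ ab)); apply; rewrite -/(k a) -/(g b) -E.
  by apply: In_allpairs; apply: List.in_map; [exact: uS'|apply: uS; exact: leq_trans ib].
have := swaps_dbl (swaps_Omega_mul (bdd_ind R Q)) k g.
have -> : ulim (fun n => ulim (fun m => Om (k m) (g n) * ind R Q (mul (k m) (g n)))) = 0.
  rewrite -(ulim_cst (0 : C)); congr ulim; apply/funext => n; rewrite -[RHS]ulim_cst.
  by apply: eq_ulim; apply: filterS (FU_free n.+1) => m /= nm; rewrite ind0 ?mulr0//; exact: nQ.
move/eqP; rewrite -normr_eq0 => /eqP E0.
have bOQ : bdd2 (fun m n => Om (k m) (g n) * ind R Q (mul (k m) (g n))).
  apply: bdd2M; first exact: bO.
  by exists 1 => m n; exact: norm_ind.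
have : d2 <= `|ulim (fun m => ulim (fun n => Om (k m) (g n) * ind R Q (mul (k m) (g n))))|.
  apply: ulim_norm_ge; [exact: bdd_ulim bOQ|exact: ltW|].
  apply: filterS filterT => m _ /=; apply: ulim_norm_ge; [exact: bdd2l bOQ|exact: ltW|].
  apply: filterS (FU_free m) => n /= mn; rewrite ind1 ?mulr1; first exact: Ohi.
  by exists m, n.
by rewrite E0 => /(lt_le_trans d20); rewrite ltxx.
Qed.

End WeightedSemigroup.

(** * The space of separately continuous functions *)

Section Swaps.
Variables (R : realType).
Local Notation C := R[i].

Lemma swapsC (X Y : Type) (f : X -> Y -> C) : swaps f -> swaps (fun y x => f x y).
Proof. by move=> sf Phi Psi hPhi hPsi; rewrite sf. Qed.

Lemma swaps_lin (X Y : Type) a (f g : X -> Y -> C) : bdd2 f -> bdd2 g ->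
  swaps f -> swaps g -> swaps (fun x y => a * f x y + g x y).
Proof.
move=> bf bg sf sg Phi Psi hPhi hPsi.
transitivity (Phi (fun x => a * Psi (f x) + Psi (g x))).
  by congr Phi; apply/funext => x; rewrite linfP//; exact: bdd2l.
rewrite linfP ?sf ?sg//; try exact: bdd2_fun.
rewrite -linfP//; try exact: (bdd2_fun (bdd2C _)).
by congr Psi; apply/funext => y; rewrite linfP//; exact: bdd2r.
Qed.

(** The image under [u] of the measure [Phi] with density [a]. *)
Lemma linf_weight (X Y : Type) (a : X -> C) (u : X -> Y) (Phi : (X -> C) -> C) :
  bdd a -> in_linf_dual Phi -> in_linf_dual (fun g => Phi (fun x => a x * g (u x))).
Proof.
move=> ba hPhi.
have bu (g : Y -> C) : bdd g -> bdd (fun x => a x * g (u x)).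
  by move=> [c gc]; apply: bddM => //; exists c.
split=> [f g c bf bg|].
  rewrite -(linfP hPhi); [|exact: bu|exact: bu].
  by congr Phi; apply/funext => x; rewrite mulrDr mulrCA.
have [_ [K [K0 hK]]] := hPhi; have [d d0 ad] := bddP ba.
exists (K * d); split; first by rewrite mulr_ge0// ltW.
move=> f r fr; rewrite -mulrA; apply: hK => x.
by rewrite normrM ler_pM.
Qed.

Lemma swaps_weight (X Y Z : Type) (a : Z -> C) (u : Z -> X) (f : X -> Y -> C) :
  bdd a -> bdd2 f -> swaps f -> swaps (fun z y => a z * f (u z) y).
Proof.
move=> ba bf sf Phi Psi hPhi hPsi.
rewrite -(sf (fun g => Phi (fun z => a z * g (u z))) Psi)//; last exact: linf_weight.
by congr Phi; apply/funext => z; rewrite linfZ//; exact: bdd2l.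
Qed.

Lemma dbl_reindex (X Y Z : Type) (f : X -> Y -> C) (u : Z -> Y) :
  dbl f -> dbl (fun x z => f x (u z)).
Proof. by move=> df x z; exact: (df x (u \o z)). Qed.

End Swaps.

Section SeparatelyContinuous.
Variables (R : realType) (S : Type).
Local Notation C := R[i].
Local Open Scope classical_set_scope.

#[local] Existing Instance FU_ultra.
#[local] Existing Instance FU_proper.

(** Stated with [swaps] rather than [clusters], since the actions apply functionals to [F]; [C^o]
    supplies the module structure on functions. *)
Definition sepcont : {pred (S * S -> C^o)} :=
  fun F => `[< bdd F /\ swaps (fun s t => F (s, t)) >].

Lemma sepcontP (F : S * S -> C^o) :
  F \in sepcont <-> bdd F /\ swaps (fun s t => F (s, t)).
Proof. by rewrite unfold_in; split=> /asboolP. Qed.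

Lemma sepcont_submod : submod_closed sepcont.
Proof.
split.
  apply/sepcontP; split=> [|Phi Psi h1 h2]; first exact: bdd_cst.
  change (Phi (fun=> Psi (fun=> 0)) = Psi (fun=> Phi (fun=> 0))).
  by rewrite (linf0 h2) (linf0 h1) (linf0 h2).
move=> a F G /sepcontP[bF sF] /sepcontP[bG sG]; apply/sepcontP; split.
  by apply: bddD => //; exact: (bddZ _ bF).
have b2 (H : S * S -> C) : bdd H -> bdd2 (fun s t => H (s, t)) by move=> [c hc]; exists c.
exact: (swaps_lin _ (b2 _ bF) (b2 _ bG) sF sG).
Qed.

HB.instance Definition _ :=
  GRing.isSubmodClosed.Build C (S * S -> C^o) sepcont sepcont_submod.

Record sepfun := SepFun {sepval :> S * S -> C^o; _ : sepval \in sepcont}.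
HB.instance Definition _ := [isSub for sepval].
HB.instance Definition _ := [Choice of sepfun by <:].
HB.instance Definition _ := [SubChoice_isSubLmodule of sepfun by <:].

Lemma sepfun_bdd (F : sepfun) : bdd (sepval F).
Proof. by case: F => F /= /sepcontP[]. Qed.

Lemma sepfun_bdd2 (F : sepfun) : bdd2 (fun s t => F (s, t)).
Proof. by have [c hc] := sepfun_bdd F; exists c. Qed.

Lemma sepfun_swaps (F : sepfun) : swaps (fun s t => F (s, t)).
Proof. by case: F => F /= /sepcontP[]. Qed.

Definition sepnorm (F : sepfun) : C := (supn (sepval F))%:C.

Lemma sepnorm_ub (F : sepfun) p : `|F p| <= sepnorm F.
Proof. exact/supn_ub/sepfun_bdd. Qed.

Lemma sepnorm_le (F : sepfun) d : 0 <= d -> (forall p, `|F p| <= d) -> sepnorm F <= d.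
Proof. exact: supn_le. Qed.

Lemma sepnorm_ge0 (F : sepfun) : 0 <= sepnorm F.
Proof. by rewrite ler0c; apply/supn_ge0/sepfun_bdd. Qed.

Lemma sepnormD (F G : sepfun) : sepnorm (F + G) <= sepnorm F + sepnorm G.
Proof.
apply: sepnorm_le => [|p]; first by rewrite addr_ge0 ?sepnorm_ge0.
by rewrite (le_trans (ler_normD _ _))// lerD ?sepnorm_ub.
Qed.

Lemma sepnormZ a (F : sepfun) : sepnorm (a *: F) = `|a| * sepnorm F.
Proof.
have le b (G : sepfun) : sepnorm (b *: G) <= `|b| * sepnorm G.
  apply: sepnorm_le => [|p]; first by rewrite mulr_ge0 ?sepnorm_ge0.
  by rewrite normrM ler_wpM2l ?sepnorm_ub.
apply/eqP; rewrite eq_le le/=; have [->|a0] := eqVneq a 0.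
  by rewrite normr0 mul0r sepnorm_ge0.
have := le a^-1 (a *: F); rewrite scalerA mulVf// scale1r normfV.
by rewrite ler_pdivlMl ?normr_gt0.
Qed.

Lemma sepnorm0_eq0 (F : sepfun) : sepnorm F = 0 -> F = 0.
Proof.
move=> F0; apply: val_inj; apply/funext => p; apply/eqP.
by rewrite -normr_le0 -F0 sepnorm_ub.
Qed.

HB.instance Definition _ :=
  Lmodule_isNormed.Build C sepfun sepnormD sepnormZ sepnorm0_eq0.

(** Each side of [swaps] moves by at most [K * L * r n] when [G] is replaced by [F n]; completeness
    of the space rests on this. *)
Lemma sepcont_uniform_limit (F : nat -> sepfun) (G : S * S -> C) (r : nat -> C) :
  (forall n p, `|F n p - G p| <= r n) -> (forall e, 0 < e -> exists n, r n < e) ->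
  (G : S * S -> C^o) \in sepcont.
Proof.
move=> FG r0.
have [n0 rn0] := r0 1 ltr01.
have bG : bdd G.
  exists (sepnorm (F n0) + r n0) => p.
  rewrite -[G p](subKr (F n0 p)) (le_trans (ler_normB _ _))// lerD ?sepnorm_ub//.
apply/sepcontP; split=> // Phi Psi hPhi hPsi.
have b2G : bdd2 (fun s t => G (s, t)) by case: bG => c hc; exists c.
have [K K0 hK] := linf_bound hPhi; have [L L0 hL] := linf_bound hPsi.
apply/eqP; rewrite -subr_eq0; apply/eqP/le_eps_eq0 => e e0.
have KL : 0 < K * L * 2 by rewrite !mulr_gt0 ?ltr0n.
have [n rn] := r0 (e / (K * L * 2)) (divr_gt0 e0 KL).
have [[s _]|nS] := pselect (exists s : S, True); last first.
  have nS2 (f g : S -> C) : f = g by apply/funext => s; case: nS; exists s.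
  rewrite (nS2 (fun x => Psi _) (fun=> 0)) (nS2 (fun y => Phi _) (fun=> 0)) !linf0//.
  by rewrite subrr normr0 ltW.
have rn0' : 0 <= r n := le_trans (normr_ge0 _) (FG n (s, s)).
have b2F := sepfun_bdd2 (F n).
have E1 : `|Phi (fun s => Psi (fun t => F n (s, t))) - Phi (fun s => Psi (fun t => G (s, t)))|
    <= K * (L * r n).
  rewrite -linfB//; try exact: bdd2_fun.
  apply: hK => [|x]; first by rewrite mulr_ge0// ltW.
  by rewrite -linfB//; [apply: hL|exact: bdd2l x b2F|exact: bdd2l x b2G].
have E2 : `|Psi (fun t => Phi (fun s => F n (s, t))) - Psi (fun t => Phi (fun s => G (s, t)))|
    <= L * (K * r n).
  rewrite -linfB//; [|exact: (bdd2_fun (bdd2C b2F))|exact: (bdd2_fun (bdd2C b2G))].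
  apply: hL => [|x]; first by rewrite mulr_ge0// ltW.
  by rewrite -linfB//; [apply: hK|exact: bdd2r x b2F|exact: bdd2r x b2G].
move: E1 E2; rewrite (sepfun_swaps (F n))//= => E1 E2.
rewrite -(subrKA (Psi (fun t => Phi (fun s => F n (s, t))))) (le_trans (ler_normD _ _))//.
rewrite distrC (le_trans (lerD E1 E2))// !mulrA [L * K]mulrC -mulr2n -[X in X <= _]mulr_natr.
by rewrite mulrAC -ler_pdivlMl// mulrC ltW.
Qed.

Lemma sepfun_complete (F : set_system sepfun) : ProperFilter F -> cauchy F -> cvg F.
Proof.
move=> FF /cauchyP cF.
have /choice[x hx] n : exists x, F (ball (x : sepfun) (n.+1%:R^-1 : C)).
  by apply: cF; rewrite invr_gt0 ltr0n.
pose G p := ulim (fun n => (x n : sepfun) p).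
have ballE (y z : sepfun) (e : C) : ball y e z = (sepnorm (y - z) < e) by rewrite -ball_normE.
have xx n m p : (n <= m)%N -> `|x n p - x m p| <= 2 * n.+1%:R^-1.
  move=> nm; have [z []] := filter_ex (filterI (hx n) (hx m)).
  rewrite !ballE => h1 h2.
  have -> : x n p - x m p = (x n - z) p - (x m - z) p.
    by rewrite /= opprB addrA subrK.
  rewrite (le_trans (ler_normB _ _))// mulr_natl mulr2n lerD//.
    by rewrite (le_trans (sepnorm_ub _ _))// ltW.
  apply: (le_trans (sepnorm_ub _ _)); apply: (le_trans (ltW h2)).
  by rewrite lef_pV2 ?posrE ?ltr0n// ler_nat ltnS.
have bx p : bdd (fun n => x n p).
  exists (`|x 0%N p| + 2 * 1%:R^-1) => n.
  rewrite -[x n p](subKr (x 0%N p)) (le_trans (ler_normB _ _))// lerD//.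
  exact: xx.
have i0 n : 0 <= 2 * n.+1%:R^-1 :> C by rewrite mulr_ge0// invr_ge0.
have xG n p : `|x n p - G p| <= 2 * n.+1%:R^-1.
  rewrite -(ulim_cst (x n p)) -ulimB//; last exact: bdd_cst.
  apply: (ucvg_norm_le (i0 n) (ulimP _)); first by apply: bddB => //; exact: bdd_cst.
  by apply: filterS (FU_free n) => m /=; exact: xx.
have small e : 0 < e -> exists n, 2 * n.+1%:R^-1 < e :> C.
  move=> e0; have [|n ne] := @eps_inv _ (e / 2); first by rewrite divr_gt0 ?ltr0n.
  by exists n; rewrite -ltr_pdivlMl ?ltr0n// mulrC.
have Gs : (G : S * S -> C^o) \in sepcont by exact: sepcont_uniform_limit xG small.
apply/cvg_ex; exists (SepFun Gs); apply/cvg_ballP => e e0.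
have e2 : 0 < e / 2 by rewrite divr_gt0 ?ltr0n.
have [n ne] := small _ e2.
apply: filterS (hx n) => z; rewrite !ballE => zx.
have -> : SepFun Gs - z = (SepFun Gs - x n) + (x n - z) by rewrite addrA subrK.
rewrite (le_lt_trans (sepnormD _ _))// [ltRHS]splitr ler_ltD//.
  rewrite (le_trans _ (ltW ne))//; apply: sepnorm_le => // p.
  by rewrite /= distrC xG.
rewrite (lt_le_trans zx)// (le_trans _ (ltW ne))// ler_peMl ?invr_ge0//.
by rewrite ler1n.
Qed.

HB.instance Definition _ := Uniform_isComplete.Build sepfun sepfun_complete.

End SeparatelyContinuous.

(** * From Connes-amenability to a virtual diagonal *)

Section ConnesAmenability.
Variables (R : realType) (S : Type) (mul : S -> S -> S) (w : S -> R).
Local Notation C := R[i].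
Local Notation Om := (Omega mul w).
Hypothesis Hassoc : semigroup_assoc mul.
Hypothesis Hw : is_weight mul w.
Hypothesis Hreg : arens_regular mul w.

Implicit Types (Phi Psi Th : (S -> C) -> C) (f : S -> C) (F : S * S -> C).

(** [trl Phi h] and [trr Phi g] are the products of [delta_h] with [Phi] and of [Phi] with
    [delta_g], and [aprod] is the first Arens product, all without the normalization on unbounded
    functions. *)
Definition trl Phi h : (S -> C) -> C := fun f => Phi (fun k => Om h k * f (mul h k)).
Definition trr Phi g : (S -> C) -> C := fun f => Phi (fun k => Om k g * f (mul k g)).
Definition aprod Phi Psi : (S -> C) -> C := fun f => Phi (fun k => trl Psi k f).

Lemma trl_linf Phi h : in_linf_dual Phi -> in_linf_dual (trl Phi h).
Proof.
apply: (@linf_weight _ _ _ (Om h) (mul h)).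
by exists 1 => k; exact: (norm_Omega Hw).
Qed.

Lemma trr_linf Phi g : in_linf_dual Phi -> in_linf_dual (trr Phi g).
Proof.
apply: (@linf_weight _ _ _ (Om^~ g) (mul^~ g)).
by exists 1 => k; exact: (norm_Omega Hw).
Qed.

Lemma bdd_trl Phi f : in_linf_dual Phi -> bdd f -> bdd (fun k => trl Phi k f).
Proof. by move=> hPhi bf; apply: (bdd2_fun (bdd2_Omega_mul Hw bf)). Qed.

Lemma bdd_trr Phi f : in_linf_dual Phi -> bdd f -> bdd (fun k => trr Phi k f).
Proof. by move=> hPhi bf; apply: (bdd2_fun (bdd2C (bdd2_Omega_mul Hw bf))). Qed.

Lemma aprod_linf Phi Psi : in_linf_dual Phi -> in_linf_dual Psi -> in_linf_dual (aprod Phi Psi).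
Proof.
move=> hPhi hPsi; split=> [f g a bf bg|].
  rewrite /aprod -(linfP hPhi); [|exact: bdd_trl|exact: bdd_trl].
  by congr Phi; apply/funext => k; exact: (linfP (trl_linf k hPsi)).
have [_ [K [K0 hK]]] := hPhi; have [_ [L [L0 hL]]] := hPsi.
exists (K * L); split; first exact: mulr_ge0.
move=> f d fd; rewrite -mulrA; apply: hK => k; apply: hL => l.
by rewrite normrM -[leRHS]mul1r ler_pM// (norm_Omega Hw).
Qed.

Lemma aprodE Phi Psi f : in_linf_dual Phi -> in_linf_dual Psi -> bdd f ->
  aprod Phi Psi f = Psi (fun h => trr Phi h f).
Proof. by move=> hPhi hPsi bf; exact: (swaps_Omega_mul Hw Hreg bf hPhi hPsi). Qed.

Lemma arens1_aprod Phi Psi f : bdd f -> arens1 mul w Phi Psi f = aprod Phi Psi f.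
Proof. exact: arens1E. Qed.

Lemma arens1_bidual Phi Psi : bidual Phi -> bidual Psi -> bidual (arens1 mul w Phi Psi).
Proof.
move=> [hPhi _] [hPsi _]; exact: (to_bidualP (aprod_linf hPhi hPsi)).
Qed.

Lemma trl_aprod Phi Psi h f : trl (aprod Phi Psi) h f =
  Phi (fun k => Psi (fun l => Om h k * (Om (mul h k) l * f (mul (mul h k) l)))).
Proof.
congr Phi; apply/funext => k; congr Psi; apply/funext => l.
by rewrite !mulrA -(Omega_cocycle Hassoc Hw) Hassoc mulrAC.
Qed.

Definition ractf F Phi : S * S -> C := fun p => trr Phi p.1 (fun s => F (s, p.2)).
Definition lactf Phi F : S * S -> C := fun p =>
  Phi (fun k => Om p.2 k * F (p.1, mul p.2 k) - Om p.1 p.2 * F (mul p.1 p.2, k)).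

Definition curry2 F := fun s t => F (s, t).

Lemma lactfE Phi F g h : in_linf_dual Phi -> bdd F ->
  lactf Phi F (g, h) = trl Phi h (curry2 F g) - Om g h * Phi (curry2 F (mul g h)).
Proof.
move=> hPhi [c Fc]; have bF s : bdd (curry2 F s) by exists c => t; exact: Fc.
rewrite /lactf/= linfB//; last exact: bddZ (bF _).
  by rewrite (linfZ hPhi (Om g h) (bF (mul g h))).
by apply: bddM; [exists 1 => k; exact: (norm_Omega Hw)|exists c => k; exact: Fc].
Qed.

Lemma bdd_curry2 F : bdd F -> bdd2 (curry2 F).
Proof. by move=> [c Fc]; exists c => s t; exact: Fc. Qed.

Lemma bdd_ractf F Phi : bdd F -> in_linf_dual Phi -> bdd (ractf F Phi).
Proof.
move=> /bddP[c c0 Fc] /linf_bound[K K0 hK]; exists (K * (1 * c)) => p; apply: hK.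
  by rewrite mul1r ltW.
by move=> k; rewrite normrM ler_pM// (norm_Omega Hw).
Qed.

Lemma bdd_lactf F Phi : bdd F -> in_linf_dual Phi -> bdd (lactf Phi F).
Proof.
move=> /bddP[c c0 Fc] /linf_bound[K K0 hK]; exists (K * (1 * c + 1 * c)) => p; apply: hK.
  by rewrite !mul1r addr_ge0// ltW.
move=> k; rewrite (le_trans (ler_normB _ _))// !normrM.
by rewrite lerD// ler_pM// (norm_Omega Hw).
Qed.

(** Integrating the first variable of [F . Phi] against [Th] amounts to integrating that of [F]
    against [aprod Phi Th], so the interchange for [F] is used with this functional. *)
Lemma ractf_sepcont F Phi : (F : S * S -> C^o) \in sepcont (R:=R) (S:=S) -> in_linf_dual Phi ->
  (ractf F Phi : S * S -> C^o) \in sepcont (R:=R) (S:=S).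
Proof.
move=> /sepcontP[bF sF] hPhi; apply/sepcontP; split; first exact: bdd_ractf.
move=> Th Psi hTh hPsi; have b2 := bdd_curry2 bF.
have bT h : bdd (curry2 F ^~ h) by exact: bdd2r b2.
transitivity (aprod Phi Th (fun s => Psi (curry2 F s))).
  rewrite aprodE//; last exact: bdd2_fun.
  by congr Th; apply/funext => g; rewrite (sF (trr Phi g) Psi)//; exact: trr_linf.
rewrite (sF (aprod Phi Th) Psi)//; last exact: aprod_linf.
by congr Psi; apply/funext => h; exact: (aprodE hPhi hTh (bT h)).
Qed.

(** The correction has the form [Om s t * phi (s t)], covered by Arens regularity; for the main
    term, [Psi] is replaced by [aprod Psi Phi] in the interchange for [F]. *)
Lemma lactf_sepcont F Phi : (F : S * S -> C^o) \in sepcont (R:=R) (S:=S) -> in_linf_dual Phi ->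
  (lactf Phi F : S * S -> C^o) \in sepcont (R:=R) (S:=S).
Proof.
move=> /sepcontP[bF sF] hPhi; apply/sepcontP; split; first exact: bdd_lactf.
have b2 := bdd_curry2 bF.
have bP : bdd (fun s => Phi (curry2 F s)) by exact: bdd2_fun.
have -> : (fun s t => lactf Phi F (s, t)) = fun s t =>
    (-1) * (Om s t * Phi (curry2 F (mul s t))) + trl Phi t (curry2 F s).
  by apply/funext => s; apply/funext => t; rewrite lactfE// mulN1r addrC.
apply: swaps_lin.
- exact: (bdd2_Omega_mul Hw bP).
- have [c c0 Fc] := bdd2P b2; have [K K0 hK] := linf_bound hPhi.
  exists (K * (1 * c)) => s t; apply: hK; first by rewrite mul1r ltW.
  by move=> k; rewrite normrM ler_pM// (norm_Omega Hw).
- exact: (swaps_Omega_mul Hw Hreg bP).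
move=> Th Psi hTh hPsi.
transitivity (aprod Psi Phi (fun t => Th (curry2 F ^~ t))).
  rewrite -(sF Th (aprod Psi Phi))//; exact: aprod_linf.
by congr Psi; apply/funext => h; exact: esym (sF Th (trl Phi h) hTh (trl_linf h hPhi)).
Qed.

(** Actions are total in the functional; [insubd] returns [0] if the result leaves the space, which
    does not happen for [Phi] in the dual. *)
Definition ract (F : sepfun R S) Phi : sepfun R S := insubd 0 (ractf F Phi : S * S -> C^o).
Definition lact Phi (F : sepfun R S) : sepfun R S := insubd 0 (lactf Phi F : S * S -> C^o).

Lemma ractE (F : sepfun R S) Phi : in_linf_dual Phi -> sepval (ract F Phi) = ractf F Phi.
Proof. by move=> hPhi; apply: insubdK; apply: ractf_sepcont => //; case: F. Qed.

Lemma lactE (F : sepfun R S) Phi : in_linf_dual Phi -> sepval (lact Phi F) = lactf Phi F.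
Proof. by move=> hPhi; apply: insubdK; apply: lactf_sepcont => //; case: F. Qed.

Lemma bid_scale_bidual a Phi Psi : bidual Phi -> bidual Psi -> bidual (bid_scale a Phi Psi).
Proof.
move=> [hPhi nPhi] [hPsi nPsi]; split; last first.
  by move=> f nf; rewrite /bid_scale nPhi// nPsi// mulr0 addr0.
split=> [f g b bf bg|].
  rewrite /bid_scale !linfP//; ring.
have [_ [K [K0 hK]]] := hPhi; have [_ [L [L0 hL]]] := hPsi.
exists (`|a| * K + L); split; first by rewrite addr_ge0// mulr_ge0.
move=> f d fd; rewrite /bid_scale (le_trans (ler_normD _ _))// mulrDl lerD ?hL//.
by rewrite normrM -mulrA ler_wpM2l// hK.
Qed.

Lemma sepfun_eq (F G : sepfun R S) : (forall p, F p = G p) -> F = G.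
Proof. by move=> FG; apply: val_inj; apply/funext. Qed.

Lemma sepfun_linE a (F G : sepfun R S) p : (a *: F + G) p = a * F p + G p.
Proof. by []. Qed.

Lemma normE (F : sepfun R S) : `|F| = sepnorm F.
Proof. by []. Qed.

Lemma bdd_sub2 (F : sepfun R S) s : bdd (curry2 F s).
Proof. exact: bdd2l s (bdd_curry2 (sepfun_bdd F)). Qed.

(** Acting twice creates two corrections at the triple product [g h k]; they cancel by the cocycle
    identity. *)
Lemma lactM Phi Psi (F : sepfun R S) : in_linf_dual Phi -> in_linf_dual Psi ->
  lactf (aprod Phi Psi) F = lactf Phi (lactf Psi F).
Proof.
move=> hPhi hPsi; have bF := sepfun_bdd F; have bL := bdd_lactf bF hPsi.
apply/funext => -[g h]; rewrite lactfE//; last exact: aprod_linf.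
have b1 : bdd (fun k => Om h k * trl Psi (mul h k) (curry2 F g)).
  apply: bddM; first by exists 1 => k; exact: (norm_Omega Hw).
  by have [c hc] := bdd_trl hPsi (bdd_sub2 F g); exists c => k; exact: hc.
have b2 := bdd_trl hPsi (bdd_sub2 F (mul g h)).
transitivity (Phi (fun k => Om h k * trl Psi (mul h k) (curry2 F g)
    - Om g h * trl Psi k (curry2 F (mul g h)))).
  rewrite linfB//; last exact: bddZ.
  rewrite linfZ//; congr (_ - _); rewrite trl_aprod; congr Phi; apply/funext => k.
  apply: linfZ => //; apply: bddM; first by exists 1 => l; exact: (norm_Omega Hw).
  by have [c hc] := bdd_sub2 F g; exists c => l; exact: hc.
congr Phi; apply/funext => k /=; rewrite !lactfE// !mulrBr !mulrA.
by rewrite -(Omega_cocycle Hassoc Hw) Hassoc; ring.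
Qed.

Lemma ractM Phi Psi (F : sepfun R S) : in_linf_dual Phi -> in_linf_dual Psi ->
  ractf F (aprod Phi Psi) = ractf (ractf F Phi) Psi.
Proof.
move=> hPhi hPsi; apply/funext => -[g h]; rewrite /ractf/=.
have bFh : bdd (fun s => F (s, h)) by exact: bdd2r (sepfun_bdd2 F).
have b1 : bdd (fun k => Om k g * F (mul k g, h)).
  apply: bddM; first by exists 1 => k; exact: (norm_Omega Hw).
  by have [c hc] := bFh; exists c => k; exact: hc.
rewrite {1}/trr aprodE//; congr Psi; apply/funext => l.
rewrite /trr -linfZ//; last first.
  apply: bddM; first by exists 1 => k; exact: (norm_Omega Hw).
  by have [c hc] := bFh; exists c => k; exact: hc.
congr Phi; apply/funext => k; rewrite !mulrA (Omega_cocycle Hassoc Hw).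
by rewrite Hassoc.
Qed.

Lemma lract Phi Psi (F : sepfun R S) : in_linf_dual Phi -> in_linf_dual Psi ->
  ractf (lactf Phi F) Psi = lactf Phi (ractf F Psi).
Proof.
move=> hPhi hPsi; have bF := sepfun_bdd F; have bR := bdd_ractf bF hPsi.
apply/funext => -[g h]; rewrite lactfE//.
have b1 : bdd (fun l => trl Phi h (curry2 F l)).
  by apply: (bdd2_fun (bdd_curry2 bF)); exact: trl_linf.
have b2 : bdd (fun l => Phi (curry2 F l)) by exact: (bdd2_fun (bdd_curry2 bF)).
have bO1 (k : S) : bdd (Om^~ k) by exists 1 => l; exact: (norm_Omega Hw).
have bcomp (u : S -> S) f : bdd f -> bdd (fun k => f (u k)) by move=> [c hc]; exists c.
transitivity (trr Psi g (fun l => trl Phi h (curry2 F l))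
    - Om g h * trr Psi (mul g h) (fun l => Phi (curry2 F l))).
  have B1 := bddM (bO1 g) (bcomp (mul^~ g) _ b1).
  have B2 := bddM (bO1 (mul g h)) (bcomp (mul^~ (mul g h)) _ b2).
  rewrite /trr -(linfZ hPsi _ B2) -(linfB hPsi B1 (bddZ _ B2)).
  congr Psi; apply/funext => l; rewrite lactfE// mulrBr !mulrA -Hassoc.
  by rewrite (Omega_cocycle Hassoc Hw).
congr (_ - _ * _).
  by rewrite (sepfun_swaps F (trr_linf g hPsi) (trl_linf h hPhi)).
by rewrite (sepfun_swaps F (trr_linf _ hPsi) hPhi).
Qed.

Lemma sepfun_bimodule : banach_bimodule mul w lact ract.
Proof.
split; [|split; [|split]].
- move=> Phi Psi a x bPhi bPsi; have := bid_scale_bidual a bPhi bPsi.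
  case: (bPhi) (bPsi) => hPhi _ [hPsi _] [hS _].
  split; apply: sepfun_eq => p.
    by rewrite lactE//= lactE// lactE.
  by rewrite ractE//= ractE// ractE.
- move=> Phi a x y [hPhi _]; split; apply: sepfun_eq => -[g h].
    rewrite lactE// lactfE//; last exact: sepfun_bdd.
    rewrite sepfun_linE !lactE// !lactfE//; [|exact: sepfun_bdd|exact: sepfun_bdd].
    have E s : curry2 (a *: x + y) s = fun t => a * curry2 x s t + curry2 y s t by [].
    rewrite !E (linfP (trl_linf h hPhi)) ?(linfP hPhi); try exact: bdd_sub2.
    by ring.
  rewrite ractE//= !ractE//; apply: (linfP (trr_linf g hPhi)).
    exact: bdd2r (sepfun_bdd2 x).
  exact: bdd2r (sepfun_bdd2 y).
- exists 2; split=> // Phi c x [hPhi _] hc; rewrite !normE.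
  have n0 := sepnorm_ge0 x.
  have c0 : 0 <= c.
    have := hc (fun=> 1) 1; rewrite mulr1 => /(_ _)/(le_trans (normr_ge0 _)); apply.
    by move=> _; rewrite normr1.
  have -> : 2 * c * sepnorm x = c * (sepnorm x + sepnorm x) by ring.
  split; apply: sepnorm_le => [|p]; rewrite ?mulr_ge0 ?addr_ge0//.
    rewrite lactE//; apply: hc => k; rewrite (le_trans (ler_normB _ _))// !normrM.
    by rewrite lerD// -[leRHS]mul1r ler_pM ?sepnorm_ub// (norm_Omega Hw).
  rewrite ractE//; apply: hc => k; rewrite normrM -[leLHS]addr0 lerD//.
  by rewrite -[leRHS]mul1r ler_pM ?sepnorm_ub// (norm_Omega Hw).
- move=> Phi Psi x bPhi bPsi; have [hA _] := arens1_bidual bPhi bPsi.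
  case: (bPhi) (bPsi) => hPhi _ [hPsi _].
  have E F p : bdd F -> lactf (arens1 mul w Phi Psi) F p = lactf (aprod Phi Psi) F p.
    move=> bF; apply: arens1_aprod; have [c c0 Fc] := bddP bF; exists (1 * c + 1 * c) => k.
    by rewrite (le_trans (ler_normB _ _))// !normrM lerD// ler_pM// (norm_Omega Hw).
  have E' F p : bdd F -> ractf F (arens1 mul w Phi Psi) p = ractf F (aprod Phi Psi) p.
    move=> bF; apply: arens1_aprod; have [c c0 Fc] := bddP bF; exists (1 * c) => k.
    by rewrite !normrM ler_pM// (norm_Omega Hw).
  split; [|split]; apply: sepfun_eq => p.
  + by rewrite lactE// E ?lactM ?lactE// ?lactE//; exact: sepfun_bdd.
  + by rewrite ractE// E' ?ractM ?ractE// ?ractE//; exact: sepfun_bdd.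
  + by rewrite ractE// lactE// lract// lactE// ractE.
Qed.

Hypothesis Hwc : weakly_cancellative mul.

(** [swaps] concerns functionals on all bounded functions, so [mu] has to leave the subspace before
    it can be interchanged with [Phi]. *)
Lemma sepfun_extend (s0 : S) (mu : sepfun R S -> C) : in_dual mu ->
  exists2 M : (S * S -> C) -> C, in_linf_dual M & forall F : sepfun R S, M (sepval F) = mu F.
Proof.
move=> [mulin [c hc]]; pose E : set (S * S -> C) := [set F | (F : S * S -> C^o) \in sepcont (R:=R) (S:=S)]%classic.
pose m (F : S * S -> C) : C := mu (insubd 0 (F : S * S -> C^o)).
have mE (F : sepfun R S) : m (sepval F) = mu F by rewrite /m valKd.
have EE F : E F -> exists G : sepfun R S, F = sepval G by move=> EF; exists (SepFun EF).
have [||||||M hM ME] := @hahn_banach_linf R (S * S)%type (s0, s0) E m `|c|.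
- by rewrite /E/=; apply: (rpred0 (sepcont (R:=R) (S:=S))).
- move=> a f g /EE[F ->] /EE[G ->].
  by have : sepval (a *: F + G) \in sepcont (R:=R) (S:=S) by case: (a *: F + G).
- by move=> f /EE[F ->]; exact: sepfun_bdd.
- by move=> a f g /EE[F ->] /EE[G ->]; rewrite !mE -mulin -mE.
- exact: normr_ge0.
- move=> f d /EE[F ->] Fd; rewrite mE (le_trans (hc F))//.
  have cF0 : 0 <= c * `|F| := le_trans (normr_ge0 _) (hc F).
  rewrite -(ger0_norm cF0) normrM normr_id ler_wpM2l// normE.
  by apply: sepnorm_le => //; exact: le_trans (normr_ge0 _) (Fd (s0, s0)).
by exists M => // F; rewrite ME ?mE//; case: F.
Qed.

Lemma weakstar_eval (E : Type) (T : ((S -> C) -> C) -> E -> C) :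
  (forall x, exists2 q, bdd q & forall Phi, bidual Phi -> T Phi x = Phi q) -> weakstar_cont T.
Proof.
move=> Tq I le Phis Phi dI bPhis bPhi cv x; have [q bq hq] := Tq x.
by rewrite hq// (_ : (fun i => T (Phis i) x) = fun i => Phis i q); [exact: cv|apply/funext => i; rewrite hq].
Qed.

(** With [M] extending [mu], [<mu, F . Phi>] is [M_p (Phi_k (G k p))]; after the interchange it is
    [Phi] at the bounded function [k |-> M (G k)], hence weak*-continuous. The left action is
    treated in the same way, term by term. *)
Lemma sepfun_normal (s0 : S) (mu : sepfun R S -> C) : in_dual mu ->
  weakstar_cont (fun Phi => dual_lact ract Phi mu) /\
  weakstar_cont (fun Phi => dual_ract lact mu Phi).
Proof.
move=> /(sepfun_extend s0)[M hM ME].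
have zO := zero_clusters_Omega Hw Hreg Hwc.
have bO : bdd2 Om := bdd2_Omega Hw.
split; apply: weakstar_eval => F.
  pose G k (p : S * S) := Om k p.1 * F (mul k p.1, p.2).
  have bG : bdd2 G.
    have [c c0 Fc] := bddP (sepfun_bdd F); exists (1 * c) => k p.
    by rewrite normrM ler_pM// (norm_Omega Hw).
  have sG : swaps G.
    apply: (dbl_swaps bG); apply: (@dbl_mul R S S S S Om mul (curry2 F)).
    - exact: bO.
    - exact: zO.
    - exact: sepfun_bdd2.
    - exact: swaps_dbl (sepfun_swaps F).
  exists (fun k => M (G k)); first exact: bdd2_fun.
  by move=> Phi [hPhi _]; rewrite /dual_lact -ME ractE// (sG _ _ hPhi hM).
pose G1 k (p : S * S) := Om p.2 k * F (p.1, mul p.2 k).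
pose G2 k (p : S * S) := Om p.1 p.2 * F (mul p.1 p.2, k).
have [c c0 Fc] := bddP (sepfun_bdd F).
have bG1 : bdd2 G1 by exists (1 * c) => k p; rewrite normrM ler_pM// (norm_Omega Hw).
have bG2 : bdd2 G2 by exists (1 * c) => k p; rewrite normrM ler_pM// (norm_Omega Hw).
(* Here the second coordinate is multiplied, so the coordinates are exchanged before [dbl_mul]
   applies. *)
have sG1 : swaps G1.
  apply: (dbl_swaps bG1); apply: (@dbl_reindex R S (S * S)%type (S * S)%type
    (fun k p => Om p.1 k * F (p.2, mul p.1 k)) (fun p => (p.2, p.1))).
  apply: (@dbl_mul R S S S S (fun k h => Om h k) (fun k h => mul h k) (fun t s => F (s, t))).
  - exact: bdd2C bO.
  - exact: zero_clustersC zO.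
  - exact: bdd2C (sepfun_bdd2 F).
  - exact: swaps_dbl (swapsC (sepfun_swaps F)).
(* In the correction [k] is not multiplied by anything: [p] enters through a weight and the point
   [p.1 p.2], and the interchange for [F] suffices. *)
have sG2 : swaps G2.
  apply: swapsC; apply: (@swaps_weight R S S (S * S)%type (fun p => Om p.1 p.2) (fun p => mul p.1 p.2) (curry2 F)).
  - by case: bO => d hd; exists d.
  - exact: sepfun_bdd2.
  - exact: sepfun_swaps.
exists (fun k => M (G1 k) - M (G2 k)).
  by apply: bddB; exact: bdd2_fun.
move=> Phi [hPhi _]; rewrite /dual_ract -ME lactE//.
rewrite linfB//; [|exact: bdd2_fun|exact: bdd2_fun].
rewrite (sG1 _ _ hPhi hM) (sG2 _ _ hPhi hM) -linfB//; [|exact: bdd2_fun (bdd2C bG1) hPhi|exact: bdd2_fun (bdd2C bG2) hPhi].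
congr M; apply/funext => p; rewrite /lactf linfB//; [exact: bdd2r bG1|exact: bdd2r bG2].
Qed.

Variable e : (S -> C) -> C.
Hypothesis He : bidual_unit mul w e.

Let he : in_linf_dual e. Proof. by case: He => -[]. Qed.

Lemma unit_aprodl Phi f : bidual Phi -> bdd f -> aprod e Phi f = Phi f.
Proof. by move=> bPhi bf; rewrite -arens1_aprod//; have [_ /(_ _ bPhi)[-> _]] := He. Qed.

Lemma unit_aprodr Phi f : bidual Phi -> bdd f -> aprod Phi e f = Phi f.
Proof. by move=> bPhi bf; rewrite -arens1_aprod//; have [_ /(_ _ bPhi)[_ ->]] := He. Qed.

Definition delta (k : S) : (S -> C) -> C := to_bidual (fun f => f k).

Lemma eval_linf (k : S) : in_linf_dual (fun f : S -> C => f k).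
Proof.
split=> // ; exists 1; split=> // f d fd.
by rewrite mul1r.
Qed.

Lemma delta_bidual k : bidual (delta k).
Proof. exact/to_bidualP/eval_linf. Qed.

Lemma deltaE k f : bdd f -> delta k f = f k.
Proof. exact: to_bidualE. Qed.

Lemma lact_delta k F g h : bdd F ->
  lactf (delta k) F (g, h) = Om h k * F (g, mul h k) - Om g h * F (mul g h, k).
Proof.
move=> /bddP[c c0 Fc]; rewrite /lactf deltaE//; exists (1 * c + 1 * c) => t.
by rewrite (le_trans (ler_normB _ _))// !normrM lerD// ler_pM// (norm_Omega Hw).
Qed.

Lemma ract_delta k F g h : bdd F -> ractf F (delta k) (g, h) = Om k g * F (mul k g, h).
Proof.
move=> /bddP[c c0 Fc]; rewrite /ractf /trr deltaE//; exists (1 * c) => t.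
by rewrite normrM ler_pM// (norm_Omega Hw).
Qed.

(** [trl e k] is [delta_k e], so this is the unit law at a point mass. *)
Lemma unit_trl k f : bdd f -> trl e k f = f k.
Proof.
move=> bf; rewrite -(deltaE k bf) -(unit_aprodr (delta_bidual k) bf) /aprod deltaE//.
exact: bdd_trl.
Qed.

Lemma unit_trr k f : bdd f -> trr e k f = f k.
Proof.
move=> bf; have [hk _] := delta_bidual k.
rewrite -(deltaE k bf) -(unit_aprodl (delta_bidual k) bf) aprodE// deltaE//.
exact: bdd_trr.
Qed.

(** Chosen so that [F] is its own orbit function: [D delta_h (F . delta_g) = F (g, h)], because
    [delta_g e = delta_g]. *)
Definition unit_derivation Phi (F : sepfun R S) : C := e (fun s => Phi (curry2 F s)).

(** On [F], the term [Phi . D Psi] is [Phi_s Psi_t F], and [D Phi . Psi] is [e_s] of the product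
    integrated in [t], minus the same [Phi_s Psi_t F]; the correction in the left action produces
    this subtraction. *)
Lemma unit_derivationP : derivation mul w lact ract unit_derivation.
Proof.
split; [|split].
- move=> Phi [hPhi _]; split=> [a x y|].
    rewrite /unit_derivation -(linfP he); try exact: (bdd2_fun (sepfun_bdd2 _)).
    by congr e; apply/funext => s; rewrite -(linfP hPhi); try exact: bdd_sub2.
  have [K K0 hK] := linf_bound he; have [L L0 hL] := linf_bound hPhi.
  exists (K * L) => x; rewrite -mulrA; apply: hK => [|s].
    by rewrite mulr_ge0 ?(ltW L0)// sepnorm_ge0.
  by apply: hL => [|t]; [exact: sepnorm_ge0|exact: sepnorm_ub].
- move=> Phi Psi a [hPhi _] [hPsi _]; apply/funext => x.
  by rewrite /unit_derivation -(linfP he)//; exact: (bdd2_fun (sepfun_bdd2 _)).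
move=> Phi Psi bPhi bPsi; apply/funext => F.
case: (bPhi) (bPsi) => hPhi _ [hPsi _].
have bP : bdd (fun u => Psi (curry2 F u)) by exact: (bdd2_fun (sepfun_bdd2 F)).
have bPP : bdd (fun u => aprod Phi Psi (curry2 F u)).
  by apply: (bdd2_fun (sepfun_bdd2 F)); exact: aprod_linf.
rewrite /dual_lact /dual_ract /unit_derivation.
have -> : (fun s => arens1 mul w Phi Psi (curry2 F s)) = fun s => aprod Phi Psi (curry2 F s).
  by apply/funext => s; apply: arens1_aprod; exact: bdd_sub2.
have -> : e (fun s => Psi (curry2 (ract F Phi) s)) = Phi (fun u => Psi (curry2 F u)).
  rewrite -(unit_aprodr bPhi bP) aprodE//; congr e; apply/funext => s.
  rewrite (sepfun_swaps F (trr_linf s hPhi) hPsi); congr Psi; apply/funext => t.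
  by rewrite /curry2 ractE.
have -> : e (fun s => Phi (curry2 (lact Psi F) s)) =
    e (fun s => aprod Phi Psi (curry2 F s)) - aprod e Phi (fun u => Psi (curry2 F u)).
  rewrite -linfB//; last exact: bdd_trl.
  congr e; apply/funext => s.
  transitivity (Phi (fun k => trl Psi k (curry2 F s) - Om s k * Psi (curry2 F (mul s k)))); last first.
    by rewrite (linfB hPhi (bdd_trl hPsi (bdd_sub2 F s)) (bdd2l s (bdd2_Omega_mul Hw bP))).
  congr Phi; apply/funext => t; rewrite /curry2 lactE// lactfE//; exact: sepfun_bdd.
by rewrite (unit_aprodl bPhi bP) addrC subrK.
Qed.

Lemma unit_derivation_cont : weakstar_cont unit_derivation.
Proof.
apply: weakstar_eval => F; exists (fun t => e (fun s => F (s, t))).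
  exact: (bdd2_fun (bdd2C (sepfun_bdd2 F))).
by move=> Phi [hPhi _]; exact: (sepfun_swaps F he hPhi).
Qed.

Definition virtual_diagonal := exists M : (S * S -> R[i]) -> R[i],
    in_linf_dual M /\
    (forall f : S -> R[i], bdd f ->
       M (fun p => f (mul p.1 p.2) * Omega mul w p.1 p.2) = e f) /\
    (forall (k : S) (f : S * S -> R[i]), bdd f -> clusters [set: S]%classic [set: S]%classic f ->
       M (fun p => f (mul p.2 k, p.1) * Omega mul w p.2 k
                   - f (p.2, mul k p.1) * Omega mul w k p.1) = 0).

Lemma connes_amenable_diagonal (s0 : S) : connes_amenable mul w -> virtual_diagonal.
Proof.
move=> CA.
have [mu [hmu innermu]] := CA _ lact ract sepfun_bimodule (sepfun_normal s0) _
   unit_derivationP unit_derivation_cont.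
have [mt hmt mtE] := sepfun_extend s0 hmu.
pose proj (f : S * S -> C) : S * S -> C :=
  fun p => f p - Om p.1 p.2 * e (curry2 f (mul p.1 p.2)).
pose M (f : S * S -> C) := mt (proj f) + e (fun s => e (curry2 f s)).
have bce (f : S * S -> C) : bdd f -> bdd (fun s => e (curry2 f s)).
  by move=> /bdd_curry2 bf; exact: bdd2_fun.
have bproj (f : S * S -> C) : bdd f -> bdd (proj f).
  move=> bf; apply: bddB => //; have [c hc] := bdd2_Omega_mul Hw (bce f bf).
  by exists c => -[g h]; exact: hc.
exists M; split; [split|split].
- move=> f g a bf bg; have bf2 := bdd_curry2 bf; have bg2 := bdd_curry2 bg.
  have E s : e (curry2 (fun p => a * f p + g p) s) = a * e (curry2 f s) + e (curry2 g s).
    by rewrite -(linfP he)//; [exact: bdd2l bf2|exact: bdd2l bg2].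
  rewrite /M mulrDr addrACA -(linfP hmt); [|exact: bproj|exact: bproj].
  rewrite -(linfP he); [|exact: bce|exact: bce].
  congr (mt _ + e _); apply/funext => p; rewrite ?E//.
  by rewrite /proj E; ring.
- have [_ [K [K0 hK]]] := hmt; have [_ [L [L0 hL]]] := he.
  exists (K * (1 + L) + L * L); split; first by rewrite addr_ge0 ?mulr_ge0 ?addr_ge0.
  move=> f d fd; have d0 : 0 <= d := le_trans (normr_ge0 _) (fd (s0, s0)).
  have ed s : `|e (curry2 f s)| <= L * d by apply: hL => t; exact: fd.
  rewrite /M (le_trans (ler_normD _ _))// mulrDl lerD//.
    rewrite -mulrA; apply: hK => p; rewrite /proj (le_trans (ler_normB _ _))//.
    by rewrite mulrDl mul1r lerD// normrM -[leRHS]mul1r ler_pM// (norm_Omega Hw).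
  by rewrite -mulrA; apply: hL.
- move=> f bf; rewrite /M.
  have E s : e (curry2 (fun p => f (mul p.1 p.2) * Om p.1 p.2) s) = f s.
    rewrite -[RHS](unit_trl s bf); congr e; apply/funext => t.
    by rewrite /curry2/= mulrC.
  have -> : proj (fun p => f (mul p.1 p.2) * Om p.1 p.2) = fun=> 0.
    by apply/funext => p; rewrite /proj E mulrC subrr.
  by rewrite (linf0 hmt) add0r; congr e; apply/funext => s; rewrite E.
move=> k f bf cf.
(* Condition (2) takes the arguments of [f] in the order opposite to that of [E]. *)
have bfs : bdd (fun p : S * S => f (p.2, p.1)) by case: bf => c hc; exists c.
have Fs : ((fun p => f (p.2, p.1)) : S * S -> C^o) \in sepcont (R:=R) (S:=S).
  apply/sepcontP; split=> //; apply: swapsC; apply: dbl_swaps.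
    by case: bf => c hc; exists c.
  exact: clusters_dbl.
pose F : sepfun R S := SepFun Fs.
pose ef s := e (curry2 F s).
have bef : bdd ef by exact: bce.
have PFs : (proj F : S * S -> C^o) \in sepcont (R:=R) (S:=S).
  apply/sepcontP; split; first by apply: bproj; exact: sepfun_bdd.
  have -> : (fun s t => proj F (s, t)) = fun s t => (-1) * (Om s t * ef (mul s t)) + F (s, t).
    by apply/funext => s; apply/funext => t; rewrite mulN1r addrC.
  apply: swaps_lin; [exact: (bdd2_Omega_mul Hw bef)|exact: sepfun_bdd2| |exact: sepfun_swaps].
  exact: (swaps_Omega_mul Hw Hreg bef).
pose PF : sepfun R S := SepFun PFs.
have hk := (delta_bidual k).1.
pose T (p : S * S) : C := f (mul p.2 k, p.1) * Om p.2 k - f (p.2, mul k p.1) * Om k p.1.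
rewrite -/T /M.
have eT u : e (curry2 T u) = F (u, k) - Om k u * ef (mul k u).
  have b1 : bdd (fun t => Om t k * F (u, mul t k)).
    exact: bdd2r k (bdd2_Omega_mul Hw (bdd_sub2 F u)).
  rewrite -[F (u, k)]/(curry2 F u k) -(unit_trr k (bdd_sub2 F u)) /ef -(linfZ he); last exact: bdd_sub2.
  rewrite -(linfB he)//; last by apply: bddZ; exact: bdd_sub2.
  by congr e; apply/funext => t; rewrite [Om t k * _]mulrC [Om k u * _]mulrC.
have bPF := sepfun_bdd PF.
(* [T] lacks the correction term of the left action; removing the components [Om g h * phi (g h)]
   from [F] and [T] supplies it, up to two coefficients that vanish by the cocycle identity. *)
have -> : proj T = fun p => lact (delta k) PF p - ract PF (delta k) p.
  apply/funext => -[g h]; rewrite lactE// lact_delta// ractE// ract_delta//.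
  have PFE a b : PF (a, b) = F (a, b) - Om a b * ef (mul a b) by [].
  rewrite !PFE !Hassoc /proj eT /T /=.
  have := Omega_cocycle Hassoc Hw k g h; have := Omega_cocycle Hassoc Hw g h k.
  rewrite !Hassoc => E1 E2.
  apply/eqP; rewrite -subr_eq0; apply/eqP.
  transitivity ((Om g h * Om k (mul g h) - Om k g * Om (mul k g) h) * ef (mul (mul k g) h)
      + (Om h k * Om g (mul h k) - Om g h * Om (mul g h) k) * ef (mul (mul g h) k)); first by ring.
  by rewrite E1 E2 !subrr !mul0r addr0.
rewrite (linfB hmt); [|exact: sepfun_bdd|exact: sepfun_bdd].
(* As [mu] implements the derivation, [mt (proj T)] is [- D delta_k PF]; what is left is to identify
   [e_s e_t T] with [D delta_k PF]. *)
rewrite !mtE; have := innermu _ (delta_bidual k) => /(congr1 (fun D => D PF)).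
rewrite /dual_lact /dual_ract => /eqP; rewrite -subr_eq0 opprB => /eqP DE.
have bFk : bdd (fun s => F (s, k)) by exact: bdd2r k (sepfun_bdd2 F).
have -> : e (fun s => e (curry2 T s)) = unit_derivation (delta k) PF.
  have -> : unit_derivation (delta k) PF = e (fun s => F (s, k) - Om s k * ef (mul s k)).
    by congr e; apply/funext => s; rewrite deltaE//; exact: bdd_sub2.
  have := bdd2r k (bdd2_Omega_mul Hw bef) => b1.
  have := bdd2l k (bdd2_Omega_mul Hw bef) => b2.
  rewrite (linfB he bFk b1) -/(trr e k ef) unit_trr//.
  rewrite -[in RHS](unit_trl k bef) -(linfB he bFk b2).
  by congr e; apply/funext => s; exact: eT.
by rewrite addrC.
Qed.

End ConnesAmenability.

(** * From a virtual diagonal to Connes-amenability *)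

Section UniformBoundedness.
Variables (R : realType).
Local Notation C := R[i].
Local Open Scope classical_set_scope.
Variables (E : completeNormedModType C) (I : Type) (T : I -> E -> C).
Hypothesis Tdual : forall i, in_dual (T i).

Let TD i x y : T i (x + y) = T i x + T i y.
Proof. by have [h _] := Tdual i; rewrite -[x]scale1r h mul1r scale1r. Qed.

Let T0 i : T i 0 = 0.
Proof. by have := TD i 0 0; rewrite addr0 => /eqP; rewrite -subr_eq0 opprD addrA subrr sub0r oppr_eq0 => /eqP. Qed.

Let TZ i a x : T i (a *: x) = a * T i x.
Proof. by have [h _] := Tdual i; rewrite -[a *: x]addr0 h T0 addr0. Qed.

Let TB i x y : T i (x - y) = T i x - T i y.
Proof. by rewrite -scaleN1r TD TZ mulN1r. Qed.

Lemma bounded_on_ball x (r N : C) : 0 < r ->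
  (forall i z, `|z - x| <= r -> `|T i z| <= N) ->
  exists2 c, 0 <= c & forall i y, `|T i y| <= c * `|y|.
Proof.
move=> r0 h; have [[i0 _]|nI] := pselect (exists i : I, True); last first.
  by exists 0 => // i; case: nI; exists i.
have xx : `|x - x| <= r by rewrite subrr normr0 ltW.
have N0 : 0 <= N := le_trans (normr_ge0 _) (h i0 x xx).
exists ((N + N) / r); first by rewrite divr_ge0 ?addr_ge0// ltW.
move=> i y; have [->|y0] := eqVneq y 0; first by rewrite T0 !normr0 mulr0.
have yp : 0 < `|y| by rewrite normr_gt0.
pose a := r / `|y|; have a0 : 0 < a by rewrite divr_gt0.
have := h i (x + a *: y); rewrite addrAC subrr add0r normrZ gtr0_norm// /a divfK ?gt_eqF//.
move=> /(_ (lexx _)); rewrite TD TZ => h1.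
have : `|a * T i y| <= N + N.
  rewrite -[X in `|X|](addKr (T i x)) addrC (le_trans (ler_normB _ _))// lerD//; exact: h.
by rewrite normrM gtr0_norm// /a mulrAC ler_pdivrMr// mulrC -ler_pdivlMr// mulrAC.
Qed.

(** Without a uniform bound the family is unbounded on every ball. Nested balls on which some [T i]
    is at least [n] then have, by completeness, a common point where pointwise boundedness fails. *)
Lemma uniform_boundedness : (forall x, exists c, forall i, `|T i x| <= c) ->
  exists2 c, 0 <= c & forall i x, `|T i x| <= c * `|x|.
Proof.
move=> pw; apply: contrapT => nub.
have unb x (r N : C) : 0 < r -> 0 <= N -> exists i z, `|z - x| <= r /\ N < `|T i z|.
  move=> r0 N0; apply: contrapT => nx; apply: nub; apply: (@bounded_on_ball x r N r0) => i z zx.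
  rewrite real_leNgt ?normr_real ?ger0_real//; apply/negP => h.
  by apply: nx; exists i, z.
(* The default [(0, 1)] is the starting ball. The estimate is required on the doubled radius, since
   the limit point is reached through a nearby centre inside the ball. *)
pose P (s : seq (E * C)) (t : E * C) := let q := last (0, 1) s in 0 < q.2 ->
  [/\ 0 < t.2, t.2 <= q.2 / 2, `|t.1 - q.1| <= q.2 / 2 &
   exists i, forall z, `|z - t.1| <= t.2 + t.2 -> (size s)%:R <= `|T i z|].
have [|u hu] := @dep_seq _ P.
  move=> s; rewrite /P; set q := last (0, 1) s; have [q0|nq] := pselect (0 < q.2); last by exists q.
  have q20 : 0 < q.2 / 2 by rewrite divr_gt0 ?ltr0n.
  have [i [z [zq Tz]]] := unb q.1 (q.2 / 2) ((size s)%:R + 1) q20 (addr_ge0 (ler0n _ _) ler01).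
  have [_ [c hc]] := Tdual i; pose k := `|c|.
  have k0 : 0 <= k := normr_ge0 c.
  have hk y : `|T i y| <= k * `|y|.
    have cy : 0 <= c * `|y| := le_trans (normr_ge0 _) (hc y).
    by rewrite (le_trans (hc y))// -(ger0_norm cy) normrM normr_id.
  have d0 : 0 < 1 + k * q.2 by rewrite ltr_wpDr// mulr_ge0// ltW.
  (* Within [2 r] of [z] the functional [T i] varies by at most [k * 2 r <= 1]. *)
  pose r := q.2 / 2 / (1 + k * q.2).
  have r0 : 0 < r by rewrite divr_gt0.
  exists (z, r) => _; split=> //=.
    by rewrite ler_pdivrMr// ler_peMr ?(ltW q20)// lerDl mulr_ge0// ltW.
  exists i => y yz.
  have h1 : `|T i z - T i y| <= 1.
    rewrite -TB (le_trans (hk _))// distrC (le_trans (ler_wpM2l k0 yz))//.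
    rewrite /r -mulrDl -splitr mulrA ler_pdivrMr// mul1r lerDr ler01//.
  have : (size s)%:R + 1 <= `|T i y| + 1.
    rewrite (le_trans (ltW Tz))// -[X in `|X|](subrK (T i y)) addrC (le_trans (ler_normD _ _))//.
    by rewrite lerD2l.
  by rewrite lerD2r.
pose x n := (u n).1; pose r n := (u n).2.
have rpos n : 0 < r n.
  elim: n => [|n IH]; first by have [] := hu 0%N ltr01.
  have := hu n.+1; rewrite /P mkseqS last_rcons -/(r n) => /(_ IH)[].
  by [].
have step n : [/\ r n.+1 <= r n / 2, `|x n.+1 - x n| <= r n / 2 & True].
  by have := hu n.+1; rewrite /P mkseqS last_rcons -/(r n) => /(_ (rpos n))[].
have big n : exists i, forall z, `|z - x n| <= r n + r n -> n%:R <= `|T i z|.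
  case: n => [|n].
    by have [] := hu 0%N ltr01 => _ _ _ [i hi]; exists i => z /hi.
  have := hu n.+1; rewrite /P mkseqS last_rcons -/(r n) => /(_ (rpos n))[_ _ _ [i hi]].
  by exists i => z /hi; rewrite size_rcons size_mkseq.
have nest n k : `|x (n + k)%N - x n| + r (n + k)%N <= r n.
  elim: k n => [|k IH] n; first by rewrite addn0 subrr normr0 add0r.
  rewrite addnS -addSn; have [h1 h2 _] := step n.
  have := IH n.+1 => h3.
  rewrite -(subrKA (x n.+1)) (le_trans (lerD (ler_normD _ _) (lexx _)))//.
  by rewrite addrAC [leRHS]splitr lerD// (le_trans h3).
have rsmall n : r n <= n.+1%:R^-1.
  elim: n => [|n IH].
    have [_ h _ _] := hu 0%N ltr01; rewrite invr1 (le_trans h)//= mul1r.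
    by rewrite invf_le1 ?ltr0n// ler1n.
  have [h1 _ _] := step n; rewrite (le_trans h1)// ler_pdivrMr ?ltr0n// (le_trans IH)//.
  rewrite mulrC ler_pdivlMr ?ltr0n// mulrC ler_pdivrMr ?ltr0n//.
  by rewrite -natrM ler_nat mul2n -addnn addSn ltnS leq_addl.
have cx : cauchy (x @ \oo).
  apply: cauchy_exP => eps e0; have [n ne] := eps_inv e0.
  exists (x n); exists n => // m /= nm; rewrite -ball_normE /= distrC.
  rewrite (le_lt_trans _ ne)// (le_trans _ (rsmall n))// -(subnKC nm).
  by rewrite (le_trans _ (nest n (m - n)%N))// lerDl ltW.
have /cvg_ex[y xy] : cvg (x @ \oo) by exact: cauchy_cvg.
have [c yc] := pw y.
have yn n : exists i, n%:R <= `|T i y|.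
  have [i hi] := big n; exists i; apply: hi.
  have /cvgrPdist_lt/(_ _ (rpos n))[k _ hk] := xy.
  have := hk (n + k)%N (leq_addl _ _); rewrite /= => h.
  rewrite -(subrKA (x (n + k)%N)) (le_trans (ler_normD _ _))// lerD//; first exact: ltW.
  by rewrite (le_trans _ (nest n k))// lerDl ltW.
have c0 : 0 <= c by have [i _] := yn 0%N; exact: le_trans (normr_ge0 _) (yc i).
have [|n] := @eps_inv _ (c + 1)^-1; first by rewrite invr_gt0 ltr_wpDl.
rewrite ltf_pV2 ?posrE ?ltr0n ?ltr_wpDl// -[n.+1%:R]natr1 ltrD2r.
have [i hi] := yn n; move=> /lt_le_trans/(_ (le_trans hi (yc i))).
by rewrite ltxx.
Qed.

End UniformBoundedness.

(** * Weak*-continuous maps are determined by point masses *)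

Section WeakStarContinuity.
Variables (R : realType) (S : Type) (s0 : S).
Local Notation C := R[i].

(** Lets the multiple [a Phi] be written with [bid_scale], the form in which linearity is given. *)
Definition zero_functional : (S -> C) -> C := fun=> 0.

Lemma zero_functional_bidual : bidual zero_functional.
Proof.
split=> //; split=> [f g a _ _|]; first by rewrite /zero_functional mulr0 addr0.
by exists 0; split=> // f d _; rewrite /zero_functional normr0 mul0r.
Qed.

Lemma fsum_dual (a : seq (C * S)) : in_linf_dual (fsum a).
Proof.
split=> [f g c _ _|]; first exact: fsum_lin.
exists (l1norm a); split; first by apply: sumr_ge0.
by move=> f d; exact: fsum_bound.
Qed.

Section Representation.
Variables (E : Type) (T : ((S -> C) -> C) -> E -> C) (x : E).
Hypothesis Tlin : forall Phi Psi a, bidual Phi -> bidual Psi ->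
  T (bid_scale a Phi Psi) x = a * T Phi x + T Psi x.
Hypothesis Tcont : weakstar_cont T.

Lemma T_zero : T zero_functional x = 0.
Proof.
have b := zero_functional_bidual.
have := Tlin (-1) b b; rewrite mulN1r addNr => <-; congr T.
by apply/funext => f; rewrite /bid_scale /zero_functional mulr0 addr0.
Qed.

Lemma T_scale a Phi : bidual Phi -> T (bid_scale a Phi zero_functional) x = a * T Phi x.
Proof.
by move=> bPhi; rewrite Tlin ?T_zero ?addr0//; exact: zero_functional_bidual.
Qed.

(** If [|T delta_k(n)| > n + 1] for all [n], the functionals [delta_k(n) / (n + 1)] tend weak* to
    [0] while their images stay above [1] in modulus. *)
Lemma T_delta_bdd : bdd (fun k => T (delta k) x).
Proof.
apply: contrapT => nb.
have /choice[k hk] n : exists k, n.+1%:R < `|T (delta k) x|.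
  apply: contrapT => h; apply: nb; exists n.+1%:R => k.
  rewrite real_leNgt ?normr_real ?ger0_real ?ler0n//; apply/negP => lt.
  by apply: h; exists k.
have bP n : bidual (bid_scale n.+1%:R^-1 (delta (k n)) zero_functional).
  by apply: bid_scale_bidual; [exact: delta_bidual|exact: zero_functional_bidual].
have dle : directed (fun i j : nat => (i <= j)%N : Prop).
  split; first by exists 0%N.
  split=> //; split; first by move=> i j l; exact: leq_trans.
  by move=> i j; exists (maxn i j); rewrite leq_maxl leq_maxr.
have cv f : bdd f -> net_cvg (fun i j : nat => (i <= j)%N : Prop)
    (fun n => bid_scale n.+1%:R^-1 (delta (k n)) zero_functional f) (zero_functional f).
  move=> bf eps e0; have [c c0 fc] := bddP bf.
  have [|n hn] := @eps_inv _ (eps / c); first by rewrite divr_gt0.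
  exists n => m nm; rewrite /bid_scale /zero_functional addr0 subr0 normrM deltaE//.
  rewrite gtr0_norm ?invr_gt0 ?ltr0n//.
  apply: (@le_lt_trans _ _ (n.+1%:R^-1 * c)).
    by rewrite ler_pM ?invr_ge0// lef_pV2 ?posrE ?ltr0n// ler_nat ltnS.
  by rewrite -ltr_pdivlMr.
have [n hn] := Tcont dle bP zero_functional_bidual cv x ltr01.
have := hn n (leqnn n); rewrite T_zero subr0 T_scale; last exact: delta_bidual.
rewrite normrM gtr0_norm ?invr_gt0 ?ltr0n// mulrC ltr_pdivrMr ?ltr0n// mul1r.
by move=> /(lt_trans (hk n)); rewrite ltxx.
Qed.

Lemma T_fsum (a : seq (C * S)) : T (to_bidual (fsum a)) x = fsum a (fun k => T (delta k) x).
Proof.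
elim: a => [|p a IH].
  rewrite fsum_nil -T_zero; congr T; apply/funext => f.
  by rewrite /to_bidual fsum_nil if_same.
rewrite fsum_cons -IH -Tlin; [|exact: delta_bidual|exact: to_bidualP (fsum_dual a)].
congr T; apply/funext => f; rewrite /bid_scale /delta /to_bidual.
by case: ifP => _; rewrite ?fsum_cons// mulr0 addr0.
Qed.

(* The net is indexed by a finite set of test functions and a tolerance. *)
Lemma weakstar_repr Phi : bidual Phi -> T Phi x = Phi (fun k => T (delta k) x).
Proof.
move=> bPhi; have [[lPhi [K [K0 hK]]] _] := bPhi; set q := fun k => _.
have bq : bdd q := T_delta_bdd.
pose J := (seq (S -> C) * nat)%type.
have inv_gt0 k : 0 < k.+1%:R^-1 :> C by rewrite invr_gt0 ltr0n.
have /choice[a ha] (j : J) : exists a : seq (C * S), forall f, List.In f j.1 -> bdd f ->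
    `|fsum a f - Phi f| <= j.2.+1%:R^-1.
  (* Unbounded test functions in the index are replaced by [0]. *)
  have [|a _ ha] := @finite_goldstine R S s0 Phi K
    [seq (if `[< bdd f >] then f else fun=> 0) | f <- j.1] _ lPhi K0 hK (inv_gt0 j.2).
    move=> g /List.in_map_iff[f [<- _]]; case: asboolP => // _; exact: bdd_cst.
  exists a => f fj bf; apply: ha; apply/List.in_map_iff; exists f; split=> //.
  by rewrite asboolT.
pose le (i j : J) := (forall f, List.In f i.1 -> List.In f j.1) /\ (i.2 <= j.2)%N.
have dle : directed le.
  split; first by exists ([::], 0%N).
  split; first by [].
  split=> [i j k [h1 h2] [h3 h4]|i j].
    by split=> [f /h1/h3//|]; exact: leq_trans h4.
  exists (i.1 ++ j.1, maxn i.2 j.2); split; split=> /= [f fi|].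
  - by apply: List.in_or_app; left.
  - exact: leq_maxl.
  - by apply: List.in_or_app; right.
  - exact: leq_maxr.
have cv f : bdd f -> net_cvg le (fun j => fsum (a j) f) (Phi f).
  move=> bf e e0; have [n ne] := eps_inv e0; exists ([:: f], n) => j [h1 h2].
  rewrite (le_lt_trans _ ne)// (le_trans (ha j f _ bf))//.
    by apply: h1; left.
  by rewrite lef_pV2 ?posrE ?ltr0n// ler_nat ltnS.
have cT := @Tcont J le (fun j => to_bidual (fsum (a j))) Phi dle
   (fun j => to_bidualP (fsum_dual (a j))) bPhi _ x.
have {}cT : net_cvg le (fun j => fsum (a j) q) (T Phi x).
  move=> e e0; have [|i hi] := cT _ e e0.
    move=> f bf e1 e10; have [i hi] := cv f bf e1 e10.
    by exists i => j ij; rewrite to_bidualE//; exact: hi.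
  by exists i => j ij; rewrite -T_fsum; exact: hi.
apply/eqP; rewrite -subr_eq0; apply/eqP/le_eps_eq0 => e e0.
have e2 : 0 < e / 2 by rewrite divr_gt0 ?ltr0n.
have [i hi] := cT _ e2; have [j hj] := cv _ bq _ e2.
have [_ [_ [_ /(_ i j)[k [ik jk]]]]] := dle.
rewrite -(subrKA (fsum (a k) q)) (le_trans (ler_normD _ _))// [leRHS]splitr lerD//.
  by rewrite distrC ltW// hi.
by rewrite ltW// hj.
Qed.

End Representation.

End WeakStarContinuity.

(** * Derivations implemented by a virtual diagonal *)

Section DiagonalToConnesAmenable.
Variables (R : realType) (S : Type) (mul : S -> S -> S) (w : S -> R) (s0 : S).
Local Notation C := R[i].
Local Notation Om := (Omega mul w).
Hypothesis Hw : is_weight mul w.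
Variable e : (S -> C) -> C.
Hypothesis He : bidual_unit mul w e.
Local Notation ar := (arens1 mul w).

Lemma arens1_delta g h :
  ar (delta g) (delta h) = bid_scale (Om g h) (delta (mul g h)) (@zero_functional R S).
Proof.
apply/funext => f; rewrite /bid_scale /zero_functional addr0 /arens1 /delta.
have [bf|nbf] := pselect (bdd f); last by rewrite /to_bidual !asboolF// mulr0.
have [c c0 fc] := bddP bf; have b : bdd2 (fun g h => Om g h * f (mul g h)).
  exact: bdd2_Omega_mul.
rewrite asboolT// [in RHS]to_bidualE// to_bidualE ?to_bidualE//; first exact: bdd2l g b.
exists (1 * c) => k; rewrite to_bidualE; last exact: bdd2l k b.
by rewrite normrM ler_pM// (norm_Omega Hw).
Qed.

Lemma delta_bounded k : fun_bounded_by (delta (R:=R) (S:=S) k) 1.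
Proof. by move=> f d fd; rewrite deltaE ?mul1r//; exists d. Qed.

Variables (E : completeNormedModType C).
Variables (lact : ((S -> C) -> C) -> E -> E) (ract : E -> ((S -> C) -> C) -> E).
Hypothesis Hmod : banach_bimodule mul w lact ract.
Hypothesis Hnormal : forall mu : E -> C, in_dual mu ->
  weakstar_cont (fun Phi => dual_lact ract Phi mu) /\
  weakstar_cont (fun Phi => dual_ract lact mu Phi).
Variable D : ((S -> C) -> C) -> E -> C.
Hypothesis HD : derivation mul w lact ract D.
Hypothesis HDc : weakstar_cont D.

Let be : bidual e. Proof. by case: He. Qed.

Let ee : ar e e = e. Proof. by have [_ /(_ _ be)[]] := He. Qed.

Let dlin (mu : E -> C) a x y : in_dual mu -> mu (a *: x + y) = a * mu x + mu y.
Proof. by case. Qed.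

Let Ddual Phi : bidual Phi -> in_dual (D Phi).
Proof. by case: HD => h _; exact: h. Qed.

Let dbound (mu : E -> C) : in_dual mu -> exists2 c, 0 <= c & forall x, `|mu x| <= c * `|x|.
Proof.
move=> [_ [c hc]]; exists `|c| => [|x]; first exact: normr_ge0.
have cx : 0 <= c * `|x| := le_trans (normr_ge0 _) (hc x).
by rewrite (le_trans (hc x))// -(ger0_norm cx) normrM normr_id.
Qed.

Let actbound : exists2 K : C, 0 <= K & forall Phi c x, bidual Phi -> fun_bounded_by Phi c ->
  `|lact Phi x| <= K * c * `|x| /\ `|ract x Phi| <= K * c * `|x|.
Proof. by have [_ [_ [[K [K0 hK]] _]]] := Hmod; exists K. Qed.

Let ractA x Phi Psi : bidual Phi -> bidual Psi -> ract x (ar Phi Psi) = ract (ract x Phi) Psi.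
Proof. by move=> h1 h2; have [_ [_ [_ /(_ _ _ x h1 h2)[_ []]]]] := Hmod. Qed.

Let lract x Phi Psi : bidual Phi -> bidual Psi -> ract (lact Phi x) Psi = lact Phi (ract x Psi).
Proof. by move=> h1 h2; have [_ [_ [_ /(_ _ _ x h1 h2)[_ []]]]] := Hmod. Qed.

Let ract_lin a x y Phi : bidual Phi -> ract (a *: x + y) Phi = a *: ract x Phi + ract y Phi.
Proof. by move=> h; have [_ [/(_ Phi a x y h)[]]] := Hmod. Qed.

Let dual_lact_lin (mu : E -> C) x : in_dual mu -> forall Phi Psi a, bidual Phi -> bidual Psi ->
  dual_lact ract (bid_scale a Phi Psi) mu x = a * dual_lact ract Phi mu x + dual_lact ract Psi mu x.
Proof.
move=> hmu Phi Psi a h1 h2; rewrite /dual_lact -dlin//; congr mu.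
by have [/(_ _ _ a x h1 h2)[]] := Hmod.
Qed.

Let dual_ract_lin (mu : E -> C) x : in_dual mu -> forall Phi Psi a, bidual Phi -> bidual Psi ->
  dual_ract lact mu (bid_scale a Phi Psi) x = a * dual_ract lact mu Phi x + dual_ract lact mu Psi x.
Proof.
move=> hmu Phi Psi a h1 h2; rewrite /dual_ract -dlin//; congr mu.
by have [/(_ _ _ a x h1 h2)[]] := Hmod.
Qed.

Let D_lin x : forall Phi Psi a, bidual Phi -> bidual Psi ->
  D (bid_scale a Phi Psi) x = a * D Phi x + D Psi x.
Proof. by move=> Phi Psi a h1 h2; have [_ [/(_ _ _ a h1 h2) ->]] := HD. Qed.

Let D_prod x Phi Psi : bidual Phi -> bidual Psi ->
  D (ar Phi Psi) x = D Psi (ract x Phi) + D Phi (lact Psi x).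
Proof. by move=> h1 h2; have [_ [_ /(_ _ _ h1 h2) ->]] := HD. Qed.

Let dual_lact_repr (mu : E -> C) x Phi : in_dual mu -> bidual Phi ->
  mu (ract x Phi) = Phi (fun k => mu (ract x (delta k))).
Proof.
move=> hmu bPhi; have [h _] := Hnormal hmu.
exact: (weakstar_repr s0 (@dual_lact_lin mu x hmu) h bPhi).
Qed.

Let dual_lact_bdd (mu : E -> C) x : in_dual mu -> bdd (fun k => mu (ract x (delta k))).
Proof.
move=> hmu; have [h _] := Hnormal hmu.
exact: (T_delta_bdd (@dual_lact_lin mu x hmu) h).
Qed.

Let dual_ract_repr (mu : E -> C) x Phi : in_dual mu -> bidual Phi ->
  mu (lact Phi x) = Phi (fun k => mu (lact (delta k) x)).
Proof.
move=> hmu bPhi; have [_ h] := Hnormal hmu.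
exact: (weakstar_repr s0 (@dual_ract_lin mu x hmu) h bPhi).
Qed.

Let dual_ract_bdd (mu : E -> C) x : in_dual mu -> bdd (fun k => mu (lact (delta k) x)).
Proof.
move=> hmu; have [_ h] := Hnormal hmu.
exact: (T_delta_bdd (@dual_ract_lin mu x hmu) h).
Qed.

Let D_repr x Phi : bidual Phi -> D Phi x = Phi (fun k => D (delta k) x).
Proof. by move=> bPhi; exact: (weakstar_repr s0 (D_lin x) HDc bPhi). Qed.

Let D_bdd x : bdd (fun k => D (delta k) x).
Proof. exact: (T_delta_bdd (D_lin x) HDc). Qed.

Definition orbit_fun (x : E) (p : S * S) : C := D (delta p.2) (ract x (delta p.1)).

Let db k : bidual (delta (R:=R) (S:=S) k). Proof. exact: delta_bidual. Qed.

(** Weak*-continuity bounds [D delta_k] only pointwise; uniform boundedness gives the estimate in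
    [|x|] that makes [mu0] continuous. *)
Lemma orbit_fun_bound : exists2 B : C, 0 <= B & forall x p, `|orbit_fun x p| <= B * `|x|.
Proof.
have [|B B0 hB] := @uniform_boundedness R E S (fun k => D (delta k)) (fun k => Ddual (db k)).
  by move=> x; have [c hc] := D_bdd x; exists c.
have [K K0 hK] := actbound.
exists (B * K) => [|x p]; first exact: mulr_ge0.
rewrite (le_trans (hB _ _))// -mulrA ler_wpM2l//.
by have [_] := hK _ _ x (db p.1) (@delta_bounded p.1); rewrite mulr1.
Qed.

Lemma orbit_fun_bdd x : bdd (orbit_fun x).
Proof. by have [B B0 hB] := orbit_fun_bound; exists (B * `|x|) => p. Qed.

(** Both sides equal [D Psi (x . Phi)]: normality of the action on [D Psi] and continuity of [D] are
    applied in the two possible orders. *)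
Lemma orbit_fun_swaps x : swaps (fun s t => orbit_fun x (s, t)).
Proof.
move=> Phi Psi hPhi hPsi.
have bPhi := to_bidualP hPhi; have bPsi := to_bidualP hPsi.
have [B B0 hB] := orbit_fun_bound.
transitivity (D (to_bidual Psi) (ract x (to_bidual Phi))).
  rewrite dual_lact_repr//; last exact: Ddual.
  rewrite to_bidualE; last exact: dual_lact_bdd (Ddual bPsi).
  by congr Phi; apply/funext => s; rewrite D_repr// to_bidualE.
rewrite D_repr// to_bidualE; last exact: D_bdd.
congr Psi; apply/funext => t; rewrite dual_lact_repr//; last exact: Ddual.
by rewrite to_bidualE//; exact: dual_lact_bdd (Ddual (db t)).
Qed.

Lemma orbit_fun_lin a x y p : orbit_fun (a *: x + y) p = a * orbit_fun x p + orbit_fun y p.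
Proof. by rewrite /orbit_fun ract_lin// dlin//; exact: Ddual. Qed.

Lemma orbit_fun_ract k x g h :
  orbit_fun (ract x (delta k)) (g, h) = Om k g * orbit_fun x (mul k g, h).
Proof.
rewrite /orbit_fun/= -ractA// arens1_delta.
exact: (@T_scale R S E (fun Phi => dual_lact ract Phi (D (delta h))) x
  (@dual_lact_lin (D (delta h)) x (Ddual (db h)))).
Qed.

(** The derivation rule for [delta_h delta_k], solved for the term with [delta_k . x]; this is the
    pattern of [lactf]. *)
Lemma orbit_fun_lact k x g h :
  orbit_fun (lact (delta k) x) (g, h) = Om h k * orbit_fun x (g, mul h k)
    - Om g h * D (delta k) (ract x (delta (mul g h))).
Proof.
rewrite /orbit_fun/= lract//; have := D_prod (ract x (delta g)) (db h) (db k).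
rewrite arens1_delta (T_scale (D_lin _))// -ractA// arens1_delta => ->.
have := @T_scale R S E (fun Phi => dual_lact ract Phi (D (delta k))) x
  (@dual_lact_lin (D (delta k)) x (Ddual (db k))) (Om g h) _ (db (mul g h)).
by rewrite /dual_lact => ->; rewrite addrC addKr.
Qed.

Variable M : (S * S -> C) -> C.
Hypothesis hM : in_linf_dual M.
Hypothesis M_unit : forall f : S -> C, bdd f ->
  M (fun p => f (mul p.1 p.2) * Om p.1 p.2) = e f.
Hypothesis M_comm : forall (k : S) (f : S * S -> C), bdd f ->
  clusters [set: S]%classic [set: S]%classic f ->
  M (fun p => f (mul p.2 k, p.1) * Om p.2 k - f (p.2, mul k p.1) * Om k p.1) = 0.

Let mu0 (x : E) : C := M (orbit_fun x).

Let mu0_dual : in_dual mu0.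
Proof.
split=> [a x y|].
  rewrite /mu0 -(linfP hM); [|exact: orbit_fun_bdd|exact: orbit_fun_bdd].
  by congr M; apply/funext => p; exact: orbit_fun_lin.
have [B B0 hB] := orbit_fun_bound; have [K K0 hK] := linf_bound hM.
exists (K * B) => x; rewrite -mulrA; apply: hK => [|p]; last exact: hB.
exact: mulr_ge0.
Qed.

(** Condition (2) removes everything but the correction term of [orbit_fun_lact], and (1) at
    [u |-> D delta_k (x . delta_u)] evaluates that term as [D delta_k (x . e)]. *)
Let mu0_delta k x :
  mu0 (ract x (delta k)) - mu0 (lact (delta k) x) = D (delta k) (ract x e).
Proof.
have bF := orbit_fun_bdd x; have [c c0 Fc] := bddP bF.
pose f q := orbit_fun x (q.2, q.1).
have bf : bdd f by exists c => q; exact: Fc.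
have cf : clusters [set: S]%classic [set: S]%classic f.
  apply: dbl_clusters; apply: (@swaps_dbl R S S (fun s t => f (s, t))).
  exact: swapsC (orbit_fun_swaps x).
pose phi u := D (delta k) (ract x (delta u)).
have bphi : bdd phi by exact: dual_lact_bdd (Ddual (db k)).
rewrite (dual_lact_repr x (Ddual (db k)) be) -(M_unit bphi) /mu0 -(linfB hM); [|exact: orbit_fun_bdd|exact: orbit_fun_bdd].
pose T (p : S * S) := f (mul p.2 k, p.1) * Om p.2 k - f (p.2, mul k p.1) * Om k p.1.
have bT : bdd T.
  exists (c * 1 + c * 1) => p; rewrite (le_trans (ler_normB _ _))// !normrM.
  by rewrite lerD// ler_pM ?(norm_Omega Hw)// /f.
have bP : bdd (fun p : S * S => phi (mul p.1 p.2) * Om p.1 p.2).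
  have [d d0 hd] := bddP bphi; exists (d * 1) => p.
  by rewrite normrM ler_pM ?(norm_Omega Hw).
have := M_comm k bf cf; rewrite -/T => MT.
rewrite -[RHS]subr0 -MT -(linfB hM bP bT); congr M; apply/funext => -[g h].
rewrite orbit_fun_ract orbit_fun_lact /T /f /phi /=; ring.
Qed.

Let mu0_eq x Phi : bidual Phi -> mu0 (ract x Phi) - mu0 (lact Phi x) = D Phi (ract x e).
Proof.
move=> bPhi; rewrite dual_lact_repr// dual_ract_repr// -linfB; last first.
- exact: dual_ract_bdd.
- exact: dual_lact_bdd.
- by case: bPhi.
by rewrite D_repr//; congr Phi; apply/funext => k; exact: mu0_delta.
Qed.

Lemma derivation_inner : inner_derivation lact ract D.
Proof.
have De := Ddual be; have [K K0 hK] := actbound.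
have [[_ [L [L0 hL]]] _] := be.
exists (fun x => mu0 x + (D e (ract x e) - D e x)); split.
  split=> [a x y|].
    by rewrite (dlin a x y mu0_dual) ract_lin// !dlin//; ring.
  have [a a0 ha] := dbound mu0_dual; have [b b0 hb] := dbound De.
  exists (a + (b * (K * L) + b)) => x; rewrite !mulrDl (le_trans (ler_normD _ _))// lerD//.
  rewrite (le_trans (ler_normB _ _))// lerD// (le_trans (hb _))// -[leRHS]mulrA ler_wpM2l//.
  by have [] := hK _ _ x be hL.
move=> Phi bPhi; apply/funext => x; rewrite /dual_lact /dual_ract.
(* The derivation rule for [e Phi = Phi], solved for [De . Phi]. *)
have eP y : D e (lact Phi y) = D Phi y - D Phi (ract y e).
  have := D_prod y be bPhi; have [_ /(_ _ bPhi)[-> _]] := He.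
  by move=> ->; rewrite addrC addKr.
(* Since [Phi e = Phi], the summand [e . De - De] vanishes at [x . Phi] and contributes only through
   the left action. *)
have E1 : ract (ract x Phi) e = ract x Phi.
  by rewrite -ractA//; have [_ /(_ _ bPhi)[_ ->]] := He.
have E2 : ract (lact Phi x) e = lact Phi (ract x e) by exact: lract.
have E3 : ract (ract x e) e = ract x e by rewrite -ractA// ee.
have := mu0_eq x bPhi => E4.
rewrite E1 E2 !eP E3.
transitivity ((mu0 (ract x Phi) - mu0 (lact Phi x)) + (D Phi x - D Phi (ract x e))); last by ring.
by rewrite E4; ring.
Qed.

End DiagonalToConnesAmenable.

Theorem theorem5p9 (R : realType) (S : Type) (mul : S -> S -> S) (w : S -> R)
  (Hassoc : semigroup_assoc mul)
  (Hinf : infinite_set [set: S])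
  (Hwc : weakly_cancellative mul)
  (Hw : is_weight mul w)
  (Hreg : arens_regular mul w)
  (e : (S -> R[i]) -> R[i]) (He : bidual_unit mul w e) :
  connes_amenable mul w <->
  exists M : (S * S -> R[i]) -> R[i],
    in_linf_dual M /\
    (forall f : S -> R[i], bdd f ->
       M (fun p => f (mul p.1 p.2) * Omega mul w p.1 p.2) = e f) /\
    (forall (k : S) (f : S * S -> R[i]), bdd f -> clusters [set: S] [set: S] f ->
       M (fun p => f (mul p.2 k, p.1) * Omega mul w p.2 k
                   - f (p.2, mul k p.1) * Omega mul w k p.1) = 0).
Proof.
have /set0P[s0 _] : [set: S]%classic != set0.
  by apply/eqP => S0; apply: Hinf; rewrite S0; exact: finite_set0.
split; first exact: connes_amenable_diagonal.
move=> [M [hM [M1 M2]]] E lact ract Hmod Hnormal D HD HDc.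
exact: (derivation_inner s0 Hw He Hmod Hnormal HD HDc hM M1 M2).
Qed.
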